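(* Let $(G,\star)$ be a compact connected $n$-dimensional Lie group with identity $e$ and Lie algebra $\mathcal{L}=T_eG$, and let $\{\frac{\partial}{\partial g_1},\dots,\frac{\partial}{\partial g_n}\}$ be a basis of $\mathcal{L}$. Let $J:G\to\mathbb{R}_{\ge 0}$ be a smooth function which is locally positive definite in a neighborhood of a unique local minimum $g^*\in G$, with $J(g^* )=0$. Let $\bar\omega_1,\dots,\bar\omega_n>0$ be rational numbers such that $\bar\omega_i\neq\bar\omega_j$ and $2\bar\omega_i\neq\bar\omega_j$ whenever $i\neq j$, and $\bar\omega_i\neq\bar\omega_j+\bar\omega_k$ for all distinct $i,j,k$. For $\omega>0$ put $\omega_i=\omega\bar\omega_i$, and for $a_1,\dots,a_n>0$ consider the extremum seeking system $$\dot g(t)=f(g(t),t),\qquad f(g,t)=-\sum_{i=1}^n a_i\sin(\omega_i t)\,J\Big(g\star\exp\Big(\sum_{j=1}^n a_j\sin(\omega_j t)\frac{\partial}{\partial g_j}\Big)\Big)\,T_eg\Big(\frac{\partial}{\partial g_i}\Big)\in T_gG .$$ Then for any neighborhood $U_{g^*}\subset G$ of $g^*$ there exist sufficiently small parameters $a_i>0$ ($i=1,\dots,n$), a sufficiently large $\omega>0$, and a neighborhood $\hat U_{g^*}\subset G$ of $g^*$ such that for any $g_0\in\hat U_{g^*}$ the solution with $g(0)=g_0$ ultimately enters and remains in $U_{g^*}$, i.e. it exists for all $t\ge 0$ and there is a time $T_0\ge 0$ with $g(t)\in U_{g^*}$ for all $t\ge T_0$.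
   Context: $\exp:\mathcal{L}\to G$ is the Lie group exponential map. For $g\in G$, $T_eg:T_eG\to T_gG$ denotes the differential at $e$ of the left translation $h\mapsto g\star h$. ''Locally positive definite around $g^*$'' means $J(g^* )=0$ and $J(g)>0$ for all $g\neq g^*$ in some neighborhood of $g^*$. *)

(* Defs.v *)
From HB Require Import structures.
From mathcomp Require Import all_boot all_order all_algebra.
From mathcomp Require Import all_classical all_reals all_analysis.
Set Implicit Arguments.
Unset Strict Implicit.
Unset Printing Implicit Defensive.
Import Order.TTheory GRing.Theory Num.Theory.
Import numFieldNormedType.Exports.
Local Open Scope classical_set_scope.
Local Open Scope ring_scope.

(* All iterated directional derivatives of f up to order k exist and are
   continuous at every point of A; only meant for open A. *)
Fixpoint Ck (R : realType) (V W : normedModType R) (k : nat) (A : set V)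
    (f : V -> W) : Prop :=
  (forall x, A x -> {for x, continuous f}) /\
  if k is k'.+1 then
    forall v, (forall x, A x -> derivable f x v) /\ Ck k' A ('D_v f)
  else True.

Definition smooth_on (R : realType) (V W : normedModType R) (A : set V)
    (f : V -> W) : Prop :=
  forall k, Ck k A f.

(* Charts are total functions; their values outside chart_dom, resp. outside
   the image of chart_dom, are junk and never matter. *)
Record chart (R : realType) (n : nat) (M : topologicalType) := Chart {
  chart_dom : set M;
  chart_coord : M -> 'rV[R]_n;
  chart_inv : 'rV[R]_n -> M;
  chart_dom_open : open chart_dom;
  chart_img_open : open (chart_coord @` chart_dom);
  chart_coordK : forall x, chart_dom x -> chart_inv (chart_coord x) = x;
  chart_coord_cts :
    forall x, chart_dom x -> {for x, continuous chart_coord};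
  chart_inv_cts :
    forall u, (chart_coord @` chart_dom) u -> {for u, continuous chart_inv}
}.

Definition chart_img (R : realType) (n : nat) (M : topologicalType)
    (c : chart R n M) : set 'rV[R]_n :=
  chart_coord c @` chart_dom c.

(* chart_at x is a chosen chart around x, in whose coordinates the tangent
   space at x is represented (see tangent). *)
HB.mixin Record isManifold (R : realType) (n : nat) M of Topological M := {
  atlas : set (chart R n M);
  chart_at : M -> chart R n M;
  atlas_chart_at : forall x, atlas (chart_at x);
  chart_at_dom : forall x, chart_dom (chart_at x) x;
  atlas_compat : forall c d : chart R n M, atlas c -> atlas d ->
    smooth_on (chart_coord c @` (chart_dom c `&` chart_dom d))
              (chart_coord d \o chart_inv c);
  manifold_hausdorff : hausdorff_space M;
  manifold_second_countable : @second_countable M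
}.

#[short(type="manifoldType")]
HB.structure Definition Manifold (R : realType) (n : nat) :=
  {M of isManifold R n M & Topological M}.

HB.mixin Record isLieGroup (R : realType) (n : nat) G
    of Manifold R n G & Group G := {
  mulg_cts : continuous (fun p : G * G => (p.1 * p.2)%g);
  mulg_smooth : forall c1 c2 c3 : chart R n G,
    atlas c1 -> atlas c2 -> atlas c3 ->
    smooth_on
      [set u : 'rV[R]_n * 'rV[R]_n | [/\ chart_img c1 u.1, chart_img c2 u.2 &
         chart_dom c3 (chart_inv c1 u.1 * chart_inv c2 u.2)%g]]
      (fun u => chart_coord c3 (chart_inv c1 u.1 * chart_inv c2 u.2)%g);
  invg_cts : continuous (fun g : G => g^-1%g);
  invg_smooth : forall c1 c2 : chart R n G, atlas c1 -> atlas c2 ->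
    smooth_on
      [set u | chart_img c1 u /\ chart_dom c2 (chart_inv c1 u)^-1%g]
      (fun u => chart_coord c2 (chart_inv c1 u)^-1%g)
}.

#[short(type="lieGroupType")]
HB.structure Definition LieGroup (R : realType) (n : nat) :=
  {G of isLieGroup R n G & Manifold R n G & Group G}.

Section Manifolds.
Variables (R : realType) (n : nat) (M : manifoldType R n).

(* A tangent vector at x is given by its components with respect to the
   coordinate basis of chart_at x. *)
Definition tangent (x : M) := 'rV[R]_n.

Definition smooth_fun (f : M -> R) : Prop :=
  forall c : chart R n M, atlas c ->
    smooth_on (chart_img c) (f \o chart_inv c : 'rV[R]_n -> R^o).

(* The curve p, defined on the set of times D, is at time t continuous and
   differentiable relatively to D, with velocity v; at an endpoint of an
   interval D this is a one-sided derivative. *)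
Definition has_velocity (D : set R) (p : R -> M) (t : R)
    (v : tangent (p t)) : Prop :=
  p s @[s --> within D (nbhs t)] --> p t /\
  (s - t)^-1 *: (chart_coord (chart_at (p t)) (p s) -
                 chart_coord (chart_at (p t)) (p t))
    @[s --> within D t^'] --> v.

Definition integral_curve (D : set R) (f : forall x : M, R -> tangent x)
    (p : R -> M) : Prop :=
  forall t, D t -> has_velocity D (f (p t) t).

Definition local_min (J : M -> R) (x : M) : Prop :=
  \forall y \near x, J x <= J y.

Definition unique_local_min (J : M -> R) (x : M) : Prop :=
  local_min J x /\ forall y, local_min J y -> y = x.

Definition locally_posdef (J : M -> R) (x : M) : Prop :=
  J x = 0 /\ \forall y \near x, y != x -> 0 < J y.

End Manifolds.

Section LieGroups.
Variables (R : realType) (n : nat) (G : lieGroupType R n).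

(* The differential at the identity of h |-> g * h, read in chart_at 1 and
   chart_at g. *)
Definition left_diff (g : G) (v : tangent (1%g : G)) : tangent g :=
  'd ((fun u => chart_coord (chart_at g)
                  (g * chart_inv (chart_at (1%g : G)) u)%g)
        : 'rV[R]_n -> 'rV[R]_n)
     (chart_coord (chart_at (1%g : G)) 1%g) v.

(* Value at time 1 of the integral curve through the identity of the
   left-invariant vector field generated by v. *)
Definition lie_exp (v : tangent (1%g : G)) : G :=
  xget 1%g [set x | exists p : R -> G,
    [/\ p 0 = 1%g, integral_curve setT (fun g _ => left_diff g v) p
      & p 1 = x]].

Definition es_field (X : n.-tuple (tangent (1%g : G))) (J : G -> R)
    (a w : 'I_n -> R) (g : G) (t : R) : tangent g :=
  - \sum_(i < n)
      (a i * sin (w i * t) *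
       J (g * lie_exp (\sum_(j < n) (a j * sin (w j * t)) *: tnth X j))%g)
      *: left_diff g (tnth X i).

Definition es_solution (X : n.-tuple (tangent (1%g : G))) (J : G -> R)
    (a w : 'I_n -> R) (g0 : G) (p : R -> G) : Prop :=
  p 0 = g0 /\ integral_curve [set t | 0 <= t] (es_field X J a w) p.

End LieGroups.

(* Main.v *)
From HB Require Import structures.
Require Import Defs.
From mathcomp Require Import all_boot all_order all_algebra.
From mathcomp Require Import all_classical all_reals all_analysis.
From mathcomp Require Import ring lra.

(* By Sard's theorem J, read in a chart around g^*, has regular values c
   arbitrarily close to 0.  Choose a box around g^* inside U and such a c below
   the minimum of J on its boundary.  With equal amplitudes a_i = a, and
   because exp (v) = v + O(|v|^2) in the chart,
   J (g * exp (a sum sin_j X_j)) = J + a sum sin_j X_j J + O(a^2), so that along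
   the system J' = - a sum sin_i (J + a sum sin_j X_j J) X_i J + O(a^3).
   Subtracting primitives in time of the oscillating terms, which are O(a/om),
   gives W = J + O(a/om) with
   W' = - (a^2/2) sum (X_i J)^2 + O(a^3 + a^2/om).
   On the level J = c the sum of
   squares is bounded below, hence for a small and om large W cannot reach c
   from below, and solutions starting near g^* stay in the box forever.
   Existence is Picard's theorem for the field extended by clamping to the box.
   The exponential map is only given by a choice among integral curves, whose
   existence is again Picard's theorem followed by extension through group
   translations. *)

Set Implicit Arguments.
Unset Strict Implicit.
Unset Printing Implicit Defensive.
Import Order.TTheory GRing.Theory Num.Theory.
Import numFieldNormedType.Exports.
Local Open Scope classical_set_scope.
Local Open Scope ring_scope.

(** * C^k functions of several variables *)

(** A strict local minimum gives no control over the gradient of J: the Hessian at g^* may vanish,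
    and critical points that are not minima may accumulate at g^*. So no decrease of J holds
    uniformly around g^*, and convergence is out of reach. Trapping needs less: strict decrease near
    a single level surrounding g^*. Sard's theorem supplies the level, and compactness thickens it
    to a band |J - c| <= ka, which absorbs the difference between J and W. The sum of squares has
    the factor 1/2 because distinct frequencies leave a nonzero mean, namely 1/2, only in the
    diagonal products sin_i sin_i. The gain a^2 competes with errors a^3 and a^2/om, so a is fixed
    before om, and the bounds on the field must be uniform in om. Neither for the system nor for the
    exponential is a curve tied to the one that Picard's theorem constructs: every estimate is
    proved for an arbitrary integral curve, and the trapping argument serves both to continue the
    constructed solution and to confine every other one. *)

Section RowNorm.
Variables (R : realType) (n : nat).
Implicit Types x y : 'rV[R]_n.

Lemma rV_norm_le x (e : R) : 0 <= e ->
  (`|x| <= e) = [forall i, `|x 0 i| <= e].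
Proof.
move=> e0; apply/idP/forallP => [xe i|xe].
  apply: le_trans xe; rewrite [leRHS]/Num.Def.normr/= mx_normrE.
  exact: (le_bigmax _ (fun i => `|x i.1 i.2|) (0, i)).
rewrite /Num.Def.normr/= mx_normrE (bigmax_le _ e0)//= => -[i j] _ /=.
by rewrite ord1.
Qed.

Lemma rV_coord_le x i : `|x 0 i| <= `|x|.
Proof. by move: (lexx `|x|); rewrite rV_norm_le// => /forallP. Qed.

Lemma closed_box_compact (x0 : 'rV[R]_n) (r : R) :
  compact [set x : 'rV[R]_n | `|x - x0| <= r].
Proof.
apply: bounded_closed_compact.
  exists (`|x0| + r); split=> [|M ltM x /= xr]; first by rewrite num_real.
  rewrite (le_trans _ (ltW ltM))// -(subrK x0 x) addrC.
  by rewrite (le_trans (ler_normD _ _))// lerD2l.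
rewrite (_ : [set _ | _] = closed_ball_ (fun z => `|z|) x0 r); last first.
  by apply/seteqP; split=> x /=; rewrite distrC.
exact: closed_closed_ball_.
Qed.

Lemma row_sum_coord x : x = \sum_i x 0 i *: 'e_i.
Proof. exact: row_sum_delta. Qed.

End RowNorm.

Lemma near_dist_le (R : realType) (V : normedModType R) (x : V) (e : R) :
  0 < e -> \forall y \near x, `|x - y| <= e.
Proof.
move=> e0; apply/nbhs_ballP; exists e => // y; rewrite -ball_normE /=; exact: ltW.
Qed.

Lemma eps_continuous (R : realType) (V W : normedModType R) (f : V -> W) x :
  (forall e, 0 < e -> \forall y \near x, `|f x - f y| <= e) -> {for x, continuous f}.
Proof. by move=> H; apply/cvgrPdist_le. Qed.

Lemma continuous_dist_le (R : realType) (V W : normedModType R) (f : V -> W) x e :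
  {for x, continuous f} -> 0 < e -> \forall y \near x, `|f x - f y| <= e.
Proof. by move=> cf e0; exact: (cvgr_dist_le _ _ cf _ e0). Qed.

Lemma continuous_rV (R : realType) (V : normedModType R) n (h : V -> 'rV[R]_n) x :
  (forall i, {for x, continuous (fun y => h y 0 i)}) -> {for x, continuous h}.
Proof.
move=> ch; apply: eps_continuous => e e0.
have : \forall t \near x, forall i, `|h x 0 i - h t 0 i| <= e.
  apply: (@filter_forall _ 'I_n (fun i t => `|h x 0 i - h t 0 i| <= e) (nbhs x) _) => i.
  exact: (continuous_dist_le (ch i) e0).
apply: filterS => y H; rewrite rV_norm_le ?(ltW e0)//.
by apply/forallP => i; have := H i; rewrite !mxE.
Qed.

Section Frechet.
Variables (R : realType) (V W : normedModType R).

Lemma differentiable_eps (f : V -> W) x : differentiable f x ->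
  forall e, 0 < e -> \forall y \near x,
    `|f y - f x - 'd f x (y - x)| <= e * `|y - x|.
Proof.
move=> df e e0; have /diff_locally/eqaddoP/(_ _ e0) H := df.
rewrite (near_shift 0) /=; apply: filterS H => h /=.
by rewrite subr0 addrK opprD addrA.
Qed.

Lemma eps_differentiable (f : V -> W) x (L : {linear V -> W}) :
  continuous L ->
  (forall e, 0 < e -> \forall y \near x,
    `|f y - f x - L (y - x)| <= e * `|y - x|) ->
  differentiable f x /\ 'd f x = L :> (V -> W).
Proof.
move=> Lc fL.
have H : f \o shift x = cst (f x) + L +o_ 0 id.
  apply/eqaddoP => e e0.
  have := fL _ e0; rewrite (near_shift 0) /= => H.
  near=> h; have /= : `|f (h + x) - f x - L (h + x - x)| <= e * `|h + x - x|.
    by near: h; apply: filterS H => h /=; rewrite subr0.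
  by rewrite addrK /= opprD addrA.
have dE := diff_unique Lc H; split=> //.
apply/diff_locallyP; split; first by rewrite dE.
by rewrite dE.
Unshelve. all: by end_near. Qed.

End Frechet.

Section SegmentMVT.
Variables (R : realType) (V : normedModType R).

Lemma is_derive_line (f : V -> R) x v (t : R) : derivable f (x + t *: v) v ->
  is_derive t 1 (fun s : R => f (x + s *: v)) ('D_v f (x + t *: v)).
Proof.
move=> df.
have E : (fun h : R => h^-1 *: ((f (x + (h *: (1:R) + t) *: v)) -
    f (x + t *: v))) =
  (fun h : R => h^-1 *: ((f (h *: v + (x + t *: v))) - f (x + t *: v))).
  apply/funext => h; rewrite scalerDl [h *: 1]mulr1; congr (_ *: (f _ - _)).
  by rewrite addrCA.
by apply: DeriveDef; rewrite /derivable /derive E.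
Qed.

Lemma MVT_line (f : V -> R) x v :
  (forall t : R, 0 <= t <= 1 -> derivable f (x + t *: v) v) ->
  exists2 t : R, 0 <= t <= 1 & f (x + v) - f x = 'D_v f (x + t *: v).
Proof.
move=> df; pose g (s : R) := f (x + s *: v).
have gd (t : R) : 0 <= t <= 1 -> is_derive t 1 g ('D_v f (x + t *: v)).
  by move=> t01; apply: is_derive_line; exact: df.
have [||t /[!in_itv] /= t01 E] :=
  @MVT R g (fun t => 'D_v f (x + t *: v)) 0 1 ltr01.
- by move=> t /[!in_itv] /= /andP[t0 t1]; apply: gd; rewrite !ltW.
- apply: derivable_within_continuous => t /[!in_itv] /= t01.
  by apply: ex_derive; exact: gd.
exists t; first by case/andP: t01 => *; rewrite !ltW.
by move: E; rewrite /g scale1r scale0r addr0 subr0 mulr1.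
Qed.

End SegmentMVT.

Section CkBasics.
Variables (R : realType) (V W : normedModType R).
Implicit Types (f g : V -> W) (A B : set V).

Lemma Ck_subset k A B f : B `<=` A -> Ck k A f -> Ck k B f.
Proof.
move=> BA; elim: k f => [|k IH] f [cf H]; first by split=> // x /BA /cf.
split=> [x /BA /cf //|v].
by have [df Hv] := H v; split; [move=> x /BA /df|exact: IH].
Qed.

Lemma Ck_le k l A f : (k <= l)%N -> Ck l A f -> Ck k A f.
Proof.
elim: k l f => [|k IH] [|l] f kl [cf H] //; split=> // v.
by have [df Hv] := H v; split=> //; exact: IH Hv.
Qed.

Lemma for_continuous_near (S T : topologicalType) (f g : S -> T) x :
  {near x, f =1 g} -> {for x, continuous f} -> {for x, continuous g}.
Proof.
move=> fg; rewrite /prop_for /continuous_at -(nbhs_singleton fg) => cf.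
by apply: cvg_trans cf; apply: near_eq_cvg; apply: filterS fg.
Qed.

Lemma Ck_eq k A f g : open A -> {in A, f =1 g} -> Ck k A f -> Ck k A g.
Proof.
move=> oA; elim: k f g => [|k IH] f g fg [cf H].
all: have nfg x : A x -> {near x, f =1 g} by move=> Ax;
  have := open_nbhs_nbhs (conj oA Ax); apply: filterS => y /mem_set; exact: fg.
  by split=> // x Ax; apply: for_continuous_near (cf _ Ax); exact: nfg.
split=> [x Ax|v]; first by apply: for_continuous_near (cf _ Ax); exact: nfg.
have [df Hv] := H v; split=> [x Ax|].
  by apply: near_eq_derivable (df _ Ax); exact: nfg.
apply: IH Hv => x /set_mem Ax; apply: near_eq_derive; exact: nfg.
Qed.

Lemma Ck_continuous k A f x : Ck k A f -> A x -> {for x, continuous f}.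
Proof. by case: k => [|k] [cf _]; exact: cf. Qed.

Lemma Ck_derivable k A f x v : Ck k.+1 A f -> A x -> derivable f x v.
Proof. by case=> _ /(_ v) [df _]; exact: df. Qed.

Lemma Ck_derive k A f v : Ck k.+1 A f -> Ck k A ('D_v f).
Proof. by case=> _ /(_ v) []. Qed.

Lemma Ck_cst k A (w : W) : Ck k A (fun=> w).
Proof.
elim: k w => [|k IH] w; first by split=> // x _; exact: cvg_cst.
split=> [x _|v]; first exact: cvg_cst.
split=> [x _|]; first exact: derivable_cst.
rewrite (_ : 'D_v _ = fun=> 0); first exact: IH.
by apply/funext => x; rewrite derive_cst.
Qed.

Lemma CkD k A f g : open A -> Ck k A f -> Ck k A g -> Ck k A (fun x => f x + g x).
Proof.
move=> oA; elim: k f g => [|k IH] f g [cf Hf] [cg Hg].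
  by split=> // x Ax; apply: cvgD; [exact: cf|exact: cg].
split=> [x Ax|v]; first by apply: cvgD; [exact: cf|exact: cg].
have [df Df] := Hf v; have [dg Dg] := Hg v; split=> [x Ax|].
  by apply: derivableD; [exact: df|exact: dg].
apply: Ck_eq (IH _ _ Df Dg) => // x /set_mem Ax; rewrite deriveD//.
  exact: df.
exact: dg.
Qed.

Lemma Ck_sum k A n (F : 'I_n -> V -> W) : open A -> (forall i, Ck k A (F i)) ->
  Ck k A (fun x => \sum_i F i x).
Proof.
move=> oA; elim: n F => [|n IH] F HF.
  rewrite (_ : (fun _ => _) = fun=> 0); first exact: Ck_cst.
  by apply/funext => x; rewrite big_ord0.
rewrite (_ : (fun _ => _) = fun x => F ord0 x + \sum_i F (lift ord0 i) x).
  by apply: CkD => //; exact: IH.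
by apply/funext => x; rewrite big_ord_recl.
Qed.

End CkBasics.

Section CkScalar.
Variables (R : realType) (V : normedModType R).
Implicit Types (f g : V -> R) (A B : set V).

Lemma CkM k A f g : open A -> Ck k A f -> Ck k A g -> Ck k A (fun x => f x * g x).
Proof.
move=> oA; elim: k f g => [|k IH] f g [cf Hf] [cg Hg].
  by split=> // x Ax; apply: cvgM; [exact: cf|exact: cg].
split=> [x Ax|v]; first by apply: cvgM; [exact: cf|exact: cg].
have [df Df] := Hf v; have [dg Dg] := Hg v; split=> [x Ax|].
  by apply: derivableM; [exact: df|exact: dg].
have Cf : Ck k A f by apply: Ck_le (leqnSn k) _.
have Cg : Ck k A g by apply: Ck_le (leqnSn k) _.
apply: (@Ck_eq _ _ _ _ _ (fun x => f x * 'D_v g x + g x * 'D_v f x)) => //.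
  move=> x /set_mem Ax; rewrite deriveM//; first exact: df.
  exact: dg.
by apply: CkD => //; exact: IH.
Qed.

Lemma CkV k A f : open A -> (forall x, A x -> f x != 0) -> Ck k A f ->
  Ck k A (fun x => (f x)^-1).
Proof.
move=> oA f0; elim: k => [|k IH] Cf.
  by split=> // x Ax; apply: cvgV; [exact: f0|exact: Cf.1].
split=> [x Ax|v]; first by apply: cvgV; [exact: f0|exact: Cf.1].
have [df Df] := Cf.2 v; split=> [x Ax|].
  exact: (derivableV (f0 _ Ax) (df _ Ax)).
have {}IH := IH (Ck_le (leqnSn k) Cf).
apply: (@Ck_eq _ _ _ _ _ (fun x => -1 * ((f x)^-1 * (f x)^-1) * 'D_v f x)) => //.
  move=> x /set_mem Ax; rewrite deriveV; [|exact: f0|exact: df].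
  by rewrite -expr2 exprVn mulN1r.
by apply: CkM => //; apply: CkM => //; [exact: Ck_cst|exact: CkM].
Qed.

End CkScalar.

(** Homogeneity in the direction holds without differentiability, by substituting [c * h] for [h].
    This lets it be used in the proof that C^1 functions are differentiable. *)
Lemma is_derive_scale (R : realType) (V : normedModType R) (f : V -> R) z v c :
  derivable f z v -> is_derive z (c *: v) f (c * 'D_v f z).
Proof.
move=> dz; have [->|c0] := eqVneq c 0.
  by rewrite scale0r mul0r; exact: is_derive0.
suff H : (fun h => h^-1 *: (f (h *: (c *: v) + z) - f z)) @ 0^' --> c * 'D_v f z.
  by apply: DeriveDef; [apply/cvg_ex; eexists; exact: H|exact: cvg_lim H].
have sc : (c * k) @[k --> 0^'] --> (0 : R)^'.
  move=> B /= [d d0 dB]; exists (d / `|c|); first by rewrite /= divr_gt0// normr_gt0.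
  move=> s /=; rewrite sub0r normrN => sd s0; apply: dB; last by rewrite mulf_neq0.
  by rewrite /= sub0r normrN normrM mulrC -ltr_pdivlMr// normr_gt0.
have H0 : (c * (h^-1 *: (f (h *: v + z) - f z))) @[h --> 0^'] --> c * 'D_v f z.
  exact: cvgMl_tmp dz.
have := cvg_comp _ _ sc H0.
apply: cvg_trans; apply: near_eq_cvg; near=> s.
have s0 : s != 0 by near: s; exact: nbhs_dnbhs_neq.
rewrite /= [s *: (c *: v)]scalerA [s * c]mulrC.
have sE (y : R) : s^-1 *: y = c * ((c * s)^-1 *: y).
  by rewrite /GRing.scale /= invfM !mulrA mulfV// mul1r.
by rewrite sE.
Unshelve. all: by end_near. Qed.

Section CkRow.
Variables (R : realType).

Lemma Ck_coord (V : normedModType R) n k (A : set V) (f : V -> 'rV[R]_n) i :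
  open A -> Ck k A f -> Ck k A (fun x => f x 0 i).
Proof.
move=> oA; elim: k f => [|k IH] f [cf Hf].
  split=> // x Ax.
  exact: (@continuous_comp _ _ _ f (fun M : 'rV[R]_n => M 0 i) x (cf _ Ax)
    (@coord_continuous _ _ _ _ _ _)).
split=> [x Ax|v].
  exact: (@continuous_comp _ _ _ f (fun M : 'rV[R]_n => M 0 i) x (cf _ Ax)
    (@coord_continuous _ _ _ _ _ _)).
have [df Df] := Hf v; split=> [x Ax|].
  by move: (df _ Ax) => /derivable_mxP /(_ 0 i).
apply: Ck_eq (IH _ Df) => // x /set_mem Ax.
by rewrite derive_mx ?mxE//; exact: df.
Qed.

Section C1.
Variables (n : nat) (A : set 'rV[R]_n) (f : 'rV[R]_n -> R).
Hypotheses (oA : open A) (Cf : Ck 1 A f).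

(* Increments are taken one coordinate at a time, so that only partial
   derivatives and the one-dimensional mean value theorem are involved. *)
Lemma Ck1_differentiable x : A x -> differentiable f x /\
  forall v, 'd f x v = \sum_i v 0 i * 'D_('e_i) f x.
Proof.
move=> Ax; pose L0 (v : 'rV[R]_n) : R := \sum_i v 0 i * 'D_('e_i) f x.
have Llin : linear L0.
  move=> a u v; rewrite /L0 scaler_sumr -big_split /=; apply: eq_bigr => i _.
  by rewrite !mxE mulrDl /GRing.scale /= mulrA.
pose LM := GRing.isLinear.Build _ _ _ _ _ Llin.
pose L : {linear 'rV[R]_n -> R} := HB.pack L0 LM.
have Lc : continuous L.
  suff C0 : Ck 0 setT L0 by move=> u; exact: Ck_continuous C0 _.
  apply: (Ck_sum openT) => i; split=> // u _.
  apply: (@cvgMr_tmp _ _ (nbhs u) _ (fun x : 'rV[R]_n => x 0 i)).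
  exact: (@coord_continuous _ _ _ 0 i u).
suff H e : 0 < e -> \forall y \near x,
    `|f y - f x - L (y - x)| <= n%:R * e * `|y - x|.
  have [|d1 d2] := @eps_differentiable _ _ _ f x L Lc; last by split=> // v; rewrite d2.
  (* The denominator is [n%:R + 1] because [n] may be 0. *)
  move=> e e0; have e'0 : 0 < e / (n%:R + 1) by rewrite divr_gt0.
  apply: filterS (H _ e'0) => y /le_trans; apply; apply: ler_wpM2r => //.
  by rewrite mulrCA ler_piMr ?(ltW e0)// ler_pdivrMr// mul1r lerDl.
move=> e0.
have near_e : \forall y \near x, A y /\ forall i, `|'D_('e_i) f y - 'D_('e_i) f x| <= e.
  apply: filterI; first exact: open_nbhs_nbhs.
  apply: (@filter_forall _ 'I_n
    (fun i y => `|'D_('e_i) f y - 'D_('e_i) f x| <= e) (nbhs x) _) => i.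
  have := Ck_continuous (Ck_derive 'e_i Cf) Ax.
  by move=> /cvgrPdist_le /(_ _ e0); apply: filterS => y; rewrite distrC.
have /nbhs_ballP [r /= r0 Hr] := near_e.
apply/nbhs_ballP; exists r => //= y; rewrite -ball_normE /= distrC => yr.
have [h hE] : {h | h = y - x} by exists (y - x).
(* The points [x + p k] form a staircase from [x] to [x + h]; in the sup norm it stays in the
   ball. *)
rewrite -hE in yr *; pose p (k : nat) : 'rV[R]_n := \row_i (if (i < k)%N then h 0 i else 0).
have pin k (i : 'I_n) t : (k <= i)%N -> `|t| <= `|h 0 i| -> ball x r (x + p k + t *: 'e_i).
  move=> ki ti; rewrite -ball_normE /= distrC addrC -addrA addKr.
  apply: le_lt_trans yr; rewrite rV_norm_le//; apply/forallP => j.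
  rewrite !mxE /=; case: (ltnP j k) => jk.
    have -> : (j == i) = false.
      by apply/negP => /eqP ji; rewrite ji ltnNge ki in jk.
    by rewrite mulr0 addr0 rV_coord_le.
  rewrite add0r; case: eqP => [_|_]; last by rewrite mulr0 normr0.
  by rewrite mulr1 (le_trans ti)// rV_coord_le.
have step k : (k <= n)%N ->
    `|f (x + p k) - f x - \sum_(i < n | (i < k)%N) h 0 i * 'D_('e_i) f x| <= k%:R * e * `|h|.
  elim: k => [|k IH] kn.
    rewrite big_pred0// (_ : p 0%N = 0) ?addr0 ?subrr ?normr0 ?mul0r//.
    by apply/rowP => i; rewrite !mxE.
  pose i := Ordinal kn.
  have pS : p k.+1 = p k + h 0 i *: 'e_i.
    apply/rowP => j; rewrite !mxE ltnS leq_eqVlt /=.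
    have -> : (nat_of_ord j == k) = (j == i) by [].
    case: eqP => [->|_] /=; first by rewrite ltnn add0r mulr1.
    by rewrite mulr0 addr0.
  have [|t t01 E] := @MVT_line _ _ f (x + p k) (h 0 i *: 'e_i).
    move=> t /andP[t0 t1].
    have /Hr[Ay _] : ball x r (x + p k + t *: (h 0 i *: 'e_i)).
      rewrite scalerA; apply: pin => //.
      by rewrite normrM ger0_norm// ler_piMl.
    exact: Ck_derivable Cf Ay.
  have Dz : 'D_(h 0 i *: 'e_i) f (x + p k + t *: (h 0 i *: 'e_i)) =
            h 0 i * 'D_('e_i) f (x + p k + t *: (h 0 i *: 'e_i)).
    set z := _ + t *: _.
    suff dz : derivable f z 'e_i by have /@derive_val-> := is_derive_scale (h 0 i) dz.
    apply: Ck_derivable Cf _.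
    have /Hr[//] : ball x r z.
    rewrite /z scalerA; apply: pin => //; case/andP: t01 => t0 t1.
    by rewrite normrM ger0_norm// ler_piMl.
  have pk1 : x + p k.+1 = x + p k + h 0 i *: 'e_i by rewrite pS addrA.
  rewrite (bigD1 i) ?ltnS//=.
  have -> : \sum_(j < n | (j < k.+1)%N && (j != i)) h 0 j * 'D_('e_j) f x =
            \sum_(j < n | (j < k)%N) h 0 j * 'D_('e_j) f x.
    apply: eq_bigl => j; rewrite ltnS leq_eqVlt.
    have -> : (nat_of_ord j == k) = (j == i) by [].
    by case: eqP => [->|_] /=; rewrite ?andbT ?andbF ?ltnn.
  set S := \sum_(_ < _ | _) _.
  have -> : f (x + p k.+1) - f x - (h 0 i * 'D_('e_i) f x + S) =
    (f (x + p k) - f x - S) +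
    h 0 i * ('D_('e_i) f (x + p k + t *: (h 0 i *: 'e_i)) - 'D_('e_i) f x).
    rewrite mulrBr -Dz -E pk1; ring.
  rewrite -natr1 !mulrDl mul1r; apply: le_trans (ler_normD _ _) _.
  apply: lerD; first exact: IH (ltnW kn).
  rewrite normrM mulrC; apply: ler_pM => //; last exact: rV_coord_le.
  have /Hr[_ //] : ball x r (x + p k + t *: (h 0 i *: 'e_i)).
  rewrite scalerA; apply: pin => //; case/andP: t01 => t0 t1.
  by rewrite normrM ger0_norm// ler_piMl.
have := step n (leqnn n).
have -> : p n = h by apply/rowP => i; rewrite !mxE ltn_ord.
have -> : x + h = y by rewrite hE addrC subrK.
apply: le_trans; rewrite le_eqVlt; apply/orP; left.
apply/eqP; congr (`|_ - _|); rewrite /= /L0; apply: eq_big => // i.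
by rewrite ltn_ord.
Qed.

End C1.
End CkRow.

Section Chain.
Variables (R : realType) (V1 V2 W : normedModType R).

(** The inner map is only derivable along [v]. It is replaced by the curve [h |-> g (h *: v + x)],
    which is differentiable at 0 as a function of one variable, and the ordinary chain rule
    applies. *)
Lemma is_derive_comp_diff (f : V2 -> W) (g : V1 -> V2) x v :
  derivable g x v -> differentiable f (g x) ->
  is_derive x v (f \o g) ('d f (g x) ('D_v g x)).
Proof.
move=> dg df; pose p (h : R) := g (h *: v + x).
have p0 : p 0 = g x by rewrite /p scale0r add0r.
have dp : differentiable p 0 by apply/derivable1_diffP; exact: (derivable1P g x v).1 dg.
have dfp : differentiable (f \o p) 0.
  by apply: differentiable_comp => //; rewrite p0.
have D1 (X : normedModType R) (h : V1 -> X) : 'D_v h x = 'D_1 (fun s : R => h (s *: v + x)) 0.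
  have E : (fun s : R => s^-1 *: ((h \o shift x) (s *: v) - h x)) =
      (fun s : R => s^-1 *: ((((fun t : R => h (t *: v + x)) \o shift 0) (s *: (1 : R))) -
        h ((0 : R) *: v + x))).
    by apply/funext => s /=; rewrite addr0 scale0r add0r [_%:A]mulr1.
  by rewrite /derive E.
apply: DeriveDef; first by apply/derivable1P/derivable1_diffP; exact: dfp.
rewrite D1 (D1 _ g) (deriveE _ dfp) (deriveE _ dp).
by rewrite diff_comp ?p0.
Qed.

End Chain.

Section Rows.
Variables (R : realType).

Lemma differentiable_rV (V : normedModType R) n (f : V -> 'rV[R]_n) x :
  (forall i, differentiable (fun y => f y 0 i) x) ->
  differentiable f x /\ forall v i, ('d f x v) 0 i = 'd (fun y => f y 0 i) x v.
Proof.
move=> df.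
have fE : f = \sum_(i < n) (fun y => f y 0 i *: ('e_i : 'rV[R]_n)).
  by apply/funext => y; rewrite fct_sumE [LHS]row_sum_coord.
have Df : differentiable f x.
  rewrite fE; apply: differentiable_sum => i.
  exact: differentiableZl.
split=> // v i; rewrite -deriveE// derive_mx; last exact: diff_derivable.
by rewrite mxE deriveE.
Qed.

Lemma Ck1_differentiable_rV n m (A : set 'rV[R]_n) (f : 'rV[R]_n -> 'rV[R]_m) x :
  open A -> Ck 1 A f -> A x -> differentiable f x.
Proof.
move=> oA Cf Ax; apply: (differentiable_rV _).1 => i.
by apply: (Ck1_differentiable oA _ Ax).1; exact: Ck_coord.
Qed.

(** Induction on [k] through the chain rule with partial derivatives. The outer function has row
    vectors as arguments, since that is where C^1 implies differentiability; the inner one may start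
    from any normed module. *)
Lemma Ck_comp (V : normedModType R) n k (A : set V) (B : set 'rV[R]_n)
    (g : V -> 'rV[R]_n) (f : 'rV[R]_n -> R) :
  open A -> open B -> (forall x, A x -> B (g x)) ->
  Ck k A g -> Ck k B f -> Ck k A (f \o g).
Proof.
move=> oA oB AB; elim: k f => [|k IH] f Cg Cf.
  split=> // x Ax; apply: continuous_comp; first exact: Cg.1.
  by apply: Cf.1; exact: AB.
split=> [x Ax|v].
  apply: continuous_comp; first exact: Cg.1.
  by apply: Cf.1; exact: AB.
have dfg x : A x -> is_derive x v (f \o g)
    (\sum_i 'D_('e_i) f (g x) * 'D_v (fun y => g y 0 i) x).
  move=> Ax; have dg : derivable g x v by exact: Ck_derivable Cg Ax.
  have [df dE] := Ck1_differentiable oB (Ck_le (ltn0Sn k) Cf) (AB _ Ax).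
  have := is_derive_comp_diff dg df; rewrite dE; congr is_derive.
  by apply: eq_bigr => i _; rewrite mulrC derive_mx// mxE.
split=> [x /dfg dx|]; first exact: ex_derive.
apply: (@Ck_eq _ _ _ _ _ (fun x => \sum_i ('D_('e_i) f \o g) x * 'D_v (fun y => g y 0 i) x)) => //.
  by move=> x /set_mem /dfg /@derive_val.
apply: Ck_sum => // i; apply: CkM => //.
  by apply: IH; [exact: Ck_le Cg|exact: Ck_derive].
by apply: Ck_derive; exact: Ck_coord.
Qed.

Lemma Ck_rV (V : normedModType R) n k (A : set V) (g : V -> 'rV[R]_n) :
  open A -> (forall i, Ck k A (fun x => g x 0 i)) -> Ck k A g.
Proof.
have gE (h : V -> 'rV[R]_n) : h = fun x => \sum_(i < n) h x 0 i *: ('e_i : 'rV[R]_n).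
  by apply/funext => y; rewrite [LHS]row_sum_coord.
move=> oA; elim: k g => [|k IH] g Cg.
  by split=> // x Ax; apply: continuous_rV => i; exact: (Cg i).1.
split=> [x Ax|v]; first by apply: continuous_rV => i; exact: (Cg i).1.
have dg x : A x -> derivable g x v.
  by move=> Ax; apply/derivable_mxP => i j; rewrite ord1; exact: Ck_derivable (Cg j) Ax.
split=> //; apply: IH => i.
apply: Ck_eq (Ck_derive v (Cg i)) => // x /set_mem /dg dx.
by rewrite derive_mx// mxE.
Qed.

End Rows.

Section Boxes.
Variables (R : realType) (n : nat).
Implicit Types (f : 'rV[R]_n -> R) (A : set 'rV[R]_n).

Definition box (x0 : 'rV[R]_n) (r : R) : set 'rV[R]_n := [set x | `|x - x0| <= r].

Lemma box_bounded f A x0 r : box x0 r `<=` A -> Ck 0 A f ->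
  exists2 K, 0 < K & forall x, box x0 r x -> `|f x| <= K.
Proof.
move=> BA [cf _].
have : bounded_set (f @` box x0 r).
  apply: compact_bounded; apply: continuous_compact; last exact: closed_box_compact.
  by apply: continuous_in_subspaceT => x /set_mem /BA; exact: cf.
move=> /ex_strict_bound_gt0 [K K0 H]; exists K => // x Bx.
by apply/ltW/H; exists x.
Qed.

Lemma box_convex x0 r x y (t : R) : box x0 r x -> box x0 r y -> 0 <= t <= 1 ->
  box x0 r (x + t *: (y - x)).
Proof.
rewrite /box /= => Bx By /andP[t0 t1].
have -> : x + t *: (y - x) - x0 = (1 - t) *: (x - x0) + t *: (y - x0).
  by apply/rowP => i; rewrite !mxE; ring.
rewrite (le_trans (ler_normD _ _))// !normrZ !ger0_norm ?subr_ge0//.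
have -> : r = (1 - t) * r + t * r by ring.
by rewrite lerD// ler_wpM2l// subr_ge0.
Qed.

Lemma box_lipschitz f A x0 r : open A -> box x0 r `<=` A -> Ck 1 A f ->
  exists2 L, 0 < L & forall x y, box x0 r x -> box x0 r y ->
    `|f x - f y| <= L * `|x - y|.
Proof.
move=> oA BA Cf.
have /choice [K KP] i : exists K, 0 < K /\ forall x, box x0 r x -> `|'D_('e_i) f x| <= K.
  by have [K K0 KP] := box_bounded BA (Ck_derive 'e_i Cf); exists K.
exists (1 + \sum_i K i); first by rewrite ltr_pwDl// sumr_ge0// => i _; rewrite ltW// (KP i).1.
move=> x y Bx By.
have seg t : 0 <= t <= 1 -> A (y + t *: (x - y)).
  by move=> t01; apply: BA; exact: box_convex.
have [t t01|t t01] := @MVT_line _ _ f y (x - y).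
  by apply: Ck_derivable Cf _; exact: seg.
rewrite addrCA subrr addr0 => ->.
have [df dE] := Ck1_differentiable oA Cf (seg _ t01).
rewrite deriveE// dE (le_trans (ler_norm_sum _ _ _))//.
rewrite mulrDl mul1r mulr_suml ler_wpDl//; apply: ler_sum => i _.
rewrite normrM mulrC ler_pM//; last exact: rV_coord_le.
by apply: (KP i).2; exact: box_convex.
Qed.

End Boxes.

(** * Sard's theorem for real-valued functions *)

Section Negligible.
Variable R : realType.
Local Notation mu := (@lebesgue_measure R).

Lemma negligible_countable (T : countType) (F : T -> set R) :
  (forall t, mu.-negligible (F t)) -> mu.-negligible (\bigcup_t F t).
Proof.
move=> HF; pose G (k : nat) := if @pickle_inv T k is Some t then F t else set0.
apply: (@negligibleS _ _ _ mu (\bigcup_k G k)); [move=> x [t _ Ftx]|apply: negligible_bigcup => k].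
  by exists (pickle t) => //; rewrite /G pickleK_inv.
by rewrite /G; case: pickle_inv => [t|]; [exact: HF|exact: negligible_set0].
Qed.

(** The m-th cover by closed intervals has total length at most 2C/(m+1). *)
Lemma small_cover_negligible (S : set R) (C : R) :
  (forall m, exists (J : finType) (c : J -> R) (d : R),
    [/\ 0 <= d, S `<=` [set x | exists j, `|x - c j| <= d] & #|J|%:R * d <= C / m.+1%:R]) ->
  mu.-negligible S.
Proof.
move=> H; have {}H m : exists B, [/\ measurable B, S `<=` B &
    (mu B <= (2 * C / m.+1%:R)%:E)%E].
  have [J [c [d [d0 SJ Jd]]]] := H m.
  pose I (j : J) : set R := `[c j - d, c j + d]%classic.
  have mI j : measurable (I j) by exact: measurable_itv.
  have muI j : (mu (I j) <= (2 * d)%:E)%E.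
    rewrite lebesgue_measure_itv /=; case: ifP => _; rewrite ?lee_fin//.
      by lra.
    by rewrite mulr_ge0.
  have [mB muB] : measurable (\big[setU/set0]_(j <- enum J) I j) /\
      (mu (\big[setU/set0]_(j <- enum J) I j) <= ((size (enum J))%:R * (2 * d))%:E)%E.
    elim: (enum J) => [|j s [mB IH]].
      by rewrite big_nil measure0 mul0r; split=> //; exact: measurable0.
    rewrite big_cons; split; first exact: measurableU.
    have := measureU2 mu (mI j) mB; move=> /le_trans; apply.
    have -> : (size (j :: s))%:R * (2 * d) = 2 * d + (size s)%:R * (2 * d).
      by rewrite -[size _]/((size s).+1) -add1n natrD mulrDl mul1r.
    rewrite EFinD; exact: leeD (muI j) IH.
  exists (\big[setU/set0]_(j <- enum J) I j); split=> //.
    move=> x /SJ [j xj]; rewrite -bigcup_seq; exists j; first by rewrite /= mem_enum.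
    by rewrite /I /= in_itv /= -ler_distlC distrC.
  apply: (le_trans muB); rewrite lee_fin -cardE mulrCA -mulrA.
  by rewrite ler_wpM2l.
(* A negligible set needs one measurable null superset; the intersection of all covers is one. *)
have [B HB] := choice H; exists (\bigcap_m B m); split.
- by apply: bigcapT_measurable => m; have [] := HB m.
- apply/eqP; rewrite eq_le measure_ge0 andbT; apply/lee_addgt0Pr => e e0.
  have mB : measurable (\bigcap_m B m) by apply: bigcapT_measurable => m; have [] := HB m.
  rewrite add0e; pose m := Num.bound (2 * `|C| / e).
  have [mBm _ muBm] := HB m.
  apply: le_trans (le_trans muBm _).
    by apply: le_measure; rewrite ?inE//; exact: bigcap_inf.
  rewrite lee_fin ler_pdivrMr// [e * _]mulrC -ler_pdivrMr//.
  apply: (@le_trans _ _ (2 * `|C| / e)).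
    by rewrite ler_wpM2r ?invr_ge0 ?(ltW e0)// ler_wpM2l// ler_norm.
  rewrite (le_trans (ltW (archi_boundP _)))//; last by rewrite ler_nat.
  by rewrite divr_ge0 ?mulr_ge0// ltW.
- by move=> x Sx m _; have [_ SB _] := HB m; exact: SB.
Qed.

End Negligible.

Section LocalNegligible.
Variables (R : realType) (n : nat).
Local Notation mu := (@lebesgue_measure R).

(** Cubes with centre z/(k+1), z an integer vector, and radius 1/(k+1) are countably many, so they
    do the work of the Lindelöf property. The centre comes from the integer parts of the coordinates
    of (k+1)x. *)
Lemma dyadic_box (O : set 'rV[R]_n) (x : 'rV[R]_n) : nbhs x O ->
  exists kz : nat * 'rV[int]_n,
    let b := box (\row_i ((kz.2 0 i)%:~R / kz.1.+1%:R)) kz.1.+1%:R^-1 in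
    b x /\ b `<=` O.
Proof.
move=> /nbhs_ballP [e /= e0 eO].
pose k := Num.bound (2 / e); pose K : R := k.+1%:R.
have K0 : 0 < K by rewrite ltr0n.
have Ke : 2 / K < e.
  rewrite ltr_pdivrMr// mulrC -ltr_pdivrMr//.
  rewrite (lt_le_trans (archi_boundP _))//; last by rewrite /K ler_nat.
  by rewrite divr_ge0// ltW.
exists (k, \row_i Num.floor (x 0 i * K)) => /=.
set c := \row_i _.
have xc : `|x - c| <= K^-1.
  rewrite rV_norm_le ?invr_ge0 ?(ltW K0)//; apply/forallP => i; rewrite !mxE.
  have /andP[f1 f2] := floor_itv (x 0 i * K).
  set z := _%:~R in f1 f2 *; rewrite intrD -/z in f2.
  rewrite -(mulfK (lt0r_neq0 K0) (x 0 i)) -mulrBl normrM [`|_^-1|]ger0_norm ?invr_ge0 ?(ltW K0)//.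
  rewrite ler_piMl ?invr_ge0 ?(ltW K0)// ler_norml.
  by apply/andP; split; move: f1 f2; rewrite /z; lra.
split=> // y yc; apply: eO; rewrite -ball_normE /=.
apply: le_lt_trans Ke; rewrite -(subrKA c) (le_trans (ler_normD _ _))//.
rewrite (_ : 2 / K = K^-1 + K^-1); last by rewrite mulrDl mul1r.
by rewrite lerD// distrC.
Qed.

Lemma local_negligible (f : 'rV[R]_n -> R) (S : set 'rV[R]_n) :
  (forall x, S x -> exists2 O, nbhs x O & mu.-negligible (f @` (S `&` O))) ->
  mu.-negligible (f @` S).
Proof.
move=> H; pose b (kz : nat * 'rV[int]_n) : set 'rV[R]_n :=
  box (\row_i ((kz.2 0 i)%:~R / kz.1.+1%:R)) kz.1.+1%:R^-1.
(* A box whose image is not negligible contributes the empty set, so the union runs over all boxes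
   without selecting any. *)
pose F kz := [set y | mu.-negligible (f @` (S `&` b kz)) /\ (f @` (S `&` b kz)) y].
apply: (@negligibleS _ _ _ mu (\bigcup_t F t)); [move=> _ [x Sx <-]|apply: negligible_countable => kz].
  have [N Ox NO] := H _ Sx; have [kz /= [bx bO]] := dyadic_box Ox.
  exists kz => //; split; last by exists x.
  by apply: (negligibleS _ NO); apply: image_subset; exact: setIS.
have [NF|NF] := pselect (mu.-negligible (f @` (S `&` b kz))).
  by apply: (negligibleS _ NF) => y [].
by apply: (negligibleS _ (negligible_set0 mu)) => y [].
Qed.

End LocalNegligible.

Section IteratedPartials.
Variables (R : realType) (n : nat).
Implicit Types (f : 'rV[R]_n -> R) (A : set 'rV[R]_n) (s : seq 'I_n).

Definition partials s f : 'rV[R]_n -> R :=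
  foldr (fun i (g : 'rV[R]_n -> R) => 'D_('e_i) g) f s.

Lemma smooth_derive A f v : smooth_on A f -> smooth_on A ('D_v f).
Proof. by move=> Cf k; exact: Ck_derive (Cf k.+1). Qed.

Lemma smooth_partials A f s : smooth_on A f -> smooth_on A (partials s f).
Proof. by move=> Cf; elim: s => [//|i s IH]; exact: smooth_derive. Qed.

Lemma partials_rcons s i f : partials (rcons s i) f = partials s ('D_('e_i) f).
Proof. by rewrite /partials foldr_rcons. Qed.

Definition flat_upto k f : set 'rV[R]_n :=
  [set x | forall s, s != [::] -> (size s <= k)%N -> partials s f x = 0].

(** No Taylor polynomial is formed: the partial derivatives of [f] are flat to one order less, and
    the mean value theorem on the segment turns their bound into one more power of the distance. *)
Lemma flat_taylor A f x0 r k : open A -> box x0 r `<=` A -> smooth_on A f ->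
  exists2 M, 0 <= M & forall x y, box x0 r x -> box x0 r y -> flat_upto k f x ->
    `|f y - f x| <= M * `|y - x| ^+ k.+1.
Proof.
move=> oA BA; elim: k f => [|k IH] f Cf.
  have [L L0 HL] := box_lipschitz oA BA (Cf 1%N).
  by exists L; [exact: ltW|move=> x y Bx By _; rewrite expr1; exact: HL].
have /choice [M HM] i : exists M, 0 <= M /\ forall x y, box x0 r x -> box x0 r y ->
    flat_upto k ('D_('e_i) f) x -> `|'D_('e_i) f y - 'D_('e_i) f x| <= M * `|y - x| ^+ k.+1.
  by have [M M0 HM] := IH _ (smooth_derive 'e_i Cf); exists M.
exists (\sum_i M i); first by apply: sumr_ge0 => i _; have [] := HM i.
move=> x y Bx By fx.
have seg t : 0 <= t <= 1 -> box x0 r (x + t *: (y - x)).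
  by move=> t01; exact: box_convex.
have [t t01|t t01] := @MVT_line _ _ f x (y - x).
  by apply: Ck_derivable (Cf 1%N) _; apply/BA/seg.
rewrite addrCA subrr addr0 => ->.
have [df dE] := Ck1_differentiable oA (Cf 1%N) (BA _ (seg _ t01)).
rewrite deriveE// dE (le_trans (ler_norm_sum _ _ _))// mulr_suml.
apply: ler_sum => i _; rewrite normrM exprS mulrCA.
apply: ler_pM => //; first exact: rV_coord_le.
have [M0 {}HM] := HM i.
have := HM x _ Bx (seg _ t01); rewrite (fx [:: i] isT isT : 'D_('e_i) f x = 0) subr0.
have -> : x + t *: (y - x) - x = t *: (y - x) by rewrite addrC addKr.
rewrite normrZ => H; apply: le_trans (H _) _.
  by move=> s _ sk; rewrite -partials_rcons fx// ?size_rcons//; case: (s).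
rewrite ler_wpM2l//; case/andP: t01 => t0 t1.
by rewrite lerXn2r ?nnegrE ?mulr_ge0// ger0_norm// ler_piMl.
Qed.

End IteratedPartials.

Section FlatNegligible.
Variables (R : realType) (n : nat).
Local Notation mu := (@lebesgue_measure R).

Lemma subdivide_box (x0 x : 'rV[R]_n) r m : 0 < r -> box x0 r x ->
  exists j : {ffun 'I_n -> 'I_m.+1},
    box (\row_i (x0 0 i - r + (2 * (j i)%:R + 1) * (r / m.+1%:R))) (r / m.+1%:R) x.
Proof.
move=> r0 xr; pose d := r / m.+1%:R.
have m0 : 0 < m.+1%:R :> R by rewrite ltr0n.
have d0 : 0 < d by rewrite divr_gt0.
suff /choice [j jP] : forall i, exists j : 'I_m.+1,
    `|x 0 i - (x0 0 i - r + (2 * j%:R + 1) * d)| <= d.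
  exists [ffun i => j i]; rewrite /box /= rV_norm_le; last exact: ltW.
  by apply/forallP => i; rewrite !mxE ffunE; exact: jP.
move=> i; set t := x 0 i - (x0 0 i - r).
have /andP[t0 t1] : 0 <= t <= 2 * r.
  have := rV_coord_le (x - x0) i; rewrite !mxE => /le_trans/(_ xr).
  by rewrite /t ler_norml => /andP[? ?]; apply/andP; split; lra.
have tE j : x 0 i - (x0 0 i - r + (2 * j + 1) * d) = t - (2 * j + 1) * d.
  by rewrite /t; ring.
have rE : r = m.+1%:R * d by rewrite /d mulrC divfK ?gt_eqF.
suff [j jm /andP[j1 j2]] : exists2 j, (j <= m)%N & 2 * j%:R * d <= t <= 2 * (j%:R + 1) * d.
  exists (Ordinal (n := m.+1) jm) => /=; rewrite tE ler_norml.
  by apply/andP; split; lra.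
(* Induction on the number of intervals, rather than a floor, puts the right end point [t = 2 * r]
   into the last interval. *)
have : t <= 2 * m.+1%:R * d by rewrite -mulrA -rE.
elim: (m) => [|k IH] tk.
  by exists 0%N => //; rewrite mulr0 mul0r t0 add0r.
have [tk'|kt] := leP t (2 * k.+1%:R * d).
  by have [j jk] := IH tk'; exists j => //; exact: leqW.
by exists k.+1 => //; rewrite (ltW kt) natr1.
Qed.

(* A cube cut into m^n pieces has its flat points sent into m^n intervals of
   length O(m^-(n+1)). *)
Lemma flat_negligible (A : set 'rV[R]_n) (f : 'rV[R]_n -> R) :
  open A -> smooth_on A f -> mu.-negligible (f @` (A `&` flat_upto n f)).
Proof.
move=> oA Cf; apply: local_negligible => x0 [Ax0 _].
have /nbhs_ballP[r0 /= r00 rA] := open_nbhs_nbhs (conj oA Ax0).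
pose r := r0 / 2.
have r0' : 0 < r by rewrite divr_gt0.
have BA : box x0 r `<=` A.
  move=> x xr; apply: rA; rewrite -ball_normE /= distrC (le_lt_trans xr)//.
  by rewrite /r ltr_pdivrMr// mulr_natr mulr2n ltrDl.
exists (box x0 r).
  apply/nbhs_ballP; exists r => // x; rewrite -ball_normE /= distrC.
  by move=> /ltW.
have [M M0 HM] := flat_taylor n oA BA Cf.
apply: (@small_cover_negligible _ _ (M * (2 * r) ^+ n.+1)) => m.
pose c (j : {ffun 'I_n -> 'I_m.+1}) : 'rV[R]_n :=
  \row_i (x0 0 i - r + (2 * (j i)%:R + 1) * (r / m.+1%:R)).
pose P j x := [/\ flat_upto n f x, box x0 r x & box (c j) (r / m.+1%:R) x].
(* Each interval is centred at the value of [f] at a flat point picked in the cube, or at the junk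
   value [f 0] if there is none. Its radius uses that two points of a cube are at most
   [2 * r / m.+1%:R] apart. *)
exists {ffun 'I_n -> 'I_m.+1}, (fun j => f (xget 0 (P j))).
exists (M * (2 * r / m.+1%:R) ^+ n.+1); split.
- by rewrite mulr_ge0// exprn_ge0// divr_ge0// mulr_ge0// ltW.
- move=> _ [x [[Ax fx] Bx] <-]; have [j jx] := subdivide_box m r0' Bx.
  exists j; case: xgetP => [y _ [fy By jy]|/(_ x)]; last by case; split.
  apply: le_trans (HM _ _ By Bx fy) _; rewrite ler_wpM2l//.
  rewrite lerXn2r ?nnegrE ?divr_ge0 ?mulr_ge0 ?(ltW r0') ?(ltW r00)//.
  rewrite -(subrKA (c j)) (le_trans (ler_normD _ _))//.
  have -> : 2 * r / m.+1%:R = r / m.+1%:R + r / m.+1%:R by ring.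
  by rewrite lerD// distrC.
- rewrite card_ffun !card_ord natrX le_eqVlt; apply/orP; left; apply/eqP.
  rewrite expr_div_n [m.+1%:R ^+ n.+1]exprS.
  set B := _ ^+ n.+1; set q : R := m.+1%:R; set Q := q ^+ n.
  have q0 : q != 0 by rewrite pnatr_eq0.
  have Q0 : Q != 0 by rewrite expf_neq0.
  clearbody Q q B; clear -q0 Q0; field.
  by rewrite q0 Q0.
Qed.

End FlatNegligible.

Lemma Ck_id (R : realType) (V : normedModType R) k (A : set V) : Ck k A (@id V).
Proof.
case: k => [|k]; first by split=> // x _; exact: cvg_id.
split=> [x _|v]; first exact: cvg_id.
split=> [x _|]; first exact: derivable_id.
rewrite (_ : 'D_v _ = fun=> v); first exact: Ck_cst.
by apply/funext => x; rewrite derive_id.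
Qed.

Section InsertCoordinate.
Variables (R : realType) (n : nat) (i : 'I_n.+1).
Implicit Types (y : 'rV[R]_n) (x : 'rV[R]_n.+1) (s : R).

(** With [col' i] this identifies R^(n+1) with R^n x R, the last factor being the coordinate that
    the implicit function theorem solves for. *)
Definition insc y s : 'rV[R]_n.+1 :=
  \row_j (if unlift i j is Some k then y 0 k else s).

Lemma insc_lift y s k : insc y s 0 (lift i k) = y 0 k.
Proof. by rewrite mxE liftK. Qed.

Lemma insc_eq y s : insc y s 0 i = s.
Proof. by rewrite mxE unlift_none. Qed.

Lemma insc_col' x : insc (col' i x) (x 0 i) = x.
Proof.
by apply/rowP => j; rewrite mxE; case: unliftP => [k ->|->]; rewrite ?mxE.
Qed.

Lemma inscB y y' s s' : insc y' s' - insc y s = insc (y' - y) (s' - s).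
Proof. by apply/rowP => j; rewrite !mxE; case: unliftP => [k|]; rewrite ?mxE. Qed.

Lemma insc_split y s : insc y s = insc y 0 + s *: 'e_i.
Proof.
apply/rowP => j; rewrite !mxE /=; case: unliftP => [k ->|->].
  by rewrite eq_sym (negbTE (neq_lift _ _)) mulr0 addr0.
by rewrite eqxx mulr1 add0r.
Qed.

Lemma insc0 : insc 0 0 = 0.
Proof. by apply/rowP => j; rewrite !mxE; case: unliftP => [k|]; rewrite ?mxE. Qed.

Lemma inscZ a y : insc (a *: y) 0 = a *: insc y 0.
Proof. by apply/rowP => j; rewrite !mxE; case: unliftP => [k|]; rewrite ?mxE ?mulr0. Qed.

Lemma insc_norm y s (e : R) : `|y| <= e -> `|s| <= e -> `|insc y s| <= e.
Proof.
move=> ye se; rewrite rV_norm_le; last exact: le_trans se.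
apply/forallP => j; rewrite mxE; case: unliftP => [k _|//].
exact: le_trans (rV_coord_le _ _) ye.
Qed.

Lemma col'_norm x : `|col' i x| <= `|x|.
Proof.
rewrite rV_norm_le//; apply/forallP => k; rewrite mxE; exact: rV_coord_le.
Qed.

End InsertCoordinate.

(** * The implicit function theorem for one equation *)

Section ImplicitFunction.
Variables (R : realType) (n : nat) (i : 'I_n.+1).
Variables (A : set 'rV[R]_n.+1) (w : 'rV[R]_n.+1 -> R).
Hypotheses (oA : open A) (Cw : smooth_on A w).
Hypothesis w_incr : forall x, A x -> 0 < 'D_('e_i) w x.
Variables (x0 : 'rV[R]_n.+1) (r : R).
Hypotheses (r0 : 0 < r) (BA : box x0 r `<=` A) (wx0 : w x0 = 0).

(** For [v] with vanishing i-th coordinate, this is the derivative along [v] of the function that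
    solves [w = 0] for the i-th coordinate. *)
Let slope v x := - ('D_v w x / 'D_('e_i) w x).

Let Ck_slope k v : Ck k A (slope v).
Proof.
apply: (@Ck_eq _ _ _ _ _ (fun x => (-1) * ('D_v w x * ('D_('e_i) w x)^-1))) => //.
  by move=> x _; rewrite mulN1r.
apply: CkM => //; first exact: Ck_cst.
apply: CkM => //; first exact: Ck_derive (Cw k.+1).
apply: CkV => //; last exact: Ck_derive (Cw k.+1).
by move=> x /w_incr; rewrite lt0r => /andP[].
Qed.

(** Mean value theorem with the positive factor ['D_('e_i) w] pulled out: between two zeros of [w]
    the other factor vanishes, which expresses the change of the i-th coordinate by a slope.
    Lipschitz continuity, differentiability and uniqueness of the root all follow from this
    identity. *)
Let increment x x' : box x0 r x -> box x0 r x' ->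
  exists2 t : R, 0 <= t <= 1 & w x' - w x =
    'D_('e_i) w (x + t *: (x' - x)) *
    ((x' - x) 0 i - slope (insc i (col' i (x' - x)) 0) (x + t *: (x' - x))).
Proof.
move=> Bx Bx'.
have seg t : 0 <= t <= 1 -> A (x + t *: (x' - x)).
  by move=> t01; apply/BA/box_convex.
have [t t01|t t01] := @MVT_line _ _ w x (x' - x).
  by apply: Ck_derivable (Cw 1%N) _; exact: seg.
rewrite addrCA subrr addr0 => ->; exists t => //.
set z := x + _; have Az : A z by exact: seg.
have [dw _] := Ck1_differentiable oA (Cw 1%N) Az.
rewrite -{1}(insc_col' i (x' - x)) insc_split deriveE// linearD linearZ /=.
rewrite -!deriveE// /slope opprK mulrDr [in RHS]mulrC addrC; congr (_ + _).
by rewrite mulrC divfK// gt_eqF// w_incr.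
Qed.

Let y0 := col' i x0.
Let s0 := x0 0 i.

Let insc_box y s : `|y - y0| <= r -> `|s - s0| <= r -> box x0 r (insc i y s).
Proof.
by move=> yr sr; rewrite /box /= -(insc_col' i x0) inscB insc_norm.
Qed.

Let is_root y s := `|s - s0| <= r /\ w (insc i y s) = 0.

(** On the vertical line through [x0], [w] is negative at [s0 - r] and positive at [s0 + r]. Both
    signs persist over nearby [y], and the intermediate value theorem gives a root in between. *)
Let root_exists : exists2 r1, 0 < r1 <= r &
  forall y, `|y - y0| < r1 -> exists s, is_root y s.
Proof.
have Ba a : `|a| <= r -> box x0 r (insc i y0 (s0 + a)).
  by move=> ar; apply: insc_box; rewrite ?subrr ?normr0 ?(ltW r0)// addrC addKr.
have side a : `|a| <= r -> exists2 t, 0 <= t <= 1 &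
    w (insc i y0 (s0 + a)) = 'D_('e_i) w (x0 + t *: (insc i y0 (s0 + a) - x0)) * a.
  move=> ar; have B0 : box x0 r x0 by rewrite /box /= subrr normr0 ltW.
  have [t t01] := increment B0 (Ba _ ar); move=> E; exists t => //; move: E.
  rewrite wx0 subr0 => ->; congr (_ * _).
  have -> : (insc i y0 (s0 + a) - x0) 0 i = a.
    by rewrite !mxE unlift_none addrC addKr.
  have -> : col' i (insc i y0 (s0 + a) - x0) = 0.
    by apply/rowP => k; rewrite !mxE liftK mxE subrr.
  by rewrite insc0 /slope derive0 mul0r oppr0 subr0.
have DA a t : `|a| <= r -> 0 <= t <= 1 ->
    0 < 'D_('e_i) w (x0 + t *: (insc i y0 (s0 + a) - x0)).
  move=> ar t01; apply/w_incr/BA/box_convex => //; last exact: Ba.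
  by rewrite /box /= subrr normr0 ltW.
have rr : `|r| <= r by rewrite ger0_norm// ltW.
have rr' : `|- r| <= r by rewrite normrN.
have wp : 0 < w (insc i y0 (s0 + r)).
  by have [t t01 ->] := side _ rr; rewrite mulr_gt0// DA.
have wm : w (insc i y0 (s0 - r)) < 0.
  by have [t t01 ->] := side _ rr'; rewrite pmulr_rlt0 ?oppr_lt0// DA.
have cont s : `|s - s0| <= r -> {for y0, continuous (fun y => w (insc i y s))}.
  move=> sr; apply: (@continuous_comp 'rV[R]_n 'rV[R]_n.+1 R (fun y => insc i y s) w).
    apply: eps_continuous => e e0; apply: filterS (near_dist_le y0 e0) => y ye.
    by rewrite inscB insc_norm ?subrr ?normr0 ?(ltW e0).
  apply: Ck_continuous (Cw 0%N) _; apply/BA/insc_box => //.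
  by rewrite subrr normr0 ltW.
have rs : `|s0 + r - s0| <= r by rewrite addrC addKr.
have rs' : `|s0 - r - s0| <= r by rewrite addrC addKr.
have /nbhs_ballP[r1 /= r10 Hr1] : \forall y \near y0,
    0 < w (insc i y (s0 + r)) /\ w (insc i y (s0 - r)) < 0.
  apply: filterI.
    exact: (cvgr_gt _ (cont _ rs) _ wp).
  exact: (cvgr_lt _ (cont _ rs') _ wm).
exists (Num.min r1 r); first by rewrite lt_min r10 r0 ge_min lexx orbT.
move=> y; rewrite lt_min => /andP[y1 yr].
have [|wp' wm'] := Hr1 y; first by rewrite -ball_normE /= distrC.
have [|||s] := @IVT _ (fun s => w (insc i y s)) (s0 - r) (s0 + r) 0.
- by rewrite lerD2l ge0_cp ?ltW.
- apply: continuous_in_subspaceT => s; rewrite inE /= in_itv /= -ler_distlC => sr.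
  apply: (@continuous_comp R 'rV[R]_n.+1 R (fun s => insc i y s) w).
    apply: eps_continuous => e e0; apply: filterS (near_dist_le s e0) => s' se.
    by rewrite inscB insc_norm ?subrr ?normr0 ?(ltW e0).
  apply: Ck_continuous (Cw 0%N) _; apply/BA/insc_box; first exact: ltW.
  by rewrite distrC.
- by rewrite ge_min le_max (ltW wp') (ltW wm') orbT.
rewrite in_itv /= -ler_distlC => sr ws; exists s; split=> //.
by rewrite distrC.
Unshelve. all: by end_near. Qed.

(** The root is merely chosen by [xget]. Regularity is bootstrapped: a bound on the slopes makes it
    Lipschitz, continuity then makes it differentiable, and the formula for its derivative makes it
    smooth. *)
Lemma implicit_function : exists (r1 : R) (g : 'rV[R]_n -> 'rV[R]_n.+1),
  [/\ 0 < r1, smooth_on (ball y0 r1) g,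
    forall y, ball y0 r1 y -> A (g y) &
    forall x, ball x0 r1 x -> w x = 0 -> ball y0 r1 (col' i x) /\ g (col' i x) = x].
Proof.
have [r1 /andP[r10 r1r] Hr1] := root_exists.
pose sg y := xget s0 (is_root y).
pose O := ball y0 r1.
have oO : open O by exact: ball_open.
have Oy y : O y -> `|y - y0| < r1 by rewrite /O -ball_normE /= distrC.
have rt y : O y -> is_root y (sg y).
  by move=> /Oy/Hr1[s sr]; rewrite /sg; case: xgetP => [s' _ //|/(_ s)].
pose g y := insc i y (sg y).
have gB y : O y -> box x0 r (g y).
  move=> yO; have [sr _] := rt _ yO; apply: insc_box => //.
  by rewrite ltW// (lt_le_trans (Oy _ yO)).
have gw y : O y -> w (g y) = 0 by move=> /rt [].
have inc x x' : box x0 r x -> box x0 r x' -> w x = 0 -> w x' = 0 ->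
    exists2 t : R, 0 <= t <= 1 & (x' - x) 0 i =
      slope (insc i (col' i (x' - x)) 0) (x + t *: (x' - x)).
  move=> Bx Bx' wx wx'; have [t t01] := increment Bx Bx'.
  rewrite wx wx' subrr => /esym/eqP; rewrite mulf_eq0 gt_eqF/=.
    by rewrite subr_eq0 => /eqP; exists t.
  by apply/w_incr/BA/box_convex.
have col'B y y' : col' i (g y' - g y) = y' - y.
  by apply/rowP => k; rewrite !mxE liftK.
have gi y y' : (g y' - g y) 0 i = sg y' - sg y by rewrite inscB insc_eq.
have [C C0 HC] : exists2 C, 0 < C & forall v x, box x0 r x ->
    `|slope (insc i v 0) x| <= C * `|v|.
  have /choice [K KP] j : exists K, 0 < K /\ forall x, box x0 r x -> `|'D_('e_j) w x| <= K.
    by have [K K0 KP] := box_bounded BA (Ck_derive 'e_j (Cw 1%N)); exists K.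
  have [K' K'0 K'P] : exists2 K, 0 < K & forall x, box x0 r x -> `|('D_('e_i) w x)^-1| <= K.
    apply: box_bounded BA _; apply: CkV => //; last exact: Ck_derive (Cw 1%N).
    by move=> x /w_incr; rewrite lt0r => /andP[].
  exists ((1 + \sum_j K j) * K').
    by rewrite mulr_gt0// ltr_pwDl// sumr_ge0// => j _; rewrite ltW// (KP j).1.
  move=> v x Bx; rewrite /slope normrN normrM mulrAC; apply: ler_pM => //; last exact: K'P.
  have [dw dE] := Ck1_differentiable oA (Cw 1%N) (BA Bx).
  rewrite deriveE// dE (le_trans (ler_norm_sum _ _ _))//.
  rewrite mulrDl mul1r mulr_suml ler_wpDl//; apply: ler_sum => j _.
  rewrite normrM mulrC ler_pM//; first exact: (KP j).2.
  apply: le_trans (rV_coord_le _ _) _.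
  by apply: insc_norm; rewrite ?normr0.
have sgL y y' : O y -> O y' -> `|sg y' - sg y| <= C * `|y' - y|.
  move=> yO y'O; have [t t01] := inc _ _ (gB _ yO) (gB _ y'O) (gw _ yO) (gw _ y'O).
  by rewrite gi col'B => ->; apply: HC; apply: box_convex => //; exact: gB.
have gL y y' : O y -> O y' -> `|g y' - g y| <= (1 + C) * `|y' - y|.
  move=> yO y'O; rewrite inscB; apply: insc_norm.
    by rewrite mulrDl mul1r lerDl mulr_ge0// ltW.
  by rewrite (le_trans (sgL _ _ yO y'O))// ler_wpM2r// lerDr.
have gc y : O y -> {for y, continuous g}.
  move=> yO; apply: eps_continuous => e e0.
  have e'0 : 0 < e / (1 + C) by rewrite divr_gt0// addr_gt0.
  apply: filterS2 (near_dist_le y e'0) (open_nbhs_nbhs (conj oO yO)) => y' ye y'O.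
  rewrite distrC (le_trans (gL _ _ yO y'O))//.
  by rewrite mulrC -ler_pdivlMr 1?distrC// addr_gt0.
(* The difference quotient equals a slope at a point between [g y] and [g (h *: v + y)]; its limit
   follows from the continuity of [g] and of the slope. *)
have sgD y v : O y -> is_derive y v sg (slope (insc i v 0) (g y)).
  move=> yO.
  suff H : h^-1 *: (sg (h *: v + y) - sg y) @[h --> 0^'] --> slope (insc i v 0) (g y).
    by apply: DeriveDef; [apply/cvg_ex; eexists; exact: H|exact: cvg_lim H].
  apply/cvgrPdist_le => e e0.
  have := Ck_continuous (Ck_slope 0 (insc i v 0)) (BA (gB _ yO)).
  move=> /cvgrPdist_le/(_ _ e0)/nbhs_ballP[d /= d0 Hd].
  have hv : (h *: v + y) @[h --> (0 : R)^'] --> y.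
    rewrite -[X in _ --> X]add0r -(scale0r v); apply: cvgD; last exact: cvg_cst.
    by apply: cvgZr_tmp => B HB; exact: nbhs_dnbhs HB.
  have nO : \forall h \near (0 : R)^', O (h *: v + y).
    exact: (hv O (open_nbhs_nbhs (conj oO yO))).
  have nd : \forall h \near (0 : R)^', `|g y - g (h *: v + y)| < d.
    exact: (hv _ (cvgr_dist_lt _ _ (gc _ yO) _ d0)).
  near=> h.
  have h0 : h != 0 by near: h; exact: nbhs_dnbhs_neq.
  have hO : O (h *: v + y) by near: h; exact: nO.
  have gd : `|g (h *: v + y) - g y| < d by rewrite distrC; near: h; exact: nd.
  have [t /andP[t0 t1]] := inc _ _ (gB _ yO) (gB _ hO) (gw _ yO) (gw _ hO).
  rewrite gi col'B addrK inscZ => ->.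
  set z := g y + _.
  have Bz : box x0 r z by apply: box_convex; [exact: gB|exact: gB|rewrite t0 t1].
  have [dw _] := Ck1_differentiable oA (Cw 1%N) (BA Bz).
  have -> : slope (h *: insc i v 0) z = h * slope (insc i v 0) z.
    have dl : 'd w z (h *: insc i v 0) = h * 'd w z (insc i v 0) by rewrite linearZ.
    by rewrite /slope !deriveE// dl mulrN mulrA.
  rewrite -[h^-1 *: _]/(h^-1 * _) mulKf//; apply: Hd.
  rewrite -ball_normE /= /z opprD addNKr normrN normrZ ger0_norm//.
  by rewrite (le_lt_trans _ gd)// ler_piMl.
have Cg k : Ck k O sg -> Ck k O g.
  move=> Cs; apply: Ck_rV => // j; case: (unliftP i j) => [l ->|->].
    apply: (@Ck_eq _ _ _ _ _ (fun y : 'rV[R]_n => y 0 l)) => //.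
      by move=> y _; rewrite insc_lift.
    by apply: (Ck_coord (f := id)) => //; exact: Ck_id.
  by apply: Ck_eq Cs => // y _; rewrite insc_eq.
(* The derivative [slope (insc i v 0) \o g] is as regular as [g], which gains one order at each
   step. *)
have Csg k : Ck k O sg.
  elim: k => [|k IH].
    split=> // y yO.
    have : {for y, continuous (fun y' => g y' 0 i)}.
      exact: (@continuous_comp _ _ _ g (fun M : 'rV[R]_n.+1 => M 0 i) y (gc _ yO) (@coord_continuous _ _ _ _ _ _)).
    by apply: for_continuous_near; near=> y'; exact: insc_eq.
  split=> [y yO|v]; first exact: Ck_continuous IH yO.
  split=> [y yO|]; first by have /@ex_derive := sgD _ v yO.
  apply: (@Ck_eq _ _ _ _ _ (slope (insc i v 0) \o g)) => //.
    by move=> y /set_mem yO; have /@derive_val-> := sgD y v yO.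
  by apply: (Ck_comp oO oA) => [y /gB/BA//||]; [exact: Cg|exact: Ck_slope].
exists r1, g; split=> // [k|y /gB/BA//|x xr wx]; first exact: Cg.
have Bx : box x0 r x.
  by move: xr; rewrite -ball_normE /= distrC => /ltW/le_trans; apply.
have yO : O (col' i x).
  have yE : y0 - col' i x = col' i (x0 - x) by apply/rowP => k; rewrite !mxE.
  rewrite /O -ball_normE /= yE; apply: le_lt_trans (col'_norm _ _) _.
  by move: xr; rewrite -ball_normE.
split=> //.
(* Uniqueness of the root: the two zeros differ only in the i-th coordinate, so the slope is taken
   along 0 and vanishes. *)
have [t t01] := inc _ _ Bx (gB _ yO) wx (gw _ yO).
have -> : col' i (g (col' i x) - x) = 0.
  by apply/rowP => k; rewrite !mxE liftK mxE subrr.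
rewrite insc0 /slope derive0 mul0r oppr0.
rewrite !mxE unlift_none => /eqP; rewrite subr_eq0 => /eqP E.
by rewrite /g E insc_col'.
Unshelve. all: by end_near. Qed.

End ImplicitFunction.

Section Sard.
Variable R : realType.
Local Notation mu := (@lebesgue_measure R).

Definition critical n (A : set 'rV[R]_n) (f : 'rV[R]_n -> R) : set 'rV[R]_n :=
  [set x | A x /\ forall i, 'D_('e_i) f x = 0].

(** Near such a point the hypersurface [w = 0] is parametrised by a smooth [g] in one variable
    fewer. Critical points of [f] on it come from critical points of [f \o g], whose values are
    negligible by the hypothesis in dimension [n]. *)
Lemma sard_hypersurface n (i : 'I_n.+1) (A : set 'rV[R]_n.+1)
    (f w : 'rV[R]_n.+1 -> R) :
  (forall (B : set 'rV[R]_n) (g : 'rV[R]_n -> R), open B -> smooth_on B g ->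
     mu.-negligible (g @` critical B g)) ->
  open A -> smooth_on A f -> smooth_on A w ->
  mu.-negligible (f @` [set x | [/\ critical A f x, w x = 0 & 'D_('e_i) w x != 0]]).
Proof.
move=> IH oA Cf Cw; apply: local_negligible => x0 [[Ax0 _] wx0 dwx0].
(* Multiplying [w] by its own partial derivative at [x0] makes the new one a square there, hence
   positive whatever the sign was. *)
pose c := 'D_('e_i) w x0; pose w' x := c * w x.
have Cw' : smooth_on A w' by move=> k; apply: CkM => //; exact: Ck_cst.
have Dw' x v : A x -> 'D_v w' x = c * 'D_v w x.
  move=> Ax; have dw : derivable w x v by exact: Ck_derivable (Cw 1%N) Ax.
  exact: (deriveZ c dw).
have [r /= r0 rA] : exists2 r, 0 < r & forall x, ball x0 r x -> A x /\ 0 < 'D_('e_i) w' x.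
  have : \forall x \near x0, A x /\ 0 < 'D_('e_i) w' x.
    apply: filterI; first exact: open_nbhs_nbhs.
    have cD := Ck_continuous (Ck_derive 'e_i (Cw' 1%N)) Ax0.
    apply: (cvgr_gt _ cD).
    by rewrite Dw'// -expr2 lt0r sqr_ge0 expf_neq0.
  by move=> /nbhs_ballP [r /= r0 H]; exists r.
have r20 : 0 < r / 2 by rewrite divr_gt0.
have BA : box x0 (r / 2) `<=` ball x0 r.
  move=> x xr; rewrite -ball_normE /= distrC (le_lt_trans xr)//.
  by rewrite ltr_pdivrMr// mulr_natr mulr2n ltrDl.
have w'x0 : w' x0 = 0 by rewrite /w' wx0 mulr0.
have Cw'' : smooth_on (ball x0 r) w'.
  by move=> k; apply: Ck_subset (Cw' k) => x /rA [].
have [r1 [g [r10 Cg gA gx]]] := implicit_function (@ball_open _ _ x0 r) Cw''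
  (fun x xr => (rA x xr).2) r20 BA w'x0.
set B := ball (col' i x0) r1 in Cg gA gx.
have oB : open B by exact: ball_open.
have gA' y : B y -> A (g y) by move=> /gA /rA [].
exists (ball x0 r1); first exact: nbhsx_ballx.
have CF : smooth_on B (f \o g) by move=> k; exact: Ck_comp oB oA gA' (Cg k) (Cf k).
apply: negligibleS (IH B _ oB CF) => _ [x [[[Ax fx] wx _] xr] <-].
have w'x : w' x = 0 by rewrite /w' wx mulr0.
have [By gy] := gx _ xr w'x.
exists (col' i x); last by rewrite /= gy.
split=> // j.
have dg : derivable g (col' i x) 'e_j by exact: Ck_derivable (Cg 1%N) By.
have [df dE] := Ck1_differentiable oA (Cf 1%N) (gA' _ By).
have /@derive_val -> := is_derive_comp_diff dg df.
by rewrite dE gy big1// => k _; rewrite fx mulr0.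
Qed.

(** Induction on the dimension. A critical point is either flat up to the order of the dimension, or
    some partial derivative vanishes there while one of its own partial derivatives does not. The
    second kind lies on countably many hypersurfaces, indexed by the list of differentiations and
    the transversal coordinate. *)
Lemma sard n (A : set 'rV[R]_n) (f : 'rV[R]_n -> R) : open A -> smooth_on A f ->
  mu.-negligible (f @` critical A f).
Proof.
elim: n => [|n IH] in A f *.
  move=> _ _; apply: negligibleS (_ : mu.-negligible [set f 0]).
    by move=> _ [x _ <-] /=; congr f; apply/rowP => -[].
  apply/negligibleP; first exact: measurable_set1.
  exact: lebesgue_measure_set1.
move=> oA Cf.
pose S (si : seq 'I_n.+1 * 'I_n.+1) : set 'rV[R]_n.+1 :=
  [set x | [/\ critical A f x, partials si.1 f x = 0 & 'D_('e_(si.2)) (partials si.1 f) x != 0]].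
have NS : mu.-negligible (\bigcup_si (f @` S si)).
  apply: negligible_countable => -[s i].
  by apply: sard_hypersurface => //; exact: smooth_partials.
apply: negligibleS (negligibleU (flat_negligible oA Cf) NS) => _ [x Cx <-].
have : forall k, flat_upto k f x \/ exists si, S si x.
  elim=> [|k [fl|]]; [by left; case|idtac|by right].
  have [ex|nex] := pselect (exists si, S si x); first by right.
  left=> -[//|i s] _; rewrite ltnS leq_eqVlt => /orP[/eqP sk|sk]; last exact: (fl (i :: s)).
  (* First-order derivatives vanish because the point is critical. At higher order the tail [j :: s]
     gives a vanishing derivative to serve as the equation of the hypersurface. *)
  case: s sk => [|j s] sk; first exact: Cx.2.
  apply/eqP; apply: contrapT => /negP D0; apply: nex.
  have fs : partials (j :: s) f x = 0 by apply: fl => //; rewrite -sk.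
  by exists (j :: s, i); split.
case/(_ n.+1) => [fl|[si Sx]]; [left|right; exists si => //]; exists x => //.
by split=> //; exact: Cx.1.
Qed.

End Sard.

(** * Integral curves *)

Lemma rV_subE (V : zmodType) n (x y : 'rV[V]_n) i : (x - y) 0 i = x 0 i - y 0 i.
Proof. by rewrite !mxE. Qed.

(** Differentiability relative to [D] in little-o form: it needs no division and no exclusion of
    [s = t], and at an end point of [D] it is one-sided. *)
Definition velocity (R : realType) (V : normedModType R) (D : set R) (u : R -> V)
    (t : R) (v : V) : Prop :=
  forall e, 0 < e -> \forall s \near t, D s -> `|u s - u t - (s - t) *: v| <= e * `|s - t|.

(** * Picard iteration on the half-line *)

Section Picard.
Variables (R : realType).
Local Notation mu := (@lebesgue_measure R).

Lemma MVT_cc (f df : R -> R) (a b : R) : a <= b ->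
  (forall x, a <= x <= b -> is_derive x 1 f (df x)) ->
  exists2 c, a <= c <= b & f b - f a = df c * (b - a).
Proof.
move=> ab fd.
have [||c /[!in_itv] /= cab E] := @MVT_segment R f df a b ab.
- by move=> x /[!in_itv] /= /andP[? ?]; apply: fd; rewrite !ltW.
- apply: derivable_within_continuous => x /[!in_itv] /= xab.
  by have /@ex_derive := fd _ xab.
by exists c.
Qed.

Lemma derive_dominated (g h dg dh : R -> R) (t : R) : 0 <= t ->
  (forall s, 0 <= s <= t -> is_derive s 1 g (dg s)) ->
  (forall s, 0 <= s <= t -> is_derive s 1 h (dh s)) ->
  (forall s, 0 <= s <= t -> `|dg s| <= dh s) ->
  `|g t - g 0| <= h t - h 0.
Proof.
move=> t0 Dg Dh gh; rewrite ler_norml; apply/andP; split.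
  have [|c c0t] := @MVT_cc (fun s => h s + g s) (fun s => dh s + dg s) 0 t t0.
    by move=> s st; apply: is_deriveD; [exact: Dh|exact: Dg].
  have : 0 <= (dh c + dg c) * (t - 0).
    by rewrite subr0 mulr_ge0//; move: (gh c c0t); rewrite ler_norml; lra.
  by move=> /[swap] <-; lra.
have [|c c0t] := @MVT_cc (fun s => h s - g s) (fun s => dh s - dg s) 0 t t0.
  by move=> s st; apply: is_deriveB; [exact: Dh|exact: Dg].
have : 0 <= (dh c - dg c) * (t - 0).
  by rewrite subr0 mulr_ge0//; move: (gh c c0t); rewrite ler_norml; lra.
by move=> /[swap] <-; lra.
Qed.

(** Integration starts at -1, so that 0 is an interior point and the derivative there is two-sided;
    the second integral normalises the value at 0. *)
Definition antideriv (f : R -> R) (t : R) : R :=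
  (\int[mu]_(s in `[(-1 : R), t]) f s)%R - (\int[mu]_(s in `[(-1 : R), (0 : R)]) f s)%R.

Lemma antideriv0 f : antideriv f 0 = 0.
Proof. by rewrite /antideriv subrr. Qed.

Lemma is_derive_antideriv (f : R -> R) (t : R) : continuous f -> 0 <= t ->
  is_derive t 1 (antideriv f) (f t).
Proof.
move=> cf t0.
have ft : mu.-integrable `[(-1 : R), t + 1] (EFin \o f).
  apply: continuous_compact_integrable; first exact: segment_compact.
  exact: continuous_subspaceT.
have [||d1 d2] := @continuous_FTC1_closed R f (-1) t (t + 1) _ ft _ (cf t).
- by rewrite ltrDl.
- by rewrite (lt_le_trans _ t0)// oppr_lt0.
have dI : is_derive t 1 (fun x => (\int[mu]_(s in `[(-1 : R), x]) f s)%R) (f t).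
  exact: (DeriveDef d1 (etrans (esym (derive1E _ _)) d2)).
by rewrite -[f t]subr0; apply: is_deriveB.
Qed.

Variables (n : nat) (F : R -> 'rV[R]_n -> 'rV[R]_n) (L K : R).
Hypotheses (L0 : 0 < L) (K0 : 0 < K).
Hypothesis F_lip : forall t x y, `|F t x - F t y| <= L * `|x - y|.
Hypothesis F_bnd : forall t x, `|F t x| <= K.
Hypothesis F_cont : forall x, continuous (F ^~ x).
Variable y0 : 'rV[R]_n.

(** [Num.max s 0] freezes the integrand at negative times. It is then continuous on the whole line
    although the iterates are controlled for nonnegative times only. *)
Fixpoint picard_iter (k : nat) : R -> 'rV[R]_n :=
  if k is k'.+1 then fun t => y0 + \row_i antideriv
    (fun s => F (Num.max s 0) (picard_iter k' (Num.max s 0)) 0 i) t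
  else fun=> y0.

Let Y := picard_iter.

Let F_continuous (y : R -> 'rV[R]_n) (t : R) :
  {for t, continuous y} -> {for t, continuous (fun s => F s (y s))}.
Proof.
move=> cy; apply: eps_continuous => e e0.
have e10 : 0 < e / 2 by rewrite divr_gt0.
have e20 : 0 < e / 2 / L by rewrite divr_gt0.
have H1 := continuous_dist_le (@F_cont (y t) t) e10.
have H2 := continuous_dist_le cy e20.
apply: filterS2 H1 H2 => s h1 h2.
rewrite -(subrKA (F s (y t))) (le_trans (ler_normD _ _))// [leRHS]splitr lerD//.
by rewrite (le_trans (F_lip _ _ _))// mulrC -ler_pdivlMr.
Qed.

Let Y0 k : Y k 0 = y0.
Proof.
case: k => [//|k] /=.
by apply/rowP => i; rewrite !mxE antideriv0 addr0.
Qed.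

Let max_continuous : continuous (fun s : R => Num.max s 0).
Proof. by move=> s; apply: continuous_max; [exact: cvg_id|exact: cvg_cst]. Qed.

Let YP k : (forall t : R, 0 <= t -> {for t, continuous (Y k)}) /\
  forall (t : R) (i : 'I_n), 0 <= t -> is_derive t 1 (fun s => Y k.+1 s 0 i) (F t (Y k t) 0 i).
Proof.
have YS k' : (forall t : R, 0 <= t -> {for t, continuous (Y k')}) ->
    forall (t : R) (i : 'I_n), 0 <= t -> is_derive t 1 (fun s => Y k'.+1 s 0 i) (F t (Y k' t) 0 i).
  move=> cY t i t0.
  pose f s := F (Num.max s 0) (Y k' (Num.max s 0)) 0 i.
  have cf : continuous f.
    move=> s; have m0 : 0 <= Num.max s 0 by rewrite le_max lexx orbT.
    have c1 := F_continuous (cY _ m0).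
    have c2 := @continuous_comp _ _ _ (fun s : R => Num.max s 0)
      (fun s => F s (Y k' s)) s (@max_continuous s) c1.
    exact: (@continuous_comp _ _ _ ((fun s => F s (Y k' s)) \o (fun s : R => Num.max s 0))
      (fun M : 'rV[R]_n => M 0 i) s c2 (@coord_continuous _ _ _ _ _ _)).
  have := is_derive_antideriv cf t0; rewrite {2}/f max_l// => H.
  have -> : (fun s => Y k'.+1 s 0 i) = (fun s => y0 0 i + antideriv f s).
    by apply/funext => s; rewrite /= !mxE.
  by rewrite -[F _ _ _ _]add0r; apply: is_deriveD.
elim: k => [|k [IHc IHd]].
  have c0 (t : R) : 0 <= t -> {for t, continuous (Y 0)} by move=> _; exact: cvg_cst.
  by split=> //; exact: YS.
suff c (t : R) : 0 <= t -> {for t, continuous (Y k.+1)} by split=> //; exact: YS.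
move=> t0; apply: continuous_rV => i.
apply: differentiable_continuous; apply/derivable1_diffP.
by have /@ex_derive := IHd t i t0.
Qed.

Let Y_lip k (s t : R) : 0 <= s -> 0 <= t -> `|Y k s - Y k t| <= K * `|s - t|.
Proof.
wlog st : s t / s <= t => [H s0 t0|s0 t0].
  have [/H|/ltW/H] := leP s t; first exact.
  by rewrite distrC [`|s - t|]distrC; exact.
case: k => [|k]; first by rewrite /= subrr normr0 mulr_ge0// ltW.
rewrite distrC [`|s - t|]distrC rV_norm_le; last by rewrite mulr_ge0// ltW.
apply/forallP => i; rewrite !mxE.
have [c /andP[c1 _]|c _] := MVT_cc st (df := fun t => F t (Y k t) 0 i) (f := fun s => Y k.+1 s 0 i).
  by apply: (YP k).2; exact: le_trans s0 c1.
rewrite /= !mxE => ->; rewrite normrM ler_wpM2r//.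
exact: le_trans (rV_coord_le _ _) (F_bnd _ _).
Qed.

Let A := K / (2 * L).

(** The weight exp(2Lt) makes the iteration contract by 1/2 on the whole half-line, with no bound on
    the length of the time interval. [A] is chosen so that the first step, at most Kt, satisfies Kt
    = 2LtA <= A exp(2Lt). *)
Let Y_step k (t : R) : 0 <= t -> `|Y k.+1 t - Y k t| <= A / 2 ^+ k * expR (2 * L * t).
Proof.
have A0 : 0 < A by rewrite divr_gt0// mulr_gt0.
elim: k t => [|k IH] t t0.
  rewrite expr0 divr1 -[Y 0 t](Y0 1).
  apply: le_trans (Y_lip 1 t0 (lexx 0)) _.
  rewrite subr0 ger0_norm// /A -mulrA -mulrA; apply: ler_wpM2l; first exact: ltW.
  rewrite [leRHS]mulrC ler_pdivlMr ?mulr_gt0//.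
  by have := expR_ge1Dx (2 * (L * t)); lra.
rewrite rV_norm_le; last by rewrite mulr_ge0 ?expR_ge0// divr_ge0 ?exprn_ge0// ltW.
apply/forallP => i.
pose h (s : R) := A / 2 ^+ k.+1 * expR (2 * L * s).
have Dh (s : R) : is_derive s 1 h (L * (A / 2 ^+ k * expR (2 * L * s))).
  have D1 : is_derive s 1 (fun s : R => 2 * L * s) (2 * L).
    by rewrite -[X in is_derive _ _ _ X]mulr1; apply: is_deriveZ.
  have D2 := is_derive1_comp (is_derive_expR (2 * L * s)) D1.
  have D3 := is_deriveZ (A / 2 ^+ k.+1) D2.
  apply: (is_derive_eq D3).
  rewrite -[_ *: _]/(A / 2 ^+ k.+1 * (expR (2 * L * s) * (2 * L))) exprS; field.
  by rewrite expf_neq0.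
pose g (s : R) := Y k.+2 s 0 i - Y k.+1 s 0 i.
have -> : (Y k.+2 t - Y k.+1 t) 0 i = g t by rewrite rV_subE.
have g0 : g 0 = 0 by rewrite /g !Y0 subrr.
rewrite -[g t]subr0 -g0; apply: le_trans (derive_dominated
  (dg := fun s => F s (Y k.+1 s) 0 i - F s (Y k s) 0 i) t0 _ (fun s _ => Dh s) _) _.
- move=> s /andP[s0 _]; apply: is_deriveB; exact: (YP _).2.
- move=> s /andP[s0 _]; have := rV_coord_le (F s (Y k.+1 s) - F s (Y k s)) i.
  rewrite !mxE => /le_trans; apply; apply: le_trans (F_lip _ _ _) _.
  by rewrite ler_wpM2l ?(ltW L0)//; exact: IH.
- by rewrite gerBl /h mulr_ge0 ?expR_ge0// divr_ge0 ?exprn_ge0// ltW.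
Qed.

Let Y_cvg (t : R) i : 0 <= t -> cvgn (fun k => Y k t 0 i).
Proof.
move=> t0; pose u k := Y k t 0 i.
have A0 : 0 < A by rewrite divr_gt0// mulr_gt0.
suff : cvgn (series (telescope u)).
  move=> cu; have : cvgn (fun k => u 0%N + series (telescope u) k).
    by apply: is_cvgD; [exact: is_cvg_cst|exact: cu].
  by under eq_fun do rewrite -eq_sum_telescope.
apply: normed_cvg.
apply: (series_le_cvg (v_ := geometric (A * expR (2 * L * t)) 2^-1)) => // k.
- exact: normr_ge0.
- by rewrite /geometric /= mulr_ge0 ?exprn_ge0 ?invr_ge0// mulr_ge0 ?expR_ge0// ltW.
- rewrite -[leLHS]/(`|Y k.+1 t 0 i - Y k t 0 i|) -rV_subE.
  apply: le_trans (rV_coord_le _ _) _; apply: le_trans (Y_step k t0) _.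
  by rewrite /geometric /= exprVn mulrAC.
- by apply: is_cvg_geometric_series; rewrite ger0_norm ?invr_ge0// invf_lt1// ltr1n.
Qed.

Lemma picard : exists y : R -> 'rV[R]_n, [/\ y 0 = y0,
  forall s t : R, 0 <= s -> 0 <= t -> `|y s - y t| <= K * `|s - t| &
  forall t : R, 0 <= t -> velocity [set s | 0 <= s] y t (F t (y t))].
Proof.
pose y t : 'rV[R]_n := \row_i limn (fun k => Y k t 0 i).
have y_near (t e : R) : 0 <= t -> 0 < e -> \forall k \near \oo, `|Y k t - y t| <= e.
  move=> t0 e0.
  have : \forall k \near \oo, forall i, `|y t 0 i - Y k t 0 i| <= e.
    apply: (@filter_forall _ 'I_n (fun i k => `|y t 0 i - Y k t 0 i| <= e) \oo _) => i.
    have yE : (fun k => Y k t 0 i) @ \oo --> y t 0 i by rewrite mxE; exact: Y_cvg.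
    by move/cvgrPdist_le : yE; exact.
  apply: filterS => k Hk; rewrite distrC rV_norm_le ?(ltW e0)//.
  by apply/forallP => i; rewrite rV_subE.
have near2 (s t e : R) : 0 <= s -> 0 <= t -> 0 < e ->
    exists k, [/\ `|Y k.+1 s - y s| <= e, `|Y k.+1 t - y t| <= e & `|Y k t - y t| <= e].
  move=> s0 t0 e0.
  have [N1 _ H1] := y_near s e s0 e0; have [N2 _ H2] := y_near t e t0 e0.
  exists (maxn N1 N2); split; [apply: H1|apply: H2|apply: H2] => /=.
  - by rewrite leqW// leq_maxl.
  - by rewrite leqW// leq_maxr.
  - exact: leq_maxr.
have y_lip (s t : R) : 0 <= s -> 0 <= t -> `|y s - y t| <= K * `|s - t|.
  move=> s0 t0; apply/ler_addgt0Pr => e e0.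
  have e20 : 0 < e / 2 by rewrite divr_gt0.
  have [k [k1 k2 _]] := near2 s t _ s0 t0 e20.
  have -> : y s - y t = (y s - Y k.+1 s) + ((Y k.+1 s - Y k.+1 t) + (Y k.+1 t - y t)).
    by move: (Y k.+1 s) (Y k.+1 t) => a b; rewrite !subrKA.
  rewrite {1}(splitr e) addrCA (le_trans (ler_normD _ _))// lerD//; first exact: Y_lip.
  by rewrite (le_trans (ler_normD _ _))// lerD// distrC.
exists y; split=> //.
  apply/rowP => i; rewrite mxE.
  by under eq_fun do rewrite Y0; rewrite lim_cst.
move=> t t0 e e0.
have e20 : 0 < e / 2 by rewrite divr_gt0.
have e30 : 0 < e / 2 / (L * K) by rewrite divr_gt0// mulr_gt0.
have H1 := continuous_dist_le (@F_cont (y t) t) e20.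
have [d /= d0 Hd] := (nbhs_ballP _ _).1 (filterI H1 (near_dist_le t e30)).
apply/nbhs_ballP; exists d => // s; rewrite -ball_normE /= => sd s0.
apply/ler_addgt0Pr => e' e'0.
(* With closeness [e' / q], the replacement errors at [s] and [t] and the one inside the field add
   up to exactly [e']. *)
pose q := 2 + `|s - t| * L.
have q0 : 0 < q by rewrite ltr_pwDl// mulr_ge0// ltW.
have [k [k1 k2 k3]] := near2 s t (e' / q) s0 t0 (divr_gt0 e'0 q0).
(* The iterates are compared with [y] at the two times [s] and [t] only; at the intermediate time
   [c] their common Lipschitz constant [K] suffices, so uniform convergence in time is not
   involved. *)
have main : `|Y k.+1 s - Y k.+1 t - (s - t) *: F t (y t)| <=
    `|s - t| * (e + L * (e' / q)).
  rewrite rV_norm_le; last first.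
    by rewrite mulr_ge0// addr_ge0 ?(ltW e0)// mulr_ge0 ?(ltW L0)// divr_ge0// ltW.
  apply/forallP => i; rewrite !mxE.
  have [c [c0 cd E]] : exists c, [/\ 0 <= c, `|t - c| <= `|t - s| &
      Y k.+1 s 0 i - Y k.+1 t 0 i = F c (Y k c) 0 i * (s - t)].
    have [st|/ltW ts] := leP s t.
      have [c /andP[c1 c2]|c /andP[c1 c2] E] := MVT_cc st (df := fun t => F t (Y k t) 0 i) (f := fun s => Y k.+1 s 0 i).
        by apply: (YP k).2; exact: le_trans s0 c1.
      exists c; split; first exact: le_trans s0 c1.
        by rewrite !ger0_norm ?subr_ge0//; lra.
      by move: E; lra.
    have [c /andP[c1 c2]|c /andP[c1 c2] E] := MVT_cc ts (df := fun t => F t (Y k t) 0 i) (f := fun s => Y k.+1 s 0 i).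
      by apply: (YP k).2; exact: le_trans t0 c1.
    exists c; split; [exact: le_trans t0 c1| |exact: E].
    by rewrite !ler0_norm ?subr_le0//; lra.
  have tc : ball t d c by rewrite -ball_normE /= (le_lt_trans cd).
  have [h1 h2] := Hd _ tc.
  move: E; rewrite /= !mxE => E.
  rewrite E mulrC -mulrBr normrM ler_wpM2l//.
  have := rV_coord_le (F c (Y k c) - F t (y t)) i; rewrite !mxE => /le_trans; apply.
  rewrite -(subrKA (F c (y t))) (le_trans (ler_normD _ _))//.
  have f1 := F_lip c (Y k c) (y t).
  have f2 : `|Y k c - y t| <= K * (e / 2 / (L * K)) + e' / q.
    rewrite -(subrKA (Y k t)) (le_trans (ler_normD _ _))// lerD//.
    apply: le_trans (Y_lip k c0 t0) _; rewrite ler_wpM2l ?(ltW K0)//.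
    by rewrite distrC.
  have f3 : `|F c (y t) - F t (y t)| <= e / 2 by rewrite distrC.
  have f4 : L * (K * (e / 2 / (L * K))) = e / 2.
    by field; rewrite !gt_eqF.
  have f5 : L * `|Y k c - y t| <= L * (K * (e / 2 / (L * K)) + e' / q).
    by rewrite ler_wpM2l// ltW.
  rewrite mulrDr f4 in f5; lra.
have -> : y s - y t - (s - t) *: F t (y t) = (y s - Y k.+1 s) +
    ((Y k.+1 s - Y k.+1 t - (s - t) *: F t (y t)) + (Y k.+1 t - y t)).
  by move: (Y k.+1 s) (Y k.+1 t) => a b; apply/rowP => j; rewrite !mxE; ring.
have n1 := ler_normD (y s - Y k.+1 s) ((Y k.+1 s - Y k.+1 t - (s - t) *: F t (y t)) + (Y k.+1 t - y t)).
have n2 := ler_normD (Y k.+1 s - Y k.+1 t - (s - t) *: F t (y t)) (Y k.+1 t - y t).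
have qe : e' = 2 * (e' / q) + `|s - t| * (L * (e' / q)).
  by rewrite /q; field; rewrite gt_eqF.
rewrite distrC in k1.
have n3 : `|s - t| * (e + L * (e' / q)) = e * `|s - t| + `|s - t| * (L * (e' / q)) by ring.
lra.
Qed.

End Picard.

(** * Left translations in charts *)

(** Composition with an affine inner map permits outer functions on any normed module, in particular
    on the product space where the group multiplication is smooth. *)
Lemma Ck_affine (R : realType) (V1 V2 W : normedModType R) k (A : set V2)
    (f : V2 -> W) (i : V1 -> V2) (l : V1 -> V2) :
  (forall (h : R) v x, i (h *: v + x) = h *: l v + i x) -> continuous i ->
  Ck k A f -> Ck k (i @^-1` A) (f \o i).
Proof.
move=> il ci; elim: k f => [|k IH] f [cf Hf].
  by split=> // x Ax; apply: continuous_comp; [exact: ci|exact: cf].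
split=> [x Ax|v]; first by apply: continuous_comp; [exact: ci|exact: cf].
have [df Df] := Hf (l v).
have E x : (fun h : R => h^-1 *: (((f \o i) \o shift x) (h *: v) - (f \o i) x)) =
    (fun h : R => h^-1 *: ((f \o shift (i x)) (h *: l v) - f (i x))).
  by apply/funext => h /=; rewrite il.
split=> [x Ax|]; first by rewrite /derivable E; exact: df.
rewrite (_ : 'D_v (f \o i) = 'D_(l v) f \o i); first exact: IH.
by apply/funext => x; rewrite /derive E.
Qed.

Section Velocity.
Variables (R : realType).
Implicit Types (D : set R) (t : R).

Lemma velocity_quotient (V : normedModType R) D (u : R -> V) t v :
  (s - t)^-1 *: (u s - u t) @[s --> within D t^'] --> v <-> velocity D u t v.
Proof.
have key s : s != t -> `|v - (s - t)^-1 *: (u s - u t)| * `|s - t| =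
    `|u s - u t - (s - t) *: v|.
  move=> st; rewrite mulrC -normrZ scalerBr scalerA mulfV ?subr_eq0//.
  by rewrite scale1r distrC.
split=> [/cvgrPdist_le H e e0|H].
  have := H _ e0; rewrite near_withinE near_withinE; apply: filterS => s Hs Ds.
  have [->|st] := eqVneq s t; first by rewrite !subrr scale0r subrr !normr0 mulr0.
  by rewrite -key// ler_wpM2r// Hs.
apply/cvgrPdist_le => e e0; rewrite near_withinE near_withinE.
apply: filterS (H _ e0) => s Hs st Ds.
have := Hs Ds; rewrite -key// ler_pM2r// normr_gt0 subr_eq0; exact: st.
Qed.

Lemma velocity_bound (V : normedModType R) D (u : R -> V) t v : velocity D u t v ->
  \forall s \near t, D s -> `|u s - u t| <= (1 + `|v|) * `|s - t|.
Proof.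
move=> /(_ 1 ltr01); apply: filterS => s Hs Ds; have := Hs Ds.
rewrite -{2}(subrK ((s - t) *: v) (u s - u t)) => H.
by rewrite (le_trans (ler_normD _ _))// mulrDl lerD// normrZ mulrC.
Qed.

Lemma velocity_diff (V W : normedModType R) D (u : R -> V) t v (h : V -> W) :
  velocity D u t v -> differentiable h (u t) ->
  velocity D (h \o u) t ('d h (u t) v).
Proof.
move=> uv dh e e0; have e20 : 0 < e / 2 by rewrite divr_gt0.
have [k k0 Hk] := linear_lipschitz (diff_continuous dh).
have vb : 0 < 1 + `|v| by rewrite ltr_pwDl.
have e'0 : 0 < e / 2 / (1 + `|v|) by rewrite divr_gt0.
have ek0 : 0 < e / 2 / k by rewrite divr_gt0.
have /nbhs_ballP[d /= d0 Hd] := differentiable_eps dh e'0.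
have d10 : 0 < d / (1 + `|v|) / 2 by rewrite !divr_gt0.
apply: filterS3 (uv _ ek0) (velocity_bound uv) (near_dist_le t d10) => s H1 H2 H3 Ds.
have {}H1 := H1 Ds; have {}H2 := H2 Ds.
have us : ball (u t) d (u s).
  rewrite -ball_normE /= distrC (le_lt_trans H2)// mulrC -ltr_pdivlMr//.
  by rewrite distrC (le_lt_trans H3)// gtr_pMr ?invf_lt1 ?divr_gt0// ltr1n.
have H4 := Hd _ us.
have -> : h (u s) - h (u t) - (s - t) *: 'd h (u t) v =
  (h (u s) - h (u t) - 'd h (u t) (u s - u t)) + 'd h (u t) (u s - u t - (s - t) *: v).
  have -> : 'd h (u t) (u s - u t - (s - t) *: v) =
      'd h (u t) (u s - u t) - (s - t) *: 'd h (u t) v by rewrite linearB linearZ.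
  by rewrite addrA subrK.
rewrite (le_trans (ler_normD _ _))// (splitr e) mulrDl lerD//.
  apply: le_trans H4 _; rewrite -ler_pdivlMl//.
  by apply: le_trans H2 _; rewrite invf_div mulrA divfK ?gt_eqF// invfM mulrA.
by rewrite (le_trans (Hk _))// mulrC -ler_pdivlMr// mulrAC.
Qed.

Lemma velocity_near (V : normedModType R) D (u u' : R -> V) t v :
  (\forall s \near t, D s -> u s = u' s) -> u t = u' t ->
  velocity D u t v -> velocity D u' t v.
Proof.
move=> uu' ut uv e e0; apply: filterS2 uu' (uv _ e0) => s h1 h2 Ds.
by rewrite -h1// -ut; exact: h2.
Qed.

End Velocity.

Section GroupCharts.
Variables (R : realType) (n : nat) (G : lieGroupType R n).
Implicit Types (c d : chart R n G) (g k : G) (D : set R) (t : R).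

Lemma chart_imgP c g : chart_dom c g -> chart_img c (chart_coord c g).
Proof. by move=> cg; exists g. Qed.

Lemma chart_inv_dom c u : chart_img c u -> chart_dom c (chart_inv c u).
Proof. by move=> [g cg <-]; rewrite chart_coordK. Qed.

Lemma chart_invK c u : chart_img c u -> chart_coord c (chart_inv c u) = u.
Proof. by move=> [g cg <-]; rewrite chart_coordK. Qed.

Lemma chart_img_nbhs c u : chart_img c u -> nbhs u (chart_img c).
Proof. by move=> cu; apply: open_nbhs_nbhs; split=> //; exact: chart_img_open. Qed.

Lemma chart_dom_nbhs c g : chart_dom c g -> nbhs g (chart_dom c).
Proof. by move=> cu; apply: open_nbhs_nbhs; split=> //; exact: chart_dom_open. Qed.

Definition mul_dom c1 c2 c3 : set ('rV[R]_n * 'rV[R]_n) :=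
  [set u | [/\ chart_img c1 u.1, chart_img c2 u.2 &
     chart_dom c3 (chart_inv c1 u.1 * chart_inv c2 u.2)%g]].

Definition mul_coord c1 c2 c3 (u : 'rV[R]_n * 'rV[R]_n) : 'rV[R]_n :=
  chart_coord c3 (chart_inv c1 u.1 * chart_inv c2 u.2)%g.

Lemma mul_dom_open c1 c2 c3 : open (mul_dom c1 c2 c3).
Proof.
rewrite openE => -[u z] [/= cu cz c3uz].
have f1 : q.1 @[q --> (u, z)] --> u by exact: cvg_fst.
have f2 : q.2 @[q --> (u, z)] --> z by exact: cvg_snd.
have pc : (chart_inv c1 q.1, chart_inv c2 q.2) @[q --> (u, z)] -->
    (chart_inv c1 u, chart_inv c2 z).
  apply: cvg_pair; first exact: (cvg_comp _ _ f1 (chart_inv_cts cu)).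
  exact: (cvg_comp _ _ f2 (chart_inv_cts cz)).
have cm := cvg_comp _ _ pc (mulg_cts (chart_inv c1 u, chart_inv c2 z)).
have h1 : \forall q \near (u, z), chart_img c1 q.1 := f1 _ (chart_img_nbhs cu).
have h2 : \forall q \near (u, z), chart_img c2 q.2 := f2 _ (chart_img_nbhs cz).
have h3 : \forall q \near (u, z), chart_dom c3 (chart_inv c1 q.1 * chart_inv c2 q.2)%g :=
  cm _ (chart_dom_nbhs c3uz).
by rewrite /interior; apply: filterS3 h1 h2 h3 => q q1 q2 q3; split.
Qed.

Definition tmap k c d (u : 'rV[R]_n) : 'rV[R]_n := chart_coord d (k * chart_inv c u)%g.

(** Left translation is the multiplication restricted to the slice whose first variable is the
    coordinate of [k]. *)
Lemma tmap_smooth k c d u : atlas c -> atlas d -> chart_img c u ->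
  chart_dom d (k * chart_inv c u)%g ->
  exists A, [/\ open A, A u & smooth_on A (tmap k c d)].
Proof.
move=> ac ad cu dku; pose ck := chart_at k; pose uk := chart_coord ck k.
have kuk : chart_inv ck uk = k by apply: chart_coordK; exact: chart_at_dom.
pose i (z : 'rV[R]_n) := (uk, z).
have ci : continuous i.
  move=> z B /nbhs_ballP[e /= e0 eB]; apply/nbhs_ballP; exists e => // z' zz'.
  by apply: eB; split => //=; exact: ballxx.
exists (i @^-1` mul_dom ck c d); split.
- by apply: open_comp => [z _|]; [exact: ci|exact: mul_dom_open].
- split=> //=; last by rewrite kuk.
  by apply: chart_imgP; exact: chart_at_dom.
- move=> m; have -> : tmap k c d = mul_coord ck c d \o i.
    by apply/funext => z; rewrite /tmap /mul_coord /= kuk.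
  apply: (Ck_affine (l := fun v => (0, v))) => //.
    by move=> h v x; rewrite /i; congr (_, _); rewrite /= scaler0 add0r.
  by apply: mulg_smooth => //; exact: atlas_chart_at.
Qed.

Lemma tmap_differentiable k c d u : atlas c -> atlas d -> chart_img c u ->
  chart_dom d (k * chart_inv c u)%g -> differentiable (tmap k c d) u.
Proof.
move=> ac ad cu dku; have [A [oA Au CA]] := tmap_smooth ac ad cu dku.
exact: Ck1_differentiable_rV oA (CA 1%N) Au.
Qed.

Local Notation c0 := (chart_at (1%g : G)).
Local Notation v0 := (chart_coord c0 (1%g : G)).

Lemma c0_dom : chart_dom c0 1%g. Proof. exact: chart_at_dom. Qed.

Lemma v0_img : chart_img c0 v0. Proof. exact: chart_imgP c0_dom. Qed.

Lemma inv_v0 : chart_inv c0 v0 = 1%g. Proof. exact: chart_coordK c0_dom. Qed.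

(* [left_diff g] is the case [c = chart_at g]. *)
Definition ldiff c g (v : 'rV[R]_n) : 'rV[R]_n := 'd (tmap g c0 c) v0 v.

Lemma tmap_v0_differentiable g c : atlas c -> chart_dom c g ->
  differentiable (tmap g c0 c) v0.
Proof.
move=> ac cg; apply: tmap_differentiable => //; [exact: atlas_chart_at|exact: v0_img|].
by rewrite inv_v0 mulg1.
Qed.

(** Left invariance, as the chain rule for the composition of the translations by [g] and by [k].
    Read in charts it equals the translation by [k * g] only near [v0], where products with [g]
    remain in the domain of [c]. *)
Lemma ldiff_translate k g c d v : atlas c -> atlas d -> chart_dom c g ->
  chart_dom d (k * g)%g ->
  'd (tmap k c d) (chart_coord c g) (ldiff c g v) = ldiff d (k * g)%g v.
Proof.
move=> ac ad cg dkg.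
have t0 : tmap g c0 c v0 = chart_coord c g by rewrite /tmap inv_v0 mulg1.
have d1 := tmap_v0_differentiable ac cg.
have d2 : differentiable (tmap k c d) (tmap g c0 c v0).
  rewrite t0; apply: tmap_differentiable => //; first exact: chart_imgP.
  by rewrite chart_coordK.
have d3 := tmap_v0_differentiable ad dkg.
have E : 'd (tmap k c d \o tmap g c0 c) v0 v =
    'd (tmap k c d) (tmap g c0 c v0) ('d (tmap g c0 c) v0 v).
  exact: (congr1 (fun F : 'rV[R]_n -> 'rV[R]_n => F v) (diff_comp d1 d2)).
have dcomp : differentiable (tmap k c d \o tmap g c0 c) v0 by exact: differentiable_comp.
have E' w : tmap g c0 c v0 = w ->
    'd (tmap k c d) w (ldiff c g v) = 'D_v (tmap k c d \o tmap g c0 c) v0.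
  by move=> <-; exact: (esym (etrans (deriveE v dcomp) E)).
apply: (etrans (E' _ t0)); apply: etrans (deriveE v d3).
apply: near_eq_derive.
have pc : (g, chart_inv c0 z) @[z --> v0] --> (g, chart_inv c0 v0).
  move=> B [[B1 B2] [/= B1g B2v] BB].
  have h : \forall z \near v0, B2 (chart_inv c0 z) := chart_inv_cts v0_img B2v.
  rewrite /fmap /=; apply: filterS h => z Bz.
  by apply: BB; split => //=; exact: nbhs_singleton.
have cm := cvg_comp _ _ pc (mulg_cts (g, chart_inv c0 v0)).
have : \forall z \near v0, chart_dom c (g * chart_inv c0 z)%g.
  by apply: cm; rewrite inv_v0 mulg1; exact: chart_dom_nbhs.
by apply: filterS => z cz; rewrite /= /tmap chart_coordK// mulgA.
Qed.

Lemma velocity_translate k (p : R -> G) c d D t v : atlas c -> atlas d ->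
  chart_dom c (p t) -> chart_dom d (k * p t)%g -> p s @[s --> within D (nbhs t)] --> p t ->
  velocity D (chart_coord c \o p) t (ldiff c (p t) v) ->
  velocity D (fun s => chart_coord d (k * p s)%g) t (ldiff d (k * p t)%g v).
Proof.
move=> ac ad cp dp pc pv.
have dt : differentiable (tmap k c d) (chart_coord c (p t)).
  by apply: tmap_differentiable => //; [exact: chart_imgP|rewrite chart_coordK].
have := eq_ind _ (velocity D (tmap k c d \o (chart_coord c \o p)) t)
  (velocity_diff pv dt) _ (ldiff_translate v ac ad cp dp).
apply: velocity_near; last by rewrite /= /tmap chart_coordK.
have nD : \forall s \near t, D s -> chart_dom c (p s) := pc _ (chart_dom_nbhs cp).
apply: filterS nD => s ps Ds.
by rewrite /= /tmap chart_coordK//; exact: ps.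
Qed.

(** A change of charts is the translation by the identity read in two charts. *)
Lemma velocity_chart_change (p : R -> G) c d D t v : atlas c -> atlas d ->
  chart_dom c (p t) -> chart_dom d (p t) -> p s @[s --> within D (nbhs t)] --> p t ->
  velocity D (chart_coord c \o p) t (ldiff c (p t) v) ->
  velocity D (chart_coord d \o p) t (ldiff d (p t) v).
Proof.
move=> ac ad cp dp pc pv.
have E : (1 * p t)%g = p t by exact: mul1g.
have dp' : chart_dom d (1 * p t)%g by rewrite E.
have := velocity_translate ac ad cp dp' pc pv; rewrite E.
apply: velocity_near; last by rewrite E.
by near=> s => _; rewrite /= mul1g.
Unshelve. all: by end_near. Qed.

(** [has_velocity] is stated in the chart chosen at [p t], which changes along the curve. For
    velocities of the form [left_diff] any chart of the atlas may be used instead, in particular a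
    fixed one. *)
Lemma has_velocityP (p : R -> G) D t v c : atlas c -> chart_dom c (p t) ->
  has_velocity D (left_diff (p t) v) <->
  p s @[s --> within D (nbhs t)] --> p t /\
  velocity D (chart_coord c \o p) t (ldiff c (p t) v).
Proof.
move=> ac cp; have at_ := atlas_chart_at (p t); have dt := chart_at_dom (p t).
have q := velocity_quotient D (chart_coord (chart_at (p t)) \o p) t
  (ldiff (chart_at (p t)) (p t) v).
split=> -[pc pv]; split.
- exact: pc.
- exact: (velocity_chart_change at_ ac dt cp pc (q.1 pv)).
- exact: pc.
- exact: (q.2 (velocity_chart_change ac at_ cp dt pc pv)).
Qed.

End GroupCharts.

(** * Continuation arguments and calculus of one-sided velocities *)

Section CurveTools.
Variables (R : realType).
Implicit Types (D : set R) (t : R).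

(** Continuation principle, by looking at the infimum of the times where [P] fails. It keeps curves
    inside charts and boxes, where the velocity estimates are available. *)
Lemma real_induction (P : R -> Prop) (b : R) : P 0 ->
  (forall t, 0 <= t -> P t -> \forall s \near t, 0 <= s -> P s) ->
  (forall T, 0 < T <= b -> (forall t, 0 <= t < T -> P t) -> P T) ->
  forall t, 0 <= t <= b -> P t.
Proof.
move=> P0 Po Pc t0 /andP[t00 t0b]; apply: contrapT => nP.
pose E := [set t | 0 <= t <= b /\ ~ P t].
have Et0 : E t0 by split=> //; apply/andP.
have Elb : has_lbound E by exists 0 => t [/andP[]].
have hE : has_inf E by split=> //; exists t0.
pose T := inf E.
have T0 : 0 <= T by apply: lb_le_inf; [exists t0|move=> t [/andP[]]].
have Tb : T <= b by apply: le_trans t0b; exact: ge_inf.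
have PT t : 0 <= t < T -> P t.
  move=> /andP[t1 t2]; apply: contrapT => nPt.
  have : T <= t by apply: ge_inf => //; split=> //; rewrite t1 (le_trans (ltW t2)).
  by rewrite leNgt t2.
have PTT : P T.
  have [->//|Tn0] := eqVneq T 0.
  by apply: Pc => //; rewrite Tb lt0r Tn0 T0.
have /nbhs_ballP[d /= d0 Hd] := Po _ T0 PTT.
have [t [/andP[t1 t2] nPt] tT] := inf_adherent d0 hE.
apply: (nPt); apply: Hd => //; rewrite -ball_normE /= distrC ger0_norm.
  by rewrite ltrBlDl.
by rewrite subr_ge0; apply: ge_inf => //; split=> //; apply/andP.
Qed.

Lemma closed_left_limit (T : topologicalType) (C : set T) (p : R -> T) t :
  closed C -> 0 < t -> p s @[s --> within [set s | 0 <= s] (nbhs t)] --> p t ->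
  (forall s, 0 <= s < t -> C (p s)) -> C (p t).
Proof.
move=> cC t0 pc Cp; apply: contrapT => nC.
have nC' : nbhs (p t) (~` C) by apply: open_nbhs_nbhs; split=> //; exact: closed_openC.
have : \forall s \near t, 0 <= s -> ~ C (p s) := pc _ nC'.
move=> /nbhs_ballP[d /= d0 Hd].
pose s := Num.max 0 (t - d / 2).
have st : s < t by rewrite gt_max t0 ltrBlDr ltrDl divr_gt0.
have s0 : 0 <= s by rewrite le_max lexx.
apply: (Hd s _ s0 (Cp s _)); last by rewrite s0.
rewrite -ball_normE /= ger0_norm ?subr_ge0 ?ltW//.
rewrite ltrBlDr -ltrBlDl lt_max; apply/orP; right.
by rewrite ltrD2l ltrN2 gtr_pMr// invf_lt1// ltr1n.
Qed.

Section VelocityCalculus.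
Variables (V W : normedModType R).
Implicit Types u : R -> V.

Lemma velocity_subset D D' u t v : D' `<=` D -> velocity D u t v -> velocity D' u t v.
Proof. by move=> DD H e e0; apply: filterS (H _ e0) => s Hs /DD. Qed.

Lemma velocity_subset_near D D' u t v : (\forall s \near t, D' s -> D s) ->
  velocity D u t v -> velocity D' u t v.
Proof. by move=> DD H e e0; apply: filterS2 DD (H _ e0) => s Hs Hs' /Hs. Qed.

Lemma velocityU D D' u t v : velocity D u t v -> velocity D' u t v ->
  velocity (D `|` D') u t v.
Proof.
move=> H H' e e0; apply: filterS2 (H _ e0) (H' _ e0) => s h h' [|].
  exact: h.
exact: h'.
Qed.

Lemma velocityB D u u' t v v' : velocity D u t v -> velocity D u' t v' ->
  velocity D (fun s => u s - u' s) t (v - v').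
Proof.
move=> H H' e e0; have e20 : 0 < e / 2 by rewrite divr_gt0.
apply: filterS2 (H _ e20) (H' _ e20) => s h h' Ds.
have -> : u s - u' s - (u t - u' t) - (s - t) *: (v - v') =
  (u s - u t - (s - t) *: v) - (u' s - u' t - (s - t) *: v').
  have sub4 (a b c d : V) : a - b - (c - d) = a - c - (b - d).
    by rewrite !opprB addrACA (addrC (- b)) addrACA.
  by rewrite scalerBr (sub4 (u s)) [LHS]sub4.
rewrite (le_trans (ler_normB _ _))// (splitr e) mulrDl lerD//.
  exact: h.
exact: h'.
Qed.

Lemma velocity_linear D t (v : V) : velocity D (fun s => s *: v) t v.
Proof.
move=> e e0; near=> s => _.
by rewrite -scalerBl subrr normr0 mulr_ge0// ltW.
Unshelve. all: by end_near. Qed.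

End VelocityCalculus.

Lemma velocity_coord n D (u : R -> 'rV[R]_n) t v i : velocity D u t v ->
  velocity D (fun s => u s 0 i) t (v 0 i).
Proof.
move=> H e e0; apply: filterS (H _ e0) => s h Ds; apply: le_trans (h Ds).
by have := rV_coord_le (u s - u t - (s - t) *: v) i; rewrite !mxE.
Qed.

Lemma velocity_is_derive (u : R -> R) t v : 0 < t ->
  velocity [set s | 0 <= s] u t v -> is_derive t 1 u v.
Proof.
move=> t0 H.
suff L : h^-1 *: (u (h *: (1 : R) + t) - u t) @[h --> 0^'] --> v.
  by apply: DeriveDef; [apply/cvg_ex; eexists; exact: L|exact: cvg_lim L].
apply/cvgrPdist_le => e e0.
have tn : \forall s \near t, 0 <= s.
  by apply/nbhs_ballP; exists t => // s; rewrite -ball_normE /= ltr_norml; lra.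
have [d /= d0 Hd] := (nbhs_ballP _ _).1 (filterI tn (H _ e0)).
near=> h.
have h0 : h != 0 by near: h; exact: nbhs_dnbhs_neq.
have hd : `|h| < d by near: h; exact: dnbhs0_lt.
have bt : ball t d (h + t) by rewrite -ball_normE /= opprD addrCA subrr addr0 normrN.
have [s0 Hs] := Hd _ bt; have {}Hs := Hs s0.
rewrite addrK in Hs; rewrite [h *: 1]mulr1 distrC.
rewrite -(ler_pM2r (x := `|h|)) ?normr_gt0// -normrM mulrBl mulrC.
by rewrite -[h^-1 *: _]/(h^-1 * _) mulVKf// [v * h]mulrC.
Unshelve. all: by end_near. Qed.

Lemma velocity_MVT (w dw : R -> R) (a b : R) : 0 <= a <= b ->
  (forall t, a <= t <= b -> velocity [set s | 0 <= s] w t (dw t)) ->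
  exists2 c, a <= c <= b & w b - w a = dw c * (b - a).
Proof.
(* Freezing [w] at negative times turns its one-sided continuity at 0 into the two-sided one of the
   mean value theorem. *)
move=> /andP[a0 ab] H; pose w' s := w (Num.max s 0).
have [E|anb] := eqVneq a b.
  by exists a; rewrite ?lexx// E !subrr mulr0.
have {anb}ab' : a < b by rewrite lt_neqAle anb.
have w'c t : a <= t <= b -> {for t, continuous w'}.
  move=> tab; apply: eps_continuous => e e0.
  have k0 : 0 < 1 + `|dw t| by rewrite ltr_pwDl.
  have ek : 0 < e / (1 + `|dw t|) by rewrite divr_gt0.
  have t0 : 0 <= t by case/andP: tab => at_ _; exact: le_trans at_.
  have [d /= d0 Hd] := (nbhs_ballP _ _).1 (velocity_bound (H _ tab)).
  have d1 : 0 < Num.min d (e / (1 + `|dw t|)) by rewrite lt_min d0.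
  apply/nbhs_ballP; exists (Num.min d (e / (1 + `|dw t|))) => //= s.
  rewrite -ball_normE /= lt_min => /andP[sd se].
  have mt : `|Num.max s 0 - t| <= `|t - s|.
    rewrite distrC; have [s0|s0] := leP 0 s; first by rewrite lexx.
    by rewrite subr0 !ger0_norm// ?subr_ge0; lra.
  rewrite distrC /w' (max_l t0).
  have := Hd (Num.max s 0).
  rewrite -ball_normE /= (distrC t) => /(_ (le_lt_trans mt sd)).
  rewrite le_max lexx orbT => /(_ isT)/le_trans; apply.
  rewrite mulrC -ler_pdivlMr//; exact: le_trans mt (ltW se).
have [||c /[!in_itv] /= /andP[c1 c2] E] := @MVT R w' dw a b ab'.
- move=> t /[!in_itv] /= /andP[t1 t2].
  have tp : 0 < t by exact: le_lt_trans t1.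
  have := velocity_is_derive tp (H t _); rewrite !ltW// => /(_ isT).
  apply: near_eq_is_derive; near=> s.
  rewrite /w' max_l//; apply: ltW; near: s; exact: lt_nbhsr.
- by apply: continuous_in_subspaceT => t /set_mem /=; rewrite in_itv; exact: w'c.
exists c; first by rewrite !ltW.
by move: E; rewrite /w' !max_l// (le_trans a0).
Unshelve. all: by end_near. Qed.

Lemma velocity_lipschitz n (u du : R -> 'rV[R]_n) (a b K : R) : 0 <= a <= b ->
  (forall t, a <= t <= b -> velocity [set s | 0 <= s] u t (du t)) ->
  (forall t, a <= t <= b -> `|du t| <= K) ->
  `|u b - u a| <= K * (b - a).
Proof.
move=> ab H HK; have K0 : 0 <= K.
  by apply: le_trans (HK a _) => //; case/andP: ab => _ ab; rewrite lexx.
rewrite rV_norm_le; last by rewrite mulr_ge0// subr_ge0; case/andP: ab.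
apply/forallP => i; rewrite rV_subE.
have [t tab|c cab ->] := velocity_MVT (w := fun s => u s 0 i) (dw := fun s => du s 0 i) ab.
  exact: velocity_coord (H _ tab).
rewrite normrM [`|b - a|]ger0_norm ?subr_ge0; last by case/andP: ab.
rewrite ler_wpM2r ?subr_ge0; [by []|by case/andP: ab|].
exact: le_trans (rV_coord_le _ _) (HK _ cab).
Qed.

End CurveTools.

Section Clamp.
Variables (R : realType) (n : nat).
Implicit Types x : 'rV[R]_n.

(* The box is the unit ball of the sup norm, so that coordinatewise truncation
   is a 1-Lipschitz retraction onto it. *)
Definition clamp x0 (r : R) x : 'rV[R]_n :=
  \row_i Num.max (x0 0 i - r) (Num.min (x 0 i) (x0 0 i + r)).

Lemma clamp_box x0 r x : 0 <= r -> box x0 r (clamp x0 r x).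
Proof.
move=> r0; rewrite /box /= rV_norm_le//; apply/forallP => i.
rewrite !mxE ler_norml; apply/andP; split.
  by rewrite lerBrDl le_max lexx.
by rewrite lerBlDl ge_max ge_min lexx orbT andbT; lra.
Qed.

Lemma clamp_id x0 r x : box x0 r x -> clamp x0 r x = x.
Proof.
move=> xr; apply/rowP => i; rewrite mxE.
have := le_trans (rV_coord_le _ i) xr; rewrite rV_subE ler_norml => /andP[x1 x2].
by rewrite (min_l (_ : x 0 i <= _)) ?max_r//; lra.
Qed.

Lemma clamp_lipschitz x0 r x y : `|clamp x0 r x - clamp x0 r y| <= `|x - y|.
Proof.
rewrite rV_norm_le//; apply/forallP => i; apply: le_trans (rV_coord_le _ i).
rewrite rV_subE [in leRHS]rV_subE !mxE.
move: (x 0 i) (y 0 i) (x0 0 i - r) (x0 0 i + r) => a b l m.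
have h1 := ler_norm (a - b).
have : b - a <= `|a - b| by rewrite distrC ler_norm.
move: `|a - b| h1 => q h1 h2; rewrite ler_norml.
case: (leP a m) => ?; case: (leP b m) => ?;
  repeat match goal with |- context [Num.max ?x ?y] => case: (leP x y) => ? end; lra.
Qed.

End Clamp.

(** * Left-invariant vector fields in charts *)

Section LeftFields.
Variables (R : realType) (n : nat) (G : lieGroupType R n).
Implicit Types (c d : chart R n G) (g k : G).

Local Notation c0 := (chart_at (1%g : G)).
Local Notation v0 := (chart_coord c0 (1%g : G)).

Definition lfield c v (u : 'rV[R]_n) : 'rV[R]_n := ldiff c (chart_inv c u) v.

Lemma pair_continuous_l (V1 V2 : normedModType R) (b : V2) :
  continuous (fun a : V1 => (a, b)).
Proof.
move=> z B /nbhs_ballP[e /= e0 eB]; apply/nbhs_ballP; exists e => // z' zz'.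
by apply: eB; split => //=; exact: ballxx.
Qed.

Lemma chart_img_mul_dom c : chart_img c `<=` [set u | mul_dom c c0 c (u, v0)].
Proof.
move=> u cu; split => //=; first exact: v0_img.
by rewrite inv_v0 mulg1; exact: chart_inv_dom.
Qed.

Lemma mul_coord_smooth c c' d : atlas c -> atlas c' -> atlas d ->
  smooth_on (mul_dom c c' d) (@mul_coord _ _ G c c' d).
Proof. exact: mulg_smooth. Qed.

(** The left-invariant field is a partial derivative of the multiplication in its second variable at
    the identity; smoothness in [u] is then inherited from the multiplication. *)
Lemma lfieldE c v u : atlas c -> chart_img c u ->
  lfield c v u = 'D_((0 : 'rV[R]_n), v) (@mul_coord _ _ G c c0 c) (u, v0).
Proof.
move=> ac cu; have du := tmap_v0_differentiable ac (chart_inv_dom cu).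
apply: etrans (esym (deriveE v du)) _; rewrite /derive.
have -> : (fun h : R => h^-1 *: ((tmap (chart_inv c u) c0 c \o shift v0) (h *: v) -
    tmap (chart_inv c u) c0 c v0)) =
  (fun h : R => h^-1 *: ((@mul_coord _ _ G c c0 c \o shift (u, v0)) (h *: (0, v)) -
    mul_coord c c0 c (u, v0))); last by [].
apply/funext => h; rewrite /tmap /mul_coord /=.
by rewrite scaler0 add0r.
Qed.

Lemma lfield_smooth c v : atlas c -> smooth_on (chart_img c) (lfield c v).
Proof.
move=> ac k.
have C := Ck_derive ((0 : 'rV[R]_n), v)
  (mul_coord_smooth ac (atlas_chart_at (1%g : G)) ac k.+1).
have il (h : R) (w x : 'rV[R]_n) : (h *: w + x, v0) = h *: (w, 0) + (x, v0).
  by congr (_, _); rewrite /= scaler0 add0r.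
have Ci := Ck_affine il (@pair_continuous_l _ _ _) C.
apply: Ck_eq (Ck_subset (@chart_img_mul_dom c) Ci).
- exact: chart_img_open.
- by move=> u /set_mem cu; exact: (esym (lfieldE v ac cu)).
Qed.

Lemma ldiff_sum c g v : ldiff c g v = \sum_j v 0 j *: ldiff c g ('e_j : 'rV[R]_n).
Proof.
rewrite {1}(row_sum_coord v) /ldiff linear_sum; apply: eq_bigr => j _.
exact: linearZ.
Qed.

(** Both bounds are proportional to [|v|] with one constant, because the field is linear in [v] and
    so reduces to the finitely many components of the fields of the ['e_j]. *)
Lemma lfield_bounds c x0 r : atlas c -> box x0 r `<=` chart_img c ->
  exists2 L, 0 < L & forall u v, box x0 r u -> `|lfield c v u| <= L * `|v| /\
    forall u', box x0 r u' -> `|lfield c v u - lfield c v u'| <= L * `|u - u'| * `|v|.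
Proof.
move=> ac Bc; have oc : open (chart_img c) by exact: chart_img_open.
have CK j i m : Ck m (chart_img c) (fun u => lfield c ('e_j : 'rV[R]_n) u 0 i).
  by apply: Ck_coord => //; exact: lfield_smooth.
have /choice [K KP] (ji : 'I_n * 'I_n) : exists K, 0 < K /\ forall u, box x0 r u ->
    `|lfield c ('e_(ji.1) : 'rV[R]_n) u 0 ji.2| <= K.
  by have [K K0 KP] := box_bounded Bc (CK ji.1 ji.2 0%N); exists K.
have /choice [M MP] (ji : 'I_n * 'I_n) : exists M, 0 < M /\ forall u u', box x0 r u ->
    box x0 r u' -> `|lfield c ('e_(ji.1) : 'rV[R]_n) u 0 ji.2 -
                     lfield c ('e_(ji.1) : 'rV[R]_n) u' 0 ji.2| <= M * `|u - u'|.
  by have [M M0 MP] := box_lipschitz oc Bc (CK ji.1 ji.2 1%N); exists M.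
pose L := 1 + \sum_i \sum_j (K (j, i) + M (j, i)).
have KM0 j i : 0 <= K (j, i) + M (j, i).
  by rewrite addr_ge0// ltW// ?(KP (j, i)).1// (MP (j, i)).1.
have LP i : \sum_j (K (j, i) + M (j, i)) <= L.
  rewrite /L [X in 1 + X](bigD1 i)//= addrCA lerDl addr_ge0//.
  by apply: sumr_ge0 => i' _; apply: sumr_ge0.
have L0 : 0 < L.
  by rewrite ltr_pwDl//; apply: sumr_ge0 => i _; apply: sumr_ge0.
exists L => // u v Bu.
have main (a : 'I_n -> 'rV[R]_n) q : 0 <= q ->
    (forall j i, `|a j 0 i| <= (K (j, i) + M (j, i)) * q) ->
    `|\sum_j v 0 j *: a j| <= L * q * `|v|.
  move=> q0 aq; rewrite rV_norm_le; last by rewrite !mulr_ge0// ltW.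
  apply/forallP => i; rewrite summxE (le_trans (ler_norm_sum _ _ _))//.
  apply: (@le_trans _ _ (\sum_j (K (j, i) + M (j, i)) * q * `|v|)).
    by apply: ler_sum => j _; rewrite mxE normrM mulrC ler_pM//; exact: rV_coord_le.
  by rewrite -!mulr_suml !ler_wpM2r.
split.
  rewrite /lfield ldiff_sum -[L]mulr1; apply: main => // j i; rewrite mulr1.
  apply: le_trans ((KP (j, i)).2 _ Bu) _; rewrite lerDl; exact: ltW (MP (j, i)).1.
move=> u' Bu'.
have -> : lfield c v u - lfield c v u' =
    \sum_j v 0 j *: (lfield c ('e_j : 'rV[R]_n) u - lfield c ('e_j : 'rV[R]_n) u').
  rewrite /lfield ldiff_sum [X in _ - X]ldiff_sum -sumrB.
  by apply: eq_bigr => j _; rewrite scalerBr.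
apply: main => // j i; rewrite rV_subE.
apply: le_trans ((MP (j, i)).2 _ _ Bu Bu') _; rewrite ler_wpM2r// lerDr.
exact: ltW (KP (j, i)).1.
Qed.

Lemma lfield_v0 v : lfield c0 v v0 = v.
Proof.
have ac := atlas_chart_at (1%g : G).
have du := tmap_v0_differentiable ac (chart_inv_dom (v0_img G)).
apply: etrans (esym (deriveE v du)) _.
apply: etrans (derive_id v0 v); apply: near_eq_derive.
apply: filterS (chart_img_nbhs (v0_img G)) => z cz.
by rewrite /tmap inv_v0 mul1g chart_invK.
Qed.

(** The image is compact, hence closed in the Hausdorff group. A chart domain is only open; this is
    what keeps a curve from leaving it at a limit time. *)
Lemma chart_box_closed c x0 r : box x0 r `<=` chart_img c ->
  closed (chart_inv c @` box x0 r).
Proof.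
move=> Bc; apply: compact_closed; first exact: manifold_hausdorff.
apply: continuous_compact; last exact: closed_box_compact.
apply: continuous_in_subspaceT => x /set_mem /Bc; exact: chart_inv_cts.
Qed.

Lemma chart_box_exists c g : chart_dom c g -> exists2 r, 0 < r &
  box (chart_coord c g) r `<=` chart_img c.
Proof.
move=> cg; have /nbhs_ballP[r /= r0 rc] := chart_img_nbhs (chart_imgP cg).
have r20 : 0 < r / 2 by rewrite divr_gt0.
exists (r / 2) => // x xr; apply: rc; rewrite -ball_normE /= distrC.
by apply: le_lt_trans xr _; rewrite gtr_pMr// invf_lt1// ltr1n.
Qed.

End LeftFields.

(** * The exponential map *)

Section CurvesInCharts.
Variables (R : realType) (n : nat) (G : lieGroupType R n).
Implicit Types (c d : chart R n G) (g k : G).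

Lemma velocity_cvg (V : normedModType R) (D : set R) (u : R -> V) (t : R) v :
  velocity D u t v -> u s @[s --> within D (nbhs t)] --> u t.
Proof.
move=> uv; apply/cvgrPdist_le => e e0; rewrite near_withinE.
have k0 : 0 < 1 + `|v| by rewrite ltr_pwDl.
have ek : 0 < e / (1 + `|v|) by rewrite divr_gt0.
apply: filterS2 (velocity_bound uv) (near_dist_le t ek) => s h1 h2 Ds.
rewrite distrC (le_trans (h1 Ds))// mulrC -ler_pdivlMr// distrC; exact: h2.
Qed.

Lemma chart_curve_velocity c (y : R -> 'rV[R]_n) (D : set R) (t : R) v :
  atlas c -> chart_img c (y t) -> velocity D y t (lfield c v (y t)) ->
  has_velocity D (p := fun s => chart_inv c (y s)) (left_diff (chart_inv c (y t)) v).
Proof.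
move=> ac cy yv; have yc := velocity_cvg yv.
apply: (has_velocityP D v ac (chart_inv_dom cy)).2; split.
  exact: (cvg_comp _ _ yc (chart_inv_cts cy)).
have nD : \forall s \near t, D s -> chart_img c (y s) := yc _ (chart_img_nbhs cy).
apply: velocity_near yv; last by rewrite /= chart_invK.
by apply: filterS nD => s h Ds; rewrite /= chart_invK//; exact: h.
Qed.

Lemma velocity_shift (V : normedModType R) (D : set R) (u : R -> V) (t a : R) v :
  velocity D u (t - a) v ->
  velocity [set s | D (s - a)] (fun s => u (s - a)) t v.
Proof.
move=> H e e0; have /nbhs_ballP[d /= d0 Hd] := H _ e0.
apply/nbhs_ballP; exists d => // s; rewrite -ball_normE /= => ts Ds.
have sa : s - t = s - a - (t - a) by rewrite opprB addrA subrK.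
rewrite sa; apply: Hd => //.
by rewrite -ball_normE /= opprB addrA subrK.
Qed.

Lemma lmulg_continuous k : continuous (fun g : G => (k * g)%g).
Proof.
move=> g B kgB; have [[B1 B2] [/= B1k B2g] BB] := mulg_cts (k, g) B kgB.
rewrite /fmap /=; apply: filterS B2g => z Bz.
by apply: (BB (k, z)); split => //=; exact: nbhs_singleton.
Qed.

End CurvesInCharts.

Section ExpExistence.
Variables (R : realType) (n : nat) (G : lieGroupType R n).
Implicit Types (c d : chart R n G) (g k : G).

Local Notation c0 := (chart_at (1%g : G)).
Local Notation v0 := (chart_coord c0 (1%g : G)).

Definition intpow (h : G) (z : int) : G :=
  match z with Posz m => (h ^+ m)%g | Negz m => (h^-1 ^+ m.+1)%g end.

Lemma intpowS h z : intpow h (z + 1) = (intpow h z * h)%g.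
Proof.
case: z => [m|[|m]].
- by rewrite -PoszD addn1 /= expgSr.
- by rewrite (_ : Negz 0 + 1 = 0 :> int)//= expg1 mulVg.
- rewrite (_ : Negz m.+1 + 1 = Negz m); last by rewrite !NegzE -(addn1 m.+1) PoszD opprD subrK.
  by rewrite [intpow _ _]/= [in RHS]/intpow [in RHS]expgSr mulgVK.
Qed.

Section Extension.
Variables (v : 'rV[R]_n) (q : R -> G).
Hypothesis q0 : q 0 = 1%g.
Hypothesis qv : forall t : R, 0 <= t <= 1 ->
  has_velocity [set s | 0 <= s] (left_diff (q t) v).

Let h := q 1.
Let piece (j : int) (s : R) : G := (intpow h j * q (s - j%:~R))%g.
Let p (s : R) : G := piece (Num.floor s) s.

(** Consecutive pieces agree at the common integer, since [q] runs from the identity to [h] in unit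
    time. *)
Let p_piece (j : int) s : j%:~R <= s <= j%:~R + 1 -> p s = piece j s.
Proof.
move=> /andP[js sj]; have [sj'|sj'] := ltP s (j%:~R + 1).
  rewrite /p (_ : Num.floor s = j)//.
  by apply: Num.Theory.floor_def; rewrite js /= intrD.
have -> : s = (j + 1)%:~R by apply/eqP; rewrite eq_le intrD sj sj'.
rewrite /p intrKfloor /piece subrr q0 mulg1 intpowS intrD addrAC subrr add0r.
by [].
Qed.

Let piece_velocity (j : int) (t : R) : j%:~R <= t <= j%:~R + 1 ->
  piece j s @[s --> within [set s | j%:~R <= s] (nbhs t)] --> piece j t /\
  forall d g, g = piece j t -> atlas d -> chart_dom d g ->
    velocity [set s | j%:~R <= s] (chart_coord d \o piece j) t (ldiff d g v).
Proof.
move=> /andP[jt tj]; pose q' s := q (s - j%:~R).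
have t01 : 0 <= t - j%:~R <= 1 by rewrite subr_ge0 jt lerBlDl.
have [qc qvel] := (has_velocityP (p := q) (t := t - j%:~R) [set s | 0 <= s] v
  (atlas_chart_at (q (t - j%:~R))) (chart_at_dom (q (t - j%:~R)))).1 (qv t01).
have DE : [set s : R | [set s | 0 <= s] (s - j%:~R)] = [set s | j%:~R <= s].
  by apply/seteqP; split=> s /=; rewrite subr_ge0.
have qc' : q' s @[s --> within [set s | j%:~R <= s] (nbhs t)] --> q' t.
  move=> B HB; have : \forall s \near t - j%:~R, 0 <= s -> B (q s) := qc _ HB.
  move=> /nbhs_ballP[e /= e0 He]; apply/nbhs_ballP; exists e => // s.
  rewrite -ball_normE /= => ts js; apply: He; last by rewrite subr_ge0.
  by rewrite -ball_normE /= opprB addrA subrK.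
split.
  by apply: (cvg_comp q' (fun g => (intpow h j * g)%g) qc'); exact: lmulg_continuous.
move=> d g -> ad dg.
have qvel' : velocity [set s | j%:~R <= s] (chart_coord (chart_at (q' t)) \o q') t
    (ldiff (chart_at (q' t)) (q' t) v).
  by have := velocity_shift qvel; rewrite DE.
exact: (velocity_translate (atlas_chart_at _) ad (chart_at_dom _) dg qc' qvel').
Qed.

(** Left translates of an integral curve of a left-invariant field are integral curves, so a curve
    on the unit interval extends to all times by powers of its end point. *)
Lemma exp_extension : exists p : R -> G, [/\ p 0 = 1%g,
  integral_curve setT (fun g _ => left_diff g v) p & p 1 = q 1].
Proof.
exists p; split.
- have -> : p 0 = piece 0 0 by apply: p_piece; rewrite mulr0z lexx add0r ler01.
  by rewrite /piece mulr0z subr0 q0 mulg1 /= expg0.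
- move=> t _.
  (* At an integer [t] these are two different pieces, for the times after and before [t]; the
     one-sided velocities agree and are glued. Elsewhere the two indices coincide. *)
  pose k := Num.floor t; pose k' := Num.ceil t - 1.
  have /andP[k1 k2] := floor_itv t; rewrite -/k intrD in k1 k2.
  have /andP[c1 c2] := ceil_itv t.
  have k'1 : k'%:~R < t by rewrite /k'.
  have k'2 : t <= k'%:~R + 1 by rewrite /k' intrB subrK.
  have kt : k%:~R <= t <= k%:~R + 1 by rewrite k1 ltW.
  have k't : k'%:~R <= t <= k'%:~R + 1 by rewrite (ltW k'1).
  have [Ck Vk] := piece_velocity kt; have [Ck' Vk'] := piece_velocity k't.
  have Ek := p_piece kt; have Ek' := p_piece k't.
  have near1 : \forall s \near t, t <= s -> p s = piece k s.
    near=> s => ts; apply: p_piece; rewrite (le_trans k1 ts) ltW//.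
    by near: s; exact: lt_nbhsl.
  have near2 : \forall s \near t, s <= t -> p s = piece k' s.
    near=> s => ts; apply: p_piece; rewrite (le_trans ts k'2) andbT ltW//.
    by near: s; exact: lt_nbhsr.
  have kk : \forall s \near t, k'%:~R <= s.
    by near=> s; apply: ltW; near: s; exact: lt_nbhsr.
  have ad := atlas_chart_at (p t); have dt := chart_at_dom (p t).
  apply: (has_velocityP setT v ad dt).2; split.
    move=> B HB.
    have h1 : \forall s \near t, k%:~R <= s -> B (piece k s).
      by apply: Ck; rewrite -Ek.
    have h2 : \forall s \near t, k'%:~R <= s -> B (piece k' s).
      by apply: Ck'; rewrite -Ek'.
    have : \forall s \near t, setT s -> B (p s); last by [].
    near=> s => _; have [ts|st] := leP t s.
      rewrite (near near1 s)//; apply: (near h1 s) => //; exact: le_trans ts.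
    by rewrite (near near2 s) ?(ltW st)//; apply: (near h2 s) => //; near: s.
  have -> : [set: R] = [set s | t <= s] `|` [set s | s <= t].
    by apply/seteqP; split=> s //= _; apply/orP; exact: le_total.
  apply: velocityU.
    apply: velocity_near (velocity_subset _ (Vk _ _ Ek ad dt)).
    + by apply: filterS near1 => s H ts; rewrite /= H.
    + by rewrite /= Ek.
    + by move=> s /=; exact: le_trans.
  apply: velocity_near (velocity_subset_near _ (Vk' _ _ Ek' ad dt)).
  + by apply: filterS near2 => s H ts; rewrite /= H.
  + by rewrite /= Ek'.
  + by apply: filterS kk.
- have -> : p 1 = piece 0 1 by apply: p_piece; rewrite mulr0z add0r ler01 lexx.
  by rewrite /piece mulr0z subr0 /= expg0 mul1g.
Unshelve. all: by end_near. Qed.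

End Extension.

(** For [|v|] at most [r / 2 / L] the speed is at most [r / 2], so the solution of the clamped field
    stays in the box during unit time, where clamping changes nothing. *)
Lemma exp_curve_exists : exists2 r1, 0 < r1 & forall v : 'rV[R]_n, `|v| <= r1 ->
  exists p : R -> G, p 0 = 1%g /\ integral_curve setT (fun g _ => left_diff g v) p.
Proof.
have ac := atlas_chart_at (1%g : G).
have [r r0 Br] := chart_box_exists (chart_at_dom (1%g : G)).
have [L L0 HL] := lfield_bounds ac Br.
have r1 : 0 < r / 2 / L by rewrite !divr_gt0.
exists (r / 2 / L) => // v vr.
pose F (t : R) (x : 'rV[R]_n) := lfield c0 v (clamp v0 r x).
have cb x : box v0 r (clamp v0 r x) by apply: clamp_box; exact: ltW.
have vr' : L * `|v| <= r / 2 by rewrite mulrC -ler_pdivlMr.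
have r20 : 0 < r / 2 by rewrite divr_gt0.
have Flip t x y : `|F t x - F t y| <= (r / 2) * `|x - y|.
  have [_ /(_ _ (cb y)) H] := HL _ v (cb x); apply: le_trans H _.
  rewrite mulrAC; apply: ler_pM => //; last exact: clamp_lipschitz.
  by rewrite mulr_ge0// ltW.
have Fb t x : `|F t x| <= r / 2.
  by have [H _] := HL _ v (cb x); exact: le_trans H _.
have Fc x : continuous (F ^~ x) by move=> t; exact: cvg_cst.
have [y [y0 ylip yv]] := picard r20 r20 Flip Fb Fc v0.
have ybox t : 0 <= t <= 1 -> box v0 r (y t).
  move=> /andP[t0 t1]; rewrite /box /= -y0.
  apply: le_trans (ylip _ _ t0 (lexx 0)) _; rewrite subr0 ger0_norm//.
  apply: le_trans (_ : r / 2 <= r); last by rewrite ler_pdivrMr// ler_pMr// ler1n.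
  by rewrite ler_piMr// ltW.
pose q s := chart_inv c0 (y s).
have q0 : q 0 = 1%g by rewrite /q y0 inv_v0.
have qv t : 0 <= t <= 1 -> has_velocity [set s | 0 <= s] (p := q) (left_diff (q t) v).
  move=> t01; have t0 : 0 <= t by case/andP: t01.
  apply: chart_curve_velocity => //; first by apply: Br; exact: ybox.
  by have := yv t t0; rewrite /F clamp_id//; exact: ybox.
by have [p [p0 pv _]] := exp_extension q0 qv; exists p.
Qed.

End ExpExistence.

(** * Estimates valid for every exponential curve *)

Section ExpEstimates.
Variables (R : realType) (n : nat) (G : lieGroupType R n).
Implicit Types (c d : chart R n G) (g k : G).

Local Notation c0 := (chart_at (1%g : G)).
Local Notation v0 := (chart_coord c0 (1%g : G)).

Lemma lfield_coord c g v : chart_dom c g -> lfield c v (chart_coord c g) = ldiff c g v.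
Proof. by move=> cg; rewrite /lfield chart_coordK. Qed.

Lemma ldiffB c g v w : ldiff c g (v - w) = ldiff c g v - ldiff c g w.
Proof. exact: linearB. Qed.

Lemma halving_bound (a b x : R) : (forall m, x <= a / 2 ^+ m + b) -> 0 <= a -> x <= b.
Proof.
move=> H a0; apply/ler_addgt0Pr => e e0.
pose m := Num.bound (a / e); apply: le_trans (H m) _.
rewrite addrC lerD2l ler_pdivrMr ?exprn_gt0// mulrC -ler_pdivrMr//.
apply: le_trans (ltW (archi_boundP _)) _; first by rewrite divr_ge0// ltW.
by rewrite -natrX ler_nat -/m ltnW// ltn_expl.
Qed.

Variables (r L : R).
Hypotheses (r0 : 0 < r) (Br : box v0 r `<=` chart_img c0) (L0 : 0 < L).
Hypothesis HL : forall u v, box v0 r u -> `|lfield c0 v u| <= L * `|v| /\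
  forall u', box v0 r u' -> `|lfield c0 v u - lfield c0 v u'| <= L * `|u - u'| * `|v|.

(** Continuation with a margin: while the curve is within [r] of [v0], its speed keeps it within
    [r / 2], a closed condition that survives at the limit time and is strictly inside again. *)
Lemma exp_curve_in_chart (p : R -> G) v : L * `|v| <= r / 2 -> p 0 = 1%g ->
  integral_curve setT (fun g _ => left_diff g v) p ->
  forall t, 0 <= t <= 1 -> [/\ chart_dom c0 (p t),
    velocity [set s | 0 <= s] (chart_coord c0 \o p) t (lfield c0 v (chart_coord c0 (p t))) &
    `|chart_coord c0 (p t) - v0| <= L * `|v| * t].
Proof.
move=> vr p0 pv; pose y := chart_coord c0 \o p.
have ac := atlas_chart_at (1%g : G).
have r2 : r / 2 < r by rewrite gtr_pMr// invf_lt1// ltr1n.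
pose P t := chart_dom c0 (p t) /\ `|y t - v0| < r.
have vel t : chart_dom c0 (p t) ->
    velocity [set s | 0 <= s] y t (lfield c0 v (y t)).
  move=> pt; have [_ yv] := (has_velocityP setT v ac pt).1 (pv t I).
  apply: velocity_subset (eq_ind_r (velocity setT y t) yv (lfield_coord v pt)).
  by move=> s.
have bnd t : 0 <= t -> (forall s, 0 <= s <= t -> P s) -> `|y t - v0| <= L * `|v| * t.
  move=> t0 Pt; rewrite -[X in _ <= _ * X]subr0.
  have -> : v0 = y 0 by rewrite /y /= p0.
  apply: (velocity_lipschitz (du := fun s => lfield c0 v (y s))).
  - by rewrite lexx.
  - by move=> s st; apply: vel; exact: (Pt s st).1.
  - by move=> s st; have [H _] := HL v (ltW (Pt s st).2).
have PP : forall t, 0 <= t <= 1 -> P t.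
  apply: real_induction.
  - by split; rewrite /y /= p0 ?subrr ?normr0//; exact: chart_at_dom.
  - move=> t t0 [pt yt]; have [pc _] := (has_velocityP setT v ac pt).1 (pv t I).
    have N1 : \forall s \near t, setT s -> chart_dom c0 (p s) := pc _ (chart_dom_nbhs pt).
    have yc : y s @[s --> within setT (nbhs t)] --> y t.
      exact: (cvg_comp _ _ pc (chart_coord_cts pt)).
    have rb : nbhs (y t) (ball v0 r).
      by apply: open_nbhs_nbhs; split; [exact: ball_open|rewrite -ball_normE /= distrC].
    have N2 : \forall s \near t, setT s -> ball v0 r (y s) := yc _ rb.
    apply: filterS2 N1 N2 => s h1 h2 _; split; first exact: h1.
    by have := h2 I; rewrite -ball_normE /= distrC.
  - move=> T /andP[T0 T1] PT.
    have clo : closed (chart_inv c0 @` box v0 (r / 2)).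
      by apply: chart_box_closed => x xr; apply: Br; exact: le_trans xr (ltW r2).
    have pc : p s @[s --> within [set s | 0 <= s] (nbhs T)] --> p T.
      have [pc _] := (has_velocityP setT v (atlas_chart_at (p T)) (chart_at_dom (p T))).1 (pv T I).
      move=> B HB; have h : \forall s \near T, setT s -> B (p s) := pc _ HB.
      have : \forall s \near T, 0 <= s -> B (p s) by apply: filterS h => s Bs _; exact: Bs.
      by [].
    have [|u ur uE] := closed_left_limit clo T0 pc.
      move=> s /andP[s0 sT]; exists (y s); last first.
        by rewrite /y /= chart_coordK//; apply: (PT s _).1; rewrite s0.
      apply: le_trans (bnd s s0 _) _.
        by move=> s' /andP[h1 h2]; apply: PT; rewrite h1 (le_lt_trans h2).
      apply: le_trans vr; rewrite ler_piMr ?mulr_ge0 ?(ltW L0)//.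
      exact: le_trans (ltW sT) T1.
    have iu : chart_img c0 u by apply: Br; exact: le_trans ur (ltW r2).
    split; first by rewrite -uE; exact: chart_inv_dom.
    by rewrite /y /= -uE chart_invK//; exact: le_lt_trans ur r2.
move=> t /andP[t0 t1]; have Pt : 0 <= t <= 1 by rewrite t0.
split; [exact: (PP t Pt).1|by apply: vel; exact: (PP t Pt).1|].
by apply: bnd => // s /andP[s0 st]; apply: PP; rewrite s0 (le_trans st).
Qed.

(** Comparison with the straight line [s *: v]: the field equals [v] at [v0], and along the curve it
    deviates from [v] by at most L |y - v0| |v|, where |y - v0| <= L |v|. *)
Lemma exp_curve_second_order (p : R -> G) v : L * `|v| <= r / 2 -> p 0 = 1%g ->
  integral_curve setT (fun g _ => left_diff g v) p ->
  `|chart_coord c0 (p 1) - v0 - v| <= L * L * `|v| ^+ 2.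
Proof.
move=> vr p0 pv; have H := exp_curve_in_chart vr p0 pv.
pose y := chart_coord c0 \o p.
have b0 : box v0 r v0 by rewrite /box /= subrr normr0 ltW.
have by_ t : 0 <= t <= 1 -> box v0 r (y t).
  move=> t01; have [_ _ h] := H t t01; apply: le_trans h _.
  case/andP: t01 => t0 t1; apply: (@le_trans _ _ (L * `|v|)).
    by rewrite ler_piMr// mulr_ge0// ltW.
  by apply: le_trans vr _; rewrite ler_pdivrMr// ler_pMr// ler1n.
have z01 : 0 <= (0 : R) <= 1 by rewrite lexx ler01.
have := @velocity_lipschitz R n (fun s => y s - s *: v)
  (fun s => lfield c0 v (y s) - v) 0 1 (L * L * `|v| ^+ 2) z01.
rewrite subr0 mulr1 scale1r scale0r subr0.
have -> : y 0 = v0 by rewrite /y /= p0.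
have -> : y 1 - v - v0 = y 1 - v0 - v by rewrite addrAC.
apply.
- move=> t t01; apply: velocityB; first by have [_ h _] := H t t01.
  exact: velocity_linear.
- move=> t t01; rewrite -{2}(lfield_v0 G v).
  have [_ /(_ _ b0) h] := HL v (by_ _ t01); apply: le_trans h _.
  have [_ _ h'] := H t t01.
  rewrite expr2 !mulrA ler_wpM2r// -!mulrA ler_wpM2l ?(ltW L0)//.
  apply: le_trans h' _; rewrite ler_piMr ?mulr_ge0 ?(ltW L0)//.
  by case/andP: t01.
Qed.

(** A self-improving bound in place of Gronwall's inequality: as L |v| <= 1/2, feeding a bound on
    the distance into the velocities halves its first term. It later yields continuity in time of
    the extremum seeking field. *)
Lemma exp_curve_lipschitz (p q : R -> G) v w : L * `|v| <= r / 2 -> L * `|w| <= r / 2 ->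
  L * `|v| <= 1 / 2 -> p 0 = 1%g -> q 0 = 1%g ->
  integral_curve setT (fun g _ => left_diff g v) p ->
  integral_curve setT (fun g _ => left_diff g w) q ->
  `|chart_coord c0 (p 1) - chart_coord c0 (q 1)| <= 2 * L * `|v - w|.
Proof.
move=> vr wr v1 p0 q0 pv qw.
have H := exp_curve_in_chart vr p0 pv; have H' := exp_curve_in_chart wr q0 qw.
pose y := chart_coord c0 \o p; pose x := chart_coord c0 \o q.
have small (a t : R) : L * a <= r / 2 -> 0 <= t <= 1 -> 0 <= a -> L * a * t <= r / 2.
  move=> ar /andP[t0 t1] a0; apply: le_trans ar.
  by rewrite ler_piMr// mulr_ge0// ltW.
have r2 : r / 2 <= r by rewrite ler_pdivrMr// ler_pMr// ler1n.
have yb t : 0 <= t <= 1 -> box v0 r (y t).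
  by move=> t01; have [_ _ h] := H t t01; rewrite /box /= (le_trans h)// (le_trans (small _ _ _ t01 _)).
have xb t : 0 <= t <= 1 -> box v0 r (x t).
  by move=> t01; have [_ _ h] := H' t t01; rewrite /box /= (le_trans h)// (le_trans (small _ _ _ t01 _)).
suff main m t : 0 <= t <= 1 -> `|y t - x t| <= 2 * r / 2 ^+ m + 2 * L * `|v - w|.
  apply: (@halving_bound (2 * r)); last by rewrite mulr_ge0// ltW.
  by move=> m; apply: main; rewrite ler01 lexx.
have d0 : 0 <= 2 * L * `|v - w| by rewrite !mulr_ge0// ltW.
elim: m t => [|m IH] t t01.
  rewrite expr0 divr1 -(subrKA v0) (le_trans (ler_normD _ _))//.
  have := yb t t01; have := xb t t01; rewrite /box /= => h1 h2.
  by rewrite (distrC v0); lra.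
set B := 2 * r / 2 ^+ m.+1 + _.
have B0 : 0 <= B by rewrite addr_ge0// divr_ge0 ?exprn_ge0// mulr_ge0// ltW.
have z0t : 0 <= (0 : R) <= t by rewrite lexx; case/andP: t01.
have := @velocity_lipschitz R n (fun s => y s - x s)
  (fun s => lfield c0 v (y s) - lfield c0 w (x s)) 0 t B z0t.
have -> : y 0 - x 0 = 0 by rewrite /y /x /= p0 q0 subrr.
rewrite !subr0 => h; apply: le_trans (h _ _) _.
- move=> s /andP[s0 st].
  have s01 : 0 <= s <= 1 by rewrite s0 (le_trans st)//; case/andP: t01.
  by apply: velocityB; [have [] := H s s01|have [] := H' s s01].
- move=> s /andP[s0 st].
  have s01 : 0 <= s <= 1 by rewrite s0 (le_trans st)//; case/andP: t01.
  have -> : lfield c0 v (y s) - lfield c0 w (x s) =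
      (lfield c0 v (y s) - lfield c0 v (x s)) + lfield c0 (v - w) (x s).
    have -> : lfield c0 (v - w) (x s) = lfield c0 v (x s) - lfield c0 w (x s).
      exact: ldiffB.
    by rewrite subrKA.
  rewrite (le_trans (ler_normD _ _))//.
  have [_ /(_ _ (xb _ s01)) h1] := HL v (yb _ s01).
  have [h2 _] := HL (v - w) (xb _ s01).
  have h3 : L * `|y s - x s| * `|v| <= 1 / 2 * (2 * r / 2 ^+ m + 2 * L * `|v - w|).
    by rewrite mulrAC; apply: ler_pM => //; [rewrite mulr_ge0// ltW|exact: IH].
  have -> : B = 1 / 2 * (2 * r / 2 ^+ m + 2 * L * `|v - w|) + L * `|v - w|.
    by rewrite /B exprS; field; rewrite expf_neq0.
  by apply: lerD; [exact: le_trans h3|].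
- by rewrite ler_piMr//; case/andP: t01.
Qed.

End ExpEstimates.

Section LieExp.
Variables (R : realType) (n : nat) (G : lieGroupType R n).

Local Notation c0 := (chart_at (1%g : G)).
Local Notation v0 := (chart_coord c0 (1%g : G)).

(** For small [v] an integral curve exists, so [lie_exp] returns the end point of some such curve
    and not the default value; which curve it is does not matter to the estimates. *)
Lemma lie_exp_estimates : exists r1 C : R, [/\ 0 < r1, 0 < C,
  forall v : 'rV[R]_n, `|v| <= r1 ->
    [/\ chart_dom c0 (lie_exp (v : tangent (1%g : G))),
        `|chart_coord c0 (lie_exp (v : tangent (1%g : G))) - v0| <= C * `|v| &
        `|chart_coord c0 (lie_exp (v : tangent (1%g : G))) - v0 - v| <= C * `|v| ^+ 2] &
  forall v w : 'rV[R]_n, `|v| <= r1 -> `|w| <= r1 ->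
    `|chart_coord c0 (lie_exp (v : tangent (1%g : G))) -
      chart_coord c0 (lie_exp (w : tangent (1%g : G)))| <= C * `|v - w|].
Proof.
have [r r0 Br] := chart_box_exists (chart_at_dom (1%g : G)).
have [L L0 HL] := lfield_bounds (atlas_chart_at (1%g : G)) Br.
have [r1 r10 Hex] := exp_curve_exists G.
pose r2 := Num.min r1 (Num.min (r / 2 / L) (1 / 2 / L)).
have small (v : 'rV[R]_n) : `|v| <= r2 -> [/\ `|v| <= r1, L * `|v| <= r / 2 & L * `|v| <= 1 / 2].
  by rewrite !le_min => /and3P[? ? ?]; split=> //; rewrite mulrC -ler_pdivlMr.
have curve (v : 'rV[R]_n) : `|v| <= r2 -> exists p : R -> G, [/\ p 0 = 1%g,
    integral_curve setT (fun g _ => left_diff g v) p & p 1 = lie_exp (v : tangent (1%g : G))].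
  move=> /small [v1 _ _]; have [p [p0 pv]] := Hex _ v1.
  rewrite /lie_exp; case: xgetP => [_ -> [q [q0 qv q1]]|/(_ (p 1))]; first by exists q.
  by case; exists p.
(* The constant dominates L, L^2 and 2L, which come from the displacement, the second-order and the
   Lipschitz bound. *)
exists r2, (2 * L + L * L); split.
- by rewrite !lt_min r10 !divr_gt0.
- by rewrite addr_gt0 ?mulr_gt0.
- move=> v vr; have [p [p0 pv <-]] := curve _ vr; have [_ h1 h2] := small _ vr.
  have z11 : 0 <= (1 : R) <= 1 by rewrite ler01 lexx.
  have [d1 _ d2] := exp_curve_in_chart r0 Br L0 HL h1 p0 pv z11.
  split=> //.
    apply: le_trans d2 _; rewrite mulr1 ler_wpM2r//.
    have := mulr_ge0 (ltW L0) (ltW L0); lra.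
  apply: le_trans (exp_curve_second_order r0 Br L0 HL h1 p0 pv) _.
  by rewrite ler_wpM2r ?sqr_ge0// lerDr mulr_ge0// ltW.
- move=> v w vr wr; have [p [p0 pv <-]] := curve _ vr; have [q [q0 qv <-]] := curve _ wr.
  have [_ h1 h2] := small _ vr; have [_ h3 _] := small _ wr.
  apply: le_trans (exp_curve_lipschitz r0 Br L0 HL h1 h3 h2 p0 q0 pv qv) _.
  by rewrite ler_wpM2r// lerDl mulr_ge0// ltW.
Qed.

End LieExp.

(** * Oscillating primitives and averaging *)

Section ScalarVelocity.
Variables (R : realType).
Implicit Types (D : set R) (t : R) (f g : R -> R).

Lemma velocity_eq (V : normedModType R) D (u : R -> V) t v v' :
  v = v' -> velocity D u t v -> velocity D u t v'.
Proof. by move->. Qed.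

Lemma velocityD D f g t (f' g' : R) : velocity D f t f' -> velocity D g t g' ->
  velocity D (fun s => f s + g s) t (f' + g').
Proof.
move=> Hf Hg e e0; have e20 : 0 < e / 2 by rewrite divr_gt0.
apply: filterS2 (Hf _ e20) (Hg _ e20) => s h h' Ds.
have -> : f s + g s - (f t + g t) - (s - t) *: (f' + g') =
  (f s - f t - (s - t) *: f') + (g s - g t - (s - t) *: g').
  by rewrite /GRing.scale /=; ring.
rewrite (le_trans (ler_normD _ _))// (splitr e) mulrDl lerD//.
  exact: h.
exact: h'.
Qed.

Lemma velocityM D f g t (f' g' : R) : velocity D f t f' -> velocity D g t g' ->
  velocity D (fun s => f s * g s) t (f' * g t + f t * g').
Proof.
move=> Hf Hg e e0.
have gt1 : 0 < 1 + `|g t| by rewrite ltr_pwDl.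
have ft1 : 0 < 1 + `|f t| by rewrite ltr_pwDl.
pose k := (1 + `|f'|) * (1 + `|g'|).
have k0 : 0 < k by rewrite mulr_gt0// ltr_pwDl.
have e30 : 0 < e / 3 by rewrite divr_gt0.
have e1 : 0 < e / 3 / (1 + `|g t|) by rewrite divr_gt0.
have e2 : 0 < e / 3 / (1 + `|f t|) by rewrite divr_gt0.
have e3 : 0 < e / 3 / k by rewrite divr_gt0.
have H1 := @filterI _ (nbhs t) (nbhs_filter t) _ _ (Hf _ e1) (Hg _ e2).
have H2 := @filterI _ (nbhs t) (nbhs_filter t) _ _ (velocity_bound Hf) (velocity_bound Hg).
apply: filterS3 H1 H2 (near_dist_le t e3) => s [h1 h2] [h3 h4] h5 Ds.
have {}h1 := h1 Ds; have {}h2 := h2 Ds; have {}h3 := h3 Ds; have {}h4 := h4 Ds.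
have -> : f s * g s - f t * g t - (s - t) *: (f' * g t + f t * g') =
  (f s - f t - (s - t) *: f') * g t + f t * (g s - g t - (s - t) *: g') +
  (f s - f t) * (g s - g t).
  by rewrite /GRing.scale /=; ring.
have b1 : `|(f s - f t - (s - t) *: f') * g t| <= e / 3 * `|s - t|.
  rewrite normrM; apply: le_trans (ler_wpM2r (normr_ge0 _) h1) _.
  rewrite mulrAC ler_wpM2r// mulrAC ler_pdivrMr//.
  by apply: ler_wpM2l; [exact: ltW|rewrite lerDr].
have b2 : `|f t * (g s - g t - (s - t) *: g')| <= e / 3 * `|s - t|.
  rewrite normrM; apply: le_trans (ler_wpM2l (normr_ge0 _) h2) _.
  rewrite mulrA ler_wpM2r// mulrA ler_pdivrMr// mulrC.
  by apply: ler_wpM2l; [exact: ltW|rewrite lerDr].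
have b3 : `|(f s - f t) * (g s - g t)| <= e / 3 * `|s - t|.
  rewrite normrM; apply: le_trans (ler_pM (normr_ge0 _) (normr_ge0 _) h3 h4) _.
  rewrite mulrACA -/k mulrA ler_wpM2r// mulrC -ler_pdivlMr// distrC.
  exact: h5.
rewrite (le_trans (ler_normD _ _))//.
have := ler_normD ((f s - f t - (s - t) *: f') * g t) (f t * (g s - g t - (s - t) *: g')).
by lra.
Qed.

Lemma velocity_cst D (a t : R) : velocity D (fun=> a) t 0.
Proof.
move=> e e0; near=> s => _; rewrite subrr scaler0 subrr normr0.
by rewrite mulr_ge0// ltW.
Unshelve. all: by end_near. Qed.

Lemma velocityZ D f t (f' a : R) : velocity D f t f' -> velocity D (fun s => a * f s) t (a * f').
Proof.
by move=> H; apply: velocity_eq (velocityM (velocity_cst D a t) H); rewrite mul0r add0r.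
Qed.

Lemma velocity_sum (I : Type) (l : seq I) D (F : I -> R -> R) (F' : I -> R) t :
  (forall i, velocity D (F i) t (F' i)) ->
  velocity D (fun s => \sum_(i <- l) F i s) t (\sum_(i <- l) F' i).
Proof.
move=> H; elim: l => [|i l IH].
  rewrite big_nil (_ : (fun _ => _) = fun=> 0); first exact: velocity_cst.
  by apply/funext => s; rewrite big_nil.
rewrite big_cons (_ : (fun _ => _) = fun s => F i s + \sum_(i0 <- l) F i0 s).
  exact: velocityD.
by apply/funext => s; rewrite big_cons.
Qed.

Lemma is_derive_velocity D f t v : is_derive t 1 f v -> velocity D f t v.
Proof.
move=> [/derivable1_diffP df dv].
have E x : 'd f t x = x * v.
  by rewrite -dv -{1}[x]mulr1 -[x * 1]/(x *: (1 : R)) linearZ deriveE.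
move=> e e0; apply: filterS (differentiable_eps df e0) => s h _.
by move: h; rewrite E.
Qed.

(** At a first time with [w = c], a negative velocity would put [w] above [c] just before it. The
    sign is needed on the level [c] only. *)
Lemma scalar_barrier (w w' : R -> R) (b c : R) : w 0 < c ->
  (forall t, 0 <= t <= b -> velocity [set s | 0 <= s] w t (w' t)) ->
  (forall t, 0 <= t <= b -> w t = c -> w' t < 0) ->
  forall t, 0 <= t <= b -> w t < c.
Proof.
move=> w0 wv wc t0 t0b; pose P t := t <= b -> w t < c.
suff H : P t0 by apply: H; case/andP: t0b.
move: t0 t0b; apply: real_induction.
- by move=> _.
- move=> t t0 Pt; have [tb|bt] := leP t b; last first.
    near=> s => _ sb; have : b < s by near: s; exact: lt_nbhsr.
    by rewrite ltNge sb.
  have := wv t; rewrite t0 tb => /(_ isT)/velocity_cvg H.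
  have H' : \forall s \near t, 0 <= s -> w s < c by exact: (cvgr_lt _ H _ (Pt tb)).
  by apply: filterS H' => s h s0 _; exact: h.
- move=> T /andP[T0 Tb] HT _.
  have T0b : 0 <= T <= b by rewrite ltW.
  have wT := wv _ T0b.
  have wTc : w T <= c.
    apply: (closed_left_limit (p := w) (@closed_le R c) T0 (velocity_cvg wT)).
    by move=> s /andP[s0 sT]; apply: ltW; apply: HT; [rewrite s0|rewrite (le_trans (ltW sT))].
  rewrite lt_neqAle wTc andbT; apply/negP => /eqP wTE.
  have w'T := wc _ T0b wTE.
  have e0 : 0 < - w' T / 2 by rewrite divr_gt0// oppr_gt0.
  have /nbhs_ballP[d /= d0 Hd] := wT _ e0.
  pose s := Num.max 0 (T - d / 2).
  have sT : s < T by rewrite gt_max T0 ltrBlDr ltrDl divr_gt0.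
  have s0 : 0 <= s by rewrite le_max lexx.
  have bs : ball T d s.
    rewrite -ball_normE /= ger0_norm ?subr_ge0 ?ltW//.
    rewrite ltrBlDr -ltrBlDl lt_max; apply/orP; right.
    by rewrite ltrD2l ltrN2 gtr_pMr// invf_lt1// ltr1n.
  have := Hd _ bs s0; have sc : w s < c.
    by apply: HT; [rewrite s0 sT|rewrite (le_trans (ltW sT))].
  rewrite wTE [`|s - T|]ler0_norm ?subr_le0 ?(ltW sT)// ler_norml /GRing.scale /=.
  have : 0 < (T - s) * - w' T by rewrite mulr_gt0 ?subr_gt0 ?oppr_gt0.
  by move=> q /andP[h1 h2]; nra.
Unshelve. all: by end_near. Qed.

End ScalarVelocity.

Section Oscillations.
Variable R : realType.

Lemma is_derive_scaled (f df : R -> R) (w t : R) : is_derive (w * t) 1 f (df (w * t)) ->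
  is_derive t 1 (fun s : R => f (w * s)) (w * df (w * t)).
Proof.
move=> H; have D1 : is_derive t 1 (fun s : R => w * s) w.
  by rewrite -[X in is_derive _ _ _ X]mulr1; apply: is_deriveZ.
by have := is_derive1_comp H D1; rewrite mulrC.
Qed.

(** A primitive of cos(w t) for nonzero [w]. For [w = 0] the convention 0^-1 = 0 makes it the zero
    function, whence the case distinction in its derivative. *)
Definition sin_prim (w t : R) : R := sin (w * t) / w.

Lemma sin_primP D w t : velocity D (sin_prim w) t (if w == 0 then 0 else cos (w * t)).
Proof.
have [->|w0] := eqVneq w 0.
  rewrite (_ : sin_prim 0 = fun=> 0); first exact: velocity_cst.
  by apply/funext => s; rewrite /sin_prim invr0 mulr0.
have := velocityZ w^-1 (is_derive_velocity D (is_derive_scaled (is_derive_sin (w * t)))).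
rewrite mulKf// (_ : (fun s => w^-1 * _) = sin_prim w)//.
by apply/funext => s; rewrite mulrC.
Qed.

Lemma sin_prim_le w t : `|sin_prim w t| <= `|w|^-1.
Proof. by rewrite /sin_prim normrM normfV ler_piMl// sin_max. Qed.

Definition cos_prim (w t : R) : R := - (cos (w * t) / w).

Lemma cos_primP D w t : w != 0 -> velocity D (cos_prim w) t (sin (w * t)).
Proof.
move=> w0.
have := velocityZ (- w^-1) (is_derive_velocity D (is_derive_scaled
  (df := fun x => - sin x) (is_derive_cos (w * t)))).
rewrite mulrN mulrNN mulKf// (_ : (fun s => - w^-1 * _) = cos_prim w)//.
by apply/funext => s; rewrite mulNr mulrC.
Qed.

Lemma cos_prim_le w t : `|cos_prim w t| <= `|w|^-1.
Proof. by rewrite /cos_prim normrN normrM normfV ler_piMl// cos_max. Qed.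

(* At equal frequencies the first term is sin_prim 0 = 0 because 0^-1 = 0. *)
Definition sin2_prim (v w t : R) : R := (sin_prim (v - w) t - sin_prim (v + w) t) / 2.

(** From sin v sin w = (cos (v - w) - cos (v + w)) / 2; at equal frequencies the mean 1/2 has no
    bounded primitive and is subtracted. *)
Lemma sin2_primP D v w t : 0 < v -> 0 < w ->
  velocity D (sin2_prim v w) t (sin (v * t) * sin (w * t) - (v == w)%:R / 2).
Proof.
move=> v0 w0.
have H := velocityD (velocityZ (1 / 2) (sin_primP D (v - w) t))
  (velocityZ (- (1 / 2)) (sin_primP D (v + w) t)).
have -> : sin2_prim v w = fun s => 1 / 2 * sin_prim (v - w) s + - (1 / 2) * sin_prim (v + w) s.
  by apply/funext => s; rewrite /sin2_prim; field.
apply: velocity_eq H; rewrite [v + w == 0]gt_eqF ?addr_gt0// subr_eq0.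
case: eqVneq => [->|_]; last by rewrite mulrBl cosB mulrDl cosD mul0r; field.
rewrite mulrDl cosD.
by have := cos2Dsin2 (w * t); rewrite !expr2 => H'; rewrite mulr1n; lra.
Qed.

Lemma sin2_prim_le v w t : `|sin2_prim v w t| <= `|v - w|^-1 + `|v + w|^-1.
Proof.
rewrite /sin2_prim normrM normfV [`|2|]ger0_norm//.
have := ler_normB (sin_prim (v - w) t) (sin_prim (v + w) t).
have := sin_prim_le (v - w) t; have := sin_prim_le (v + w) t.
have : 0 <= `|v - w|^-1 by rewrite invr_ge0.
have : 0 <= `|v + w|^-1 by rewrite invr_ge0.
rewrite ler_pdivrMr//; lra.
Qed.

End Oscillations.

Section Averaging.
Variables (R : realType) (n : nat).
Variables (A : set 'rV[R]_n) (x0 : 'rV[R]_n) (r : R).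
Hypotheses (oA : open A) (BA : box x0 r `<=` A).

Lemma box_C1_bound (f : 'rV[R]_n -> R) : Ck 1 A f ->
  exists2 M, 0 < M & forall x, box x0 r x -> `|f x| <= M /\
    forall v, `|'d f x v| <= M * `|v|.
Proof.
move=> Cf; have [M M0 HM] := box_bounded BA (Ck_le (leqnSn 0) Cf).
have /choice [K KP] i : exists K, 0 < K /\ forall x, box x0 r x -> `|'D_('e_i) f x| <= K.
  by have [K K0 KP] := box_bounded BA (Ck_derive 'e_i Cf); exists K.
have S0 : 0 <= \sum_i K i by apply: sumr_ge0 => i _; exact: ltW (KP i).1.
exists (M + \sum_i K i); first by rewrite ltr_wpDr.
move=> x Bx; split; first by rewrite (le_trans (HM _ Bx))// lerDl.
move=> v; have [_ ->] := Ck1_differentiable oA Cf (BA Bx).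
rewrite (le_trans (ler_norm_sum _ _ _))// mulrDl ler_wpDl//.
  by rewrite mulr_ge0// ltW.
rewrite mulr_suml; apply: ler_sum => i _; rewrite normrM mulrC.
by apply: ler_pM => //; [exact: (KP i).2|exact: rV_coord_le].
Qed.

Variables (j : 'rV[R]_n -> R) (d : 'I_n -> 'rV[R]_n -> R) (wb : 'I_n -> R) (C : R).
Hypotheses (Cj : Ck 1 A j) (Cd : forall i, Ck 1 A (d i)).
Hypotheses (wb0 : forall i, 0 < wb i) (wb_inj : injective wb) (C0 : 0 < C).

(* The oscillating corrections cancel the terms of order a and the
   non-resonant terms of order a^2 in the derivative of j along the system. *)
Definition corrected (a om : R) (x : 'rV[R]_n) (t : R) : R :=
  j x + (a * \sum_i cos_prim (om * wb i) t * (j x * d i x) +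
    a ^+ 2 * \sum_i \sum_k sin2_prim (om * wb i) (om * wb k) t * (d i x * d k x)).

(** Size of the second-order primitives at [om = 1]; the differences with [i = k] contribute 0^-1 =
    0. *)
Let freq := \sum_i \sum_k (`|wb i - wb k|^-1 + `|wb i + wb k|^-1).
Let freq1 := \sum_i `|wb i|^-1.

Let freq_ge0 : 0 <= freq.
Proof.
by apply: sumr_ge0 => i _; apply: sumr_ge0 => k _; rewrite addr_ge0// invr_ge0.
Qed.

Let freq1_ge0 : 0 <= freq1.
Proof. by apply: sumr_ge0 => i _; rewrite invr_ge0. Qed.

Let cos_sum_le om t (f : 'I_n -> R) M : 0 < om -> 0 <= M -> (forall i, `|f i| <= M) ->
  `|\sum_i cos_prim (om * wb i) t * f i| <= freq1 * M / om.
Proof.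
move=> om0 M0 fM; rewrite (le_trans (ler_norm_sum _ _ _))//.
rewrite -mulrA mulr_suml; apply: ler_sum => i _; rewrite normrM mulrCA.
rewrite mulrC; apply: ler_pM => //.
apply: le_trans (cos_prim_le _ _) _.
by rewrite normrM invfM [`|om|]gtr0_norm// mulrC.
Qed.

Let sin2_sum_le om t (f : 'I_n -> 'I_n -> R) M : 0 < om -> 0 <= M ->
  (forall i k, `|f i k| <= M) ->
  `|\sum_i \sum_k sin2_prim (om * wb i) (om * wb k) t * f i k| <= freq * M / om.
Proof.
move=> om0 M0 fM; rewrite (le_trans (ler_norm_sum _ _ _))//.
rewrite -mulrA mulr_suml; apply: ler_sum => i _.
rewrite (le_trans (ler_norm_sum _ _ _))// mulr_suml; apply: ler_sum => k _.
rewrite normrM mulrCA mulrC; apply: ler_pM => //.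
apply: le_trans (sin2_prim_le _ _ _) _.
by rewrite -mulrBr -mulrDr !normrM !invfM [`|om|]gtr0_norm// -mulrDr mulrC.
Qed.

(** Stated for an abstract curve [u] and measured value [q], known only through the size of the
    velocity, the derivative of [j] along it and the expansion of [q]. [K] is independent of [a] and
    [om], which are chosen later. *)
Lemma averaging_drift : exists2 K, 0 < K & forall a om, 0 < a <= 1 -> 0 < om ->
  (forall x t, box x0 r x -> `|corrected a om x t - j x| <= K * a / om) /\
  forall (D : set R) (u : R -> 'rV[R]_n) (v : 'rV[R]_n) (q t : R), box x0 r (u t) ->
    velocity D u t v -> `|v| <= C * a ->
    'd j (u t) v = - \sum_i a * sin (om * wb i * t) * q * d i (u t) ->
    `|q - j (u t) - \sum_k a * sin (om * wb k * t) * d k (u t)| <= C * a ^+ 2 ->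
    exists w', velocity D (fun s => corrected a om (u s) s) t w' /\
      `|w' + a ^+ 2 / 2 * \sum_i d i (u t) ^+ 2| <= K * (a ^+ 3 + a ^+ 2 / om).
Proof.
have [Mj Mj0 HMj] := box_C1_bound Cj.
have /choice [Md HMd] i : exists M, 0 < M /\ forall x, box x0 r x -> `|d i x| <= M /\
    forall v, `|'d (d i) x v| <= M * `|v|.
  by have [M M0 HM] := box_C1_bound (Cd i); exists M.
pose M := Mj + \sum_i Md i.
have Md0 i : 0 <= Md i by exact: ltW (HMd i).1.
have SM0 : 0 <= \sum_i Md i by apply: sumr_ge0.
have M0 : 0 < M by rewrite ltr_wpDr.
have MjM : Mj <= M by rewrite lerDl.
have MdM i : Md i <= M.
  by rewrite /M (bigD1 i)//= addrCA lerDl addr_ge0 ?(ltW Mj0)// sumr_ge0.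
have jM x : box x0 r x -> `|j x| <= M by move=> /HMj [h _]; exact: le_trans MjM.
have jdM x v : box x0 r x -> `|'d j x v| <= M * `|v|.
  by move=> /HMj [_ h]; apply: le_trans (h v) _; rewrite ler_wpM2r.
have dM i x : box x0 r x -> `|d i x| <= M.
  by move=> Bx; have [h _] := (HMd i).2 _ Bx; exact: le_trans (MdM i).
have ddM i x v : box x0 r x -> `|'d (d i) x v| <= M * `|v|.
  by move=> Bx; have [_ h] := (HMd i).2 _ Bx; apply: le_trans (h v) _; rewrite ler_wpM2r.
(* [K1] bounds the correction itself. In [K2] the first term comes from the error of the measured
   value, the second from differentiating the corrections along a velocity of size C a. *)
pose K1 := (freq1 + freq) * M ^+ 2.
pose K2 := n%:R * C * M + (freq1 + freq) * (2 * M ^+ 2 * C).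
have K10 : 0 <= K1 by rewrite mulr_ge0 ?exprn_ge0 ?addr_ge0// ltW.
have MC0 : 0 <= 2 * M ^+ 2 * C by rewrite !mulr_ge0 ?exprn_ge0// ltW.
have K20 : 0 <= K2 by rewrite addr_ge0 ?mulr_ge0 ?addr_ge0// ltW.
exists (1 + K1 + K2); first by rewrite ltr_wpDr// ltr_wpDr.
move=> a om /andP[a0 a1] om0.
have aom : 0 < a / om by rewrite divr_gt0.
have a2a : a ^+ 2 <= a by rewrite expr2 ler_piMl// ltW.
have prodM y z : `|y| <= M -> `|z| <= M -> `|y * z| <= M ^+ 2.
  by move=> yM zM; rewrite normrM expr2 ler_pM.
split.
  move=> x t Bx; rewrite /corrected addrC addKr.
  have H1 := cos_sum_le t om0 (exprn_ge0 2 (ltW M0))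
    (fun i => prodM _ _ (jM _ Bx) (dM i _ Bx)).
  have H2 := sin2_sum_le t om0 (exprn_ge0 2 (ltW M0))
    (fun i k => prodM _ _ (dM i _ Bx) (dM k _ Bx)).
  rewrite (le_trans (ler_normD _ _))// (normrM a) (normrM (a ^+ 2)).
  rewrite (ger0_norm (ltW a0)) (ger0_norm (exprn_ge0 2 (ltW a0))).
  have h1 := ler_wpM2l (ltW a0) H1.
  have h2 : a ^+ 2 * `|\sum_i \sum_k sin2_prim (om * wb i) (om * wb k) t * (d i x * d k x)|
      <= a * (freq * M ^+ 2 / om) by apply: ler_pM => //; exact: exprn_ge0 (ltW a0).
  apply: le_trans (lerD h1 h2) _.
  have -> : a * (freq1 * M ^+ 2 / om) + a * (freq * M ^+ 2 / om) = K1 * (a / om).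
    by rewrite /K1; ring.
  by rewrite -mulrA ler_wpM2r ?(ltW aom)//; lra.
move=> D u v q t But uv vC jv qE.
have Aut := BA But.
have vj : velocity D (fun s => j (u s)) t ('d j (u t) v).
  exact: velocity_diff uv (Ck1_differentiable oA Cj Aut).1.
have vd i : velocity D (fun s => d i (u s)) t ('d (d i) (u t) v).
  exact: velocity_diff uv (Ck1_differentiable oA (Cd i) Aut).1.
pose sn i := sin (om * wb i * t).
pose fj i := 'd j (u t) v * d i (u t) + j (u t) * 'd (d i) (u t) v.
pose fd i k := 'd (d i) (u t) v * d k (u t) + d i (u t) * 'd (d k) (u t) v.
have omwb i : 0 < om * wb i by rewrite mulr_gt0.
have vc i : velocity D (fun s => cos_prim (om * wb i) s * (j (u s) * d i (u s))) t
    (sn i * (j (u t) * d i (u t)) + cos_prim (om * wb i) t * fj i).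
  have c0 : om * wb i != 0 by rewrite gt_eqF.
  exact: (velocityM (cos_primP D t c0) (velocityM vj (vd i))).
have vs i k : velocity D (fun s => sin2_prim (om * wb i) (om * wb k) s *
      (d i (u s) * d k (u s))) t
    ((sn i * sn k - (om * wb i == om * wb k)%:R / 2) * (d i (u t) * d k (u t)) +
      sin2_prim (om * wb i) (om * wb k) t * fd i k).
  exact: (velocityM (sin2_primP D t (omwb i) (omwb k)) (velocityM (vd i) (vd k))).
have vcs := velocity_sum (index_enum _) vc.
have vss := velocity_sum (index_enum _) (fun i => velocity_sum (index_enum _) (vs i)).
exists ('d j (u t) v + (a * (\sum_i (sn i * (j (u t) * d i (u t)) +
    cos_prim (om * wb i) t * fj i)) + a ^+ 2 * \sum_i \sum_k
    ((sn i * sn k - (om * wb i == om * wb k)%:R / 2) * (d i (u t) * d k (u t)) +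
      sin2_prim (om * wb i) (om * wb k) t * fd i k))); split.
  exact: (velocityD vj (velocityD (velocityZ a vcs) (velocityZ (a ^+ 2) vss))).
pose E0 := \sum_i sn i * d i (u t).
pose F1 := \sum_i cos_prim (om * wb i) t * fj i.
pose F2 := \sum_i \sum_k sin2_prim (om * wb i) (om * wb k) t * fd i k.
have S1 : \sum_i (sn i * (j (u t) * d i (u t)) + cos_prim (om * wb i) t * fj i) =
    j (u t) * E0 + F1.
  rewrite big_split /=; congr (_ + _); rewrite /E0 mulr_sumr.
  by apply: eq_bigr => i _; ring.
have S2 : \sum_i \sum_k
    ((sn i * sn k - (om * wb i == om * wb k)%:R / 2) * (d i (u t) * d k (u t)) +
      sin2_prim (om * wb i) (om * wb k) t * fd i k) =
    E0 * E0 - 1 / 2 * (\sum_i d i (u t) ^+ 2) + F2.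
  have E2 : E0 * E0 = \sum_i \sum_k (sn i * sn k * (d i (u t) * d k (u t))).
    rewrite {1}/E0 mulr_suml; apply: eq_bigr => i _.
    by rewrite /E0 mulr_sumr; apply: eq_bigr => k _; ring.
  (* Injectivity of [wb] leaves only the diagonal terms with a nonzero mean. *)
  have E3 : 1 / 2 * (\sum_i d i (u t) ^+ 2) = \sum_i \sum_k
      ((om * wb i == om * wb k)%:R / 2 * (d i (u t) * d k (u t))).
    rewrite mulr_sumr; apply: eq_bigr => i _.
    rewrite (bigD1 i)//= eqxx big1 ?addr0; first by rewrite expr2.
    move=> k ki; rewrite (inj_eq (mulfI (lt0r_neq0 om0))) (inj_eq wb_inj).
    by rewrite eq_sym (negbTE ki) !mul0r.
  rewrite E2 E3 /F2 -sumrB -big_split /=; apply: eq_bigr => i _.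
  rewrite -sumrB -big_split /=; apply: eq_bigr => k _; ring.
have S3 : 'd j (u t) v = - a * q * E0.
  rewrite jv /E0 mulNr mulNr mulr_sumr; congr (- _).
  by apply: eq_bigr => i _; rewrite /sn; ring.
have S4 : \sum_k a * sin (om * wb k * t) * d k (u t) = a * E0.
  by rewrite /E0 mulr_sumr; apply: eq_bigr => k _; rewrite /sn mulrA.
rewrite S4 in qE; rewrite S1 S2 S3.
(* The cancellation: the terms [a * j * E0] and [a ^+ 2 * E0 * E0] disappear. What is left is the
   error of [q], of order a^3, and the derivatives of the coefficients of the corrections, of order
   a^2/om. *)
have -> : - a * q * E0 + (a * (j (u t) * E0 + F1) +
    a ^+ 2 * (E0 * E0 - 1 / 2 * (\sum_i d i (u t) ^+ 2) + F2)) +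
    a ^+ 2 / 2 * \sum_i d i (u t) ^+ 2 =
  - a * (q - j (u t) - a * E0) * E0 + (a * F1 + a ^+ 2 * F2) by field.
have E0M : `|E0| <= n%:R * M.
  rewrite /E0 (le_trans (ler_norm_sum _ _ _))//.
  apply: le_trans (_ : \sum_(i < n) M <= _); last first.
    by rewrite sumr_const card_ord mulr_natl.
  apply: ler_sum => i _; rewrite normrM -[M]mul1r; apply: ler_pM => //.
    exact: sin_max.
  exact: dM.
have vM y : `|y| <= M * `|v| -> `|y| <= M * (C * a).
  by move=> /le_trans; apply; rewrite ler_wpM2l// ltW.
have fM y z y' z' : `|y| <= M -> `|z| <= M -> `|y'| <= M * (C * a) ->
    `|z'| <= M * (C * a) -> `|y' * z + y * z'| <= 2 * M ^+ 2 * C * a.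
  move=> h1 h2 h3 h4; rewrite (le_trans (ler_normD _ _))// !normrM.
  have g1 : `|y'| * `|z| <= M * (C * a) * M by apply: ler_pM.
  have g2 : `|y| * `|z'| <= M * (M * (C * a)) by apply: ler_pM.
  apply: le_trans (lerD g1 g2) _; rewrite le_eqVlt; apply/orP; left; apply/eqP; ring.
have MCa : 0 <= 2 * M ^+ 2 * C * a by rewrite mulr_ge0// ltW.
have F1M : `|F1| <= freq1 * (2 * M ^+ 2 * C * a) / om.
  apply: cos_sum_le => // i; rewrite /fj; apply: fM => //.
  - exact: jM.
  - exact: dM.
  - exact: vM (jdM _ _ But).
  - exact: vM (ddM _ _ _ But).
have F2M : `|F2| <= freq * (2 * M ^+ 2 * C * a) / om.
  apply: sin2_sum_le => // i k; rewrite /fd; apply: fM => //.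
  - exact: dM.
  - exact: dM.
  - exact: vM (ddM _ _ _ But).
  - exact: vM (ddM _ _ _ But).
have T1 : `|- a * (q - j (u t) - a * E0) * E0| <= a * (C * a ^+ 2) * (n%:R * M).
  rewrite normrM; apply: ler_pM => //; rewrite normrM normrN (ger0_norm (ltW a0)).
  by rewrite ler_wpM2l// ltW.
have T2 : `|a * F1| <= a * (freq1 * (2 * M ^+ 2 * C * a) / om).
  by rewrite normrM (ger0_norm (ltW a0)) ler_wpM2l// ltW.
have T3 : `|a ^+ 2 * F2| <= a * (freq * (2 * M ^+ 2 * C * a) / om).
  rewrite (normrM (a ^+ 2)) (ger0_norm (exprn_ge0 2 (ltW a0))).
  by apply: ler_pM => //; exact: exprn_ge0 (ltW a0).
rewrite (le_trans (ler_normD _ _))//.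
have T23 := le_trans (ler_normD (a * F1) (a ^+ 2 * F2)) (lerD T2 T3).
apply: le_trans (lerD T1 T23) _.
have a30 : 0 <= a ^+ 3 by rewrite exprn_ge0// ltW.
have a20 : 0 <= a ^+ 2 / om by rewrite divr_ge0 ?exprn_ge0// ltW.
have -> : a * (C * a ^+ 2) * (n%:R * M) + (a * (freq1 * (2 * M ^+ 2 * C * a) / om) +
    a * (freq * (2 * M ^+ 2 * C * a) / om)) =
  n%:R * C * M * a ^+ 3 + (freq1 + freq) * (2 * M ^+ 2 * C) * (a ^+ 2 / om) by ring.
have P1 : 0 <= n%:R * C * M by rewrite !mulr_ge0// ltW.
have P2 : 0 <= (freq1 + freq) * (2 * M ^+ 2 * C) by rewrite mulr_ge0// addr_ge0.
rewrite [leRHS]mulrDr; apply: lerD; apply: ler_wpM2r => //; rewrite /K2.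
  by rewrite addrCA lerDl addr_ge0// addr_ge0.
by rewrite addrA lerDr addr_ge0// addr_ge0.
Qed.

End Averaging.

(** * The extremum seeking field in a chart *)

Section RowPair.
Variables (R : realType) (n m : nat).
Implicit Types (x : 'rV[R]_n) (z : 'rV[R]_m).

Lemma row_mx_norm x z (e : R) : `|x| <= e -> `|z| <= e -> `|row_mx x z| <= e.
Proof.
move=> xe ze; rewrite rV_norm_le; last exact: le_trans xe.
apply/forallP => i; rewrite mxE; case: fintype.split => k.
  exact: le_trans (rV_coord_le _ _) xe.
exact: le_trans (rV_coord_le _ _) ze.
Qed.

Lemma lsubmx_norm (y : 'rV[R]_(n + m)) : `|lsubmx y| <= `|y|.
Proof. by rewrite rV_norm_le//; apply/forallP => i; rewrite mxE; exact: rV_coord_le. Qed.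

Lemma rsubmx_norm (y : 'rV[R]_(n + m)) : `|rsubmx y| <= `|y|.
Proof. by rewrite rV_norm_le//; apply/forallP => i; rewrite mxE; exact: rV_coord_le. Qed.

(** Functions of two row vectors are pulled back to one row space, where C^1 functions are known to
    be differentiable and Lipschitz on boxes. *)
Definition unpair (y : 'rV[R]_(n + m)) := (lsubmx y, rsubmx y).

Lemma unpair_continuous : continuous unpair.
Proof.
move=> y B /nbhs_ballP[e /= e0 eB]; apply/nbhs_ballP; exists e => // y'.
rewrite -ball_normE /= => yy'; apply: eB; split; rewrite /= -ball_normE /=.
  by apply: le_lt_trans yy'; rewrite -linearB; exact: lsubmx_norm.
by apply: le_lt_trans yy'; rewrite -linearB; exact: rsubmx_norm.
Qed.

Lemma unpair_row x z : unpair (row_mx x z) = (x, z).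
Proof. by rewrite /unpair row_mxKl row_mxKr. Qed.

Lemma unpair_affine (h : R) (v y : 'rV[R]_(n + m)) :
  unpair (h *: v + y) = h *: unpair v + unpair y.
Proof. by rewrite /unpair !linearD !linearZ. Qed.

End RowPair.

Section Potential.
Variables (R : realType) (n : nat) (G : lieGroupType R n).
Variables (J : G -> R) (J_smooth : smooth_fun J).
Variables (cs : chart R n G) (acs : atlas cs).

Local Notation c0 := (chart_at (1%g : G)).
Local Notation v0 := (chart_coord c0 (1%g : G)).

Let ac0 := atlas_chart_at (1%g : G).
Let ocs : open (chart_img cs) := @chart_img_open R n G cs.

Definition potential (x : 'rV[R]_n) : R := J (chart_inv cs x).

Definition translated_potential (x z : 'rV[R]_n) : R :=
  J (chart_inv cs x * chart_inv c0 z)%g.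

Lemma potential_smooth : smooth_on (chart_img cs) potential.
Proof. exact: J_smooth. Qed.

Lemma potential_differentiable x : chart_img cs x -> differentiable potential x.
Proof.
by move=> cx; have [] := Ck1_differentiable ocs (potential_smooth 1%N) cx.
Qed.

(** The derivative of J along the left-invariant field of [v], written with partial derivatives so
    that its smoothness in [x] can be read off. *)
Definition slope_along (v x : 'rV[R]_n) : R :=
  \sum_k 'D_('e_k) potential x * lfield cs v x 0 k.

Lemma slope_alongE v x : chart_img cs x ->
  'd potential x (lfield cs v x) = slope_along v x.
Proof.
move=> cx; have [_ ->] := Ck1_differentiable ocs (potential_smooth 1%N) cx.
by apply: eq_bigr => k _; rewrite mulrC.
Qed.

Lemma slope_along_smooth v : smooth_on (chart_img cs) (slope_along v).
Proof.
move=> k; apply: Ck_sum => // i.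
apply: CkM => //; first exact: Ck_derive (potential_smooth k.+1).
by apply: Ck_coord => //; exact: lfield_smooth.
Qed.

Let psi (y : 'rV[R]_(n + n)) : R := translated_potential (lsubmx y) (rsubmx y).
Let Omega := @unpair R n n @^-1` mul_dom cs c0 cs.

Let Omega_open : open Omega.
Proof.
by apply: open_comp => [y _|]; [exact: unpair_continuous|exact: mul_dom_open].
Qed.

Let psi_smooth : smooth_on Omega psi.
Proof.
move=> k.
have C1 : Ck k (mul_dom cs c0 cs) (potential \o mul_coord cs c0 cs).
  apply: (Ck_comp (B := chart_img cs)); last exact: potential_smooth.
  - exact: mul_dom_open.
  - exact: ocs.
  - by move=> u [_ _ cu]; exact: chart_imgP.
  - exact: mul_coord_smooth.
have C2 : Ck k (mul_dom cs c0 cs) (fun u => translated_potential u.1 u.2).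
  apply: Ck_eq C1; first exact: mul_dom_open.
  move=> u /set_mem [_ _ cu]; rewrite /= /potential /mul_coord chart_coordK//.
have := Ck_affine (@unpair_affine R n n) (@unpair_continuous R n n) C2.
exact.
Qed.

Let Omega_v0 x : chart_img cs x -> Omega (row_mx x v0).
Proof.
by move=> cx; rewrite /Omega /= unpair_row; exact: chart_img_mul_dom.
Qed.

(** Differentiating J(g h) in [h] at the identity gives the derivative of J at g along a
    left-invariant field: near [v0] the function of [h] is [potential] composed with the translation
    by g. *)
Let psi_derive x h : chart_img cs x ->
  'D_(row_mx 0 h) psi (row_mx x v0) = 'd potential x (lfield cs h x).
Proof.
move=> cx; pose g := chart_inv cs x.
have E1 : 'D_(row_mx 0 h) psi (row_mx x v0) = 'D_h (translated_potential x) v0.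
  rewrite /derive.
  have -> : (fun s : R => s^-1 *: ((psi \o shift (row_mx x v0)) (s *: row_mx 0 h) -
      psi (row_mx x v0))) =
    (fun s : R => s^-1 *: ((translated_potential x \o shift v0) (s *: h) -
      translated_potential x v0)); last by [].
  apply/funext => s /=; rewrite /psi scale_row_mx add_row_mx !row_mxKl !row_mxKr.
  by rewrite scaler0 add0r.
have dt : differentiable (tmap g c0 cs) v0.
  exact: (tmap_v0_differentiable acs (chart_inv_dom cx)).
have tE : tmap g c0 cs v0 = x by rewrite /tmap inv_v0 mulg1 chart_invK.
have dp : differentiable potential (tmap g c0 cs v0).
  by rewrite tE; exact: potential_differentiable.
have E2 : 'D_h (translated_potential x) v0 = 'D_h (potential \o tmap g c0 cs) v0.
  apply: near_eq_derive.
  have Om := open_nbhs_nbhs (conj Omega_open (Omega_v0 cx)).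
  have rc : (row_mx x z) @[z --> v0] --> row_mx x v0.
    apply: (eps_continuous (f := fun z => row_mx x z)) => e e0.
    apply: filterS (near_dist_le v0 e0) => z ze.
    by rewrite opp_row_mx add_row_mx subrr row_mx_norm// normr0 ltW.
  have : \forall z \near v0, Omega (row_mx x z) := rc _ Om.
  apply: filterS => z; rewrite /Omega /= unpair_row => -[_ _ /= cz].
  by rewrite /potential /tmap chart_coordK.
have /@derive_val E3 := is_derive_comp_diff (@diff_derivable _ _ _ _ _ h dt) dp.
apply: (etrans E1 (etrans E2 (etrans E3 _))).
have E4 w : tmap g c0 cs v0 = w ->
    'd potential (tmap g c0 cs v0) ('D_h (tmap g c0 cs) v0) =
    'd potential w ('d (tmap g c0 cs) v0 h).
  by move=> <-; exact: congr1 (deriveE h dt).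
exact: E4 tE.
Qed.

(** One box around [(us, v0)] serves both variables. The quadratic remainder, uniform in [x], comes
    from the Lipschitz constants of the partial derivatives of [psi] along a segment in the second
    variable. *)
Lemma translated_potential_estimates us : chart_img cs us ->
  exists r C : R, [/\ 0 < r, 0 < C & box us r `<=` chart_img cs] /\
   [/\ forall x h, box us r x -> `|h| <= r ->
      `|translated_potential x (v0 + h) - potential x -
        'd potential x (lfield cs h x)| <= C * `|h| ^+ 2,
    forall x z, box us r x -> box v0 r z -> `|translated_potential x z| <= C &
    forall x x' z z', box us r x -> box us r x' -> box v0 r z -> box v0 r z' ->
      `|translated_potential x z - translated_potential x' z'| <= C * (`|x - x'| + `|z - z'|)].
Proof.
move=> cus; pose y0 := row_mx us v0.
have /nbhs_ballP[e /= e0 eO] := open_nbhs_nbhs (conj Omega_open (Omega_v0 cus)).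
pose r := e / 2.
have r0 : 0 < r by rewrite divr_gt0.
have BO : box y0 r `<=` Omega.
  move=> y yr; apply: eO; rewrite -ball_normE /= distrC (le_lt_trans yr)//.
  by rewrite gtr_pMr// invf_lt1// ltr1n.
have rowB x z : box us r x -> box v0 r z -> box y0 r (row_mx x z).
  by move=> xr zr; rewrite /box /= /y0 opp_row_mx add_row_mx row_mx_norm.
have v0r : box v0 r v0 by rewrite /box /= subrr normr0 ltW.
have Bc : box us r `<=` chart_img cs.
  by move=> x xr; have := BO _ (rowB _ _ xr v0r); rewrite /Omega /= unpair_row => -[].
have psiE x z : psi (row_mx x z) = translated_potential x z.
  by rewrite /psi row_mxKl row_mxKr.
have tv0 x : translated_potential x v0 = potential x.
  by rewrite /translated_potential inv_v0 mulg1.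
have [C1 C10 HC1] := box_bounded BO (psi_smooth 0%N).
have [C2 C20 HC2] := box_lipschitz Omega_open BO (psi_smooth 1%N).
have /choice [C3 HC3] i : exists L, 0 < L /\ forall x y, box y0 r x -> box y0 r y ->
    `|'D_('e_i) psi x - 'D_('e_i) psi y| <= L * `|x - y|.
  have [L L0 HL] := box_lipschitz Omega_open BO (Ck_derive 'e_i (psi_smooth 2%N)).
  by exists L.
have S0 : 0 <= \sum_i C3 i by apply: sumr_ge0 => i _; exact: ltW (HC3 i).1.
exists r, (C1 + C2 + \sum_i C3 i); split.
  by split=> //; rewrite ltr_wpDr// addr_gt0.
split.
- move=> x h xr hr.
  have Bt t : 0 <= t <= 1 -> box y0 r (row_mx x v0 + t *: row_mx 0 h).
    move=> /andP[t0 t1]; rewrite scale_row_mx add_row_mx scaler0 addr0.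
    apply: rowB => //; rewrite /box /= addrC addKr normrZ ger0_norm//.
    by apply: le_trans hr; rewrite ler_piMl.
  have [t t01|t t01] := @MVT_line _ _ psi (row_mx x v0) (row_mx 0 h).
    by apply: Ck_derivable (psi_smooth 1%N) _; apply: BO; exact: Bt.
  rewrite add_row_mx addr0 !psiE tv0 => ->.
  rewrite -psi_derive; last exact: Bc.
  have z01 : 0 <= (0 : R) <= 1 by rewrite lexx ler01.
  have B0 : box y0 r (row_mx x v0) by exact: rowB.
  have [d1 E1] := Ck1_differentiable Omega_open (psi_smooth 1%N) (BO _ (Bt _ t01)).
  have [d2 E2] := Ck1_differentiable Omega_open (psi_smooth 1%N) (BO _ B0).
  have e1 := etrans (deriveE (row_mx 0 h) d1) (E1 (row_mx 0 h)).
  have e2 := etrans (deriveE (row_mx 0 h) d2) (E2 (row_mx 0 h)).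
  rewrite e1 e2 -sumrB.
  rewrite (le_trans (ler_norm_sum _ _ _))//.
  apply: (@le_trans _ _ (\sum_i C3 i * `|h| ^+ 2)); last first.
    by rewrite -mulr_suml ler_wpM2r ?sqr_ge0// lerDr addr_ge0// ltW.
  apply: ler_sum => i _; rewrite -mulrBr normrM.
  have hn : `|row_mx (0 : 'rV[R]_n) h| <= `|h| by rewrite row_mx_norm// normr0.
  have h1 := le_trans (rV_coord_le (row_mx 0 h) i) hn.
  have h2 := (HC3 i).2 _ _ (Bt _ t01) B0.
  have tE : row_mx x v0 + t *: row_mx 0 h - row_mx x v0 = t *: row_mx 0 h.
    by rewrite addrC addKr.
  rewrite tE normrZ in h2.
  rewrite expr2 mulrA mulrC; apply: ler_pM => //; apply: le_trans h2 _.
  apply: ler_wpM2l; first exact: ltW (HC3 i).1.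
  case/andP: t01 => t0 t1; rewrite ger0_norm//.
  by apply: le_trans (ler_piMl _ t1) hn.
- move=> x z xr zr; rewrite -psiE; apply: le_trans (HC1 _ (rowB _ _ xr zr)) _.
  by rewrite -addrA lerDl addr_ge0// ltW.
- move=> x x' z z' xr xr' zr zr'; rewrite -!psiE.
  apply: le_trans (HC2 _ _ (rowB _ _ xr zr) (rowB _ _ xr' zr')) _.
  apply: ler_pM => //; first exact: ltW.
    by rewrite addrAC lerDr addr_ge0// ltW.
  by rewrite opp_row_mx add_row_mx row_mx_norm// ?lerDl ?lerDr.
Qed.

(** The differential of left translation is onto: every [w] is the translate of its image under the
    differential of the translation by the inverse of g. Hence a left-translated basis of the Lie
    algebra detects all directions. *)
Lemma critical_of_basis (X : n.-tuple 'rV[R]_n) x : basis_of fullv X -> chart_img cs x ->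
  (forall i, slope_along (tnth X i) x = 0) -> forall w, 'd potential x w = 0.
Proof.
move=> bX cx X0 w; pose g := chart_inv cs x.
have gcs : chart_dom cs g by exact: chart_inv_dom.
have t1 : tmap g^-1%g cs c0 x = v0 by rewrite /tmap mulVg.
have d1 : differentiable (tmap g^-1%g cs c0) x.
  apply: (tmap_differentiable acs ac0 cx).
  by rewrite mulVg; exact: chart_at_dom.
have d2 : differentiable (tmap g c0 cs) v0 := tmap_v0_differentiable acs gcs.
have d2' : differentiable (tmap g c0 cs) (tmap g^-1%g cs c0 x) by rewrite t1.
have E : w = ldiff cs g ('d (tmap g^-1%g cs c0) x w).
  have dc := congr1 (fun F : 'rV[R]_n -> 'rV[R]_n => F w) (diff_comp d1 d2').
  have dcomp : differentiable (tmap g c0 cs \o tmap g^-1%g cs c0) x.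
    exact: differentiable_comp.
  have E' v : v = v0 -> 'D_w (tmap g c0 cs \o tmap g^-1%g cs c0) x =
      'd (tmap g c0 cs) v ('d (tmap g^-1%g cs c0) x w).
    by move=> ->; rewrite -[in RHS]t1; exact: etrans (deriveE w dcomp) dc.
  apply: etrans (E' _ erefl); apply: etrans (esym (derive_id x w)) _.
  apply: near_eq_derive.
  have pc : (g^-1 * chart_inv cs y)%g @[y --> x] --> (g^-1 * chart_inv cs x)%g.
    apply: (cvg_comp _ _ (chart_inv_cts cx)); exact: lmulg_continuous.
  have c1 : nbhs (g^-1 * chart_inv cs x)%g (chart_dom c0).
    by rewrite mulVg; apply: chart_dom_nbhs; exact: chart_at_dom.
  have N1 : \forall y \near x, chart_dom c0 (g^-1 * chart_inv cs y)%g := pc _ c1.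
  apply: filterS2 N1 (chart_img_nbhs cx) => y y1 y2.
  by rewrite /= /tmap chart_coordK// mulVKg chart_invK.
set v := 'd _ _ _ in E; rewrite E.
rewrite (coord_basis bX (memvf v)).
have lin (s : seq 'I_n) (b : 'I_n -> R) :
    'd potential x (ldiff cs g (\sum_(i <- s) b i *: X`_i)) = 0.
  elim: s => [|i s IH].
    rewrite big_nil; have -> : ldiff cs g 0 = 0 by exact: linear0.
    exact: linear0.
  rewrite big_cons.
  have -> : ldiff cs g (b i *: X`_i + \sum_(k <- s) b k *: X`_k) =
    b i *: ldiff cs g X`_i + ldiff cs g (\sum_(k <- s) b k *: X`_k).
    exact: linearP.
  have -> : forall a y z, 'd potential x (a *: y + z) =
      a * 'd potential x y + 'd potential x z by move=> a y z; exact: linearP.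
  rewrite IH addr0 -tnth_nth.
  have -> : 'd potential x (ldiff cs g (tnth X i)) = 0.
    exact: etrans (slope_alongE (tnth X i) cx) (X0 i).
  by rewrite mulr0.
exact: lin.
Qed.

End Potential.

Section ExtremumSeekingField.
Variables (R : realType) (n : nat) (G : lieGroupType R n).
Variables (X : n.-tuple (tangent (1%g : G))) (J : G -> R) (J_smooth : smooth_fun J).
Variables (cs : chart R n G) (acs : atlas cs) (wb : 'I_n -> R).

Local Notation c0 := (chart_at (1%g : G)).
Local Notation v0 := (chart_coord c0 (1%g : G)).

Definition combination (b : 'I_n -> R) : 'rV[R]_n := \sum_(i < n) b i *: (tnth X i : 'rV[R]_n).

Definition dither (a om t : R) : 'rV[R]_n :=
  combination (fun i => a * sin (om * wb i * t)).

Definition measured (a om : R) (x : 'rV[R]_n) (t : R) : R :=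
  translated_potential J cs x (chart_coord c0 (lie_exp (dither a om t : tangent (1%g : G)))).

(** By linearity the right-hand side at g is the left translate of this single vector of the Lie
    algebra, so at each time its velocity is a left-invariant one. *)
Definition es_vector (a om : R) (x : 'rV[R]_n) (t : R) : 'rV[R]_n :=
  - combination (fun i => a * sin (om * wb i * t) * measured a om x t).

Definition es_chart_field (a om : R) (x : 'rV[R]_n) (t : R) : 'rV[R]_n :=
  lfield cs (es_vector a om x t) x.

Let S := 1 + \sum_i `|tnth X i : 'rV[R]_n|.

Let S0 : 0 < S. Proof. by rewrite ltr_pwDl// sumr_ge0. Qed.

Lemma combination_le b M : 0 <= M -> (forall i, `|b i| <= M) -> `|combination b| <= M * S.
Proof.
move=> M0 bM; rewrite (le_trans (ler_norm_sum _ _ _))//.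
rewrite mulrDr mulr1 ler_wpDl// mulr_sumr; apply: ler_sum => i _.
by rewrite normrZ ler_wpM2r.
Qed.

Lemma combinationB b b' : combination b - combination b' = combination (fun i => b i - b' i).
Proof. by rewrite /combination -sumrB; apply: eq_bigr => i _; rewrite scalerBl. Qed.

Lemma combination_continuous (b : 'I_n -> R -> R) : (forall i, continuous (b i)) ->
  continuous (fun t => combination (b ^~ t)).
Proof.
move=> cb t; apply: (eps_continuous (f := fun t => combination (b ^~ t))) => e e0.
have eS : 0 < e / S by rewrite divr_gt0.
have : \forall s \near t, forall i, `|b i t - b i s| <= e / S.
  apply: (@filter_forall _ 'I_n (fun i s => `|b i t - b i s| <= e / S) (nbhs t) _) => i.
  exact: (continuous_dist_le (cb i t) eS).
apply: filterS => s hs; rewrite combinationB.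
have -> : e = e / S * S by rewrite divfK// gt_eqF.
by apply: combination_le => //; exact: ltW.
Qed.

Lemma linear_combination (V : lmodType R) (f : {linear 'rV[R]_n -> V}) b :
  f (combination b) = \sum_(i < n) b i *: f (tnth X i).
Proof.
rewrite /combination linear_sum; apply: eq_bigr => i _; exact: linearZ.
Qed.

Lemma es_field_vector a om g t : chart_dom cs g ->
  chart_dom c0 (lie_exp (dither a om t : tangent (1%g : G))) ->
  es_field X J (fun=> a) (fun i => om * wb i) g t =
  left_diff g (es_vector a om (chart_coord cs g) t : tangent (1%g : G)).
Proof.
move=> gcs ec0.
pose f : {linear 'rV[R]_n -> 'rV[R]_n} :=
  'd (tmap g c0 (chart_at g)) v0.
have mE : measured a om (chart_coord cs g) t =
    J (g * lie_exp (dither a om t : tangent (1%g : G)))%g.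
  by rewrite /measured /translated_potential !chart_coordK.
have E : f (es_vector a om (chart_coord cs g) t) =
    - \sum_(i < n) (a * sin (om * wb i * t) * measured a om (chart_coord cs g) t) *: f (tnth X i).
  rewrite /es_vector (linearN f); congr (- _); exact: linear_combination.
apply: etrans (esym E); rewrite /es_field mE; reflexivity.
Qed.

Lemma slope_combination b x : chart_img cs x ->
  'd (potential J cs) x (lfield cs (combination b) x) =
  \sum_(i < n) b i * slope_along J cs (tnth X i) x.
Proof.
move=> cx; pose f : {linear 'rV[R]_n -> 'rV[R]_n} := 'd (tmap (chart_inv cs x) c0 cs) v0.
have E := linear_combination f b.
have E2 : 'd (potential J cs) x (\sum_(i < n) b i *: f (tnth X i)) =
    \sum_(i < n) b i * 'd (potential J cs) x (f (tnth X i)).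
  by rewrite linear_sum; apply: eq_bigr => i _; exact: linearZ.
apply: etrans (congr1 ('d (potential J cs) x) E) (etrans E2 _).
apply: eq_bigr => i _; congr (_ * _).
exact: (slope_alongE J_smooth acs (tnth X i) cx).
Qed.

(** Gathers what averaging and Picard's theorem require of the field. The constants are chosen
    before [a] and [om] and hold for all frequencies. *)
Lemma es_chart_estimates us : chart_img cs us ->
  exists r K a1 : R, [/\ 0 < r, 0 < K, 0 < a1 & box us r `<=` chart_img cs] /\
  forall a om, 0 < a <= a1 ->
  [/\ forall g t, chart_dom cs g ->
        es_field X J (fun=> a) (fun i => om * wb i) g t =
        left_diff g (es_vector a om (chart_coord cs g) t : tangent (1%g : G)),
      forall x t, box us r x -> [/\ `|es_chart_field a om x t| <= K * a,
        'd (potential J cs) x (es_chart_field a om x t) =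
          - \sum_i a * sin (om * wb i * t) * measured a om x t *
              slope_along J cs (tnth X i) x &
        `|measured a om x t - potential J cs x -
          \sum_k a * sin (om * wb k * t) * slope_along J cs (tnth X k) x| <= K * a ^+ 2],
      forall x x' t, box us r x -> box us r x' ->
        `|es_chart_field a om x t - es_chart_field a om x' t| <= K * `|x - x'| &
      forall x, box us r x -> continuous (es_chart_field a om x)].
Proof.
move=> cus.
have [r [C [[r0 C0 Bc] [Tay bndP lipP]]]] := translated_potential_estimates J_smooth acs cus.
have [r1 [C1 [r10 C10 He Helip]]] := lie_exp_estimates G.
have [L L0 HL] := lfield_bounds acs Bc.
have [M M0 HM] := box_C1_bound (@chart_img_open _ _ _ cs) Bc (potential_smooth J_smooth acs 1%N).
(* [r1 / S] keeps the dither where the exponential is controlled, [r / (C1 * S)] keeps its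
   exponential in the box around [v0], and 1 allows the factor [a] to be dropped in the Lipschitz
   bound. [K1], [K2] and [K3] bound the speed, the measurement error and the Lipschitz constant. *)
pose a1 := Num.min 1 (Num.min (r1 / S) (r / (C1 * S))).
pose K1 := L * (C * S).
pose K2 := C * (C1 * S) ^+ 2 + M * (L * (C1 * S ^+ 2)).
pose K3 := L * (C * S) + L * (C * S).
have K10 : 0 < K1 by rewrite !mulr_gt0.
have K20 : 0 < K2 by rewrite addr_gt0 ?mulr_gt0 ?exprn_gt0// mulr_gt0.
have K30 : 0 < K3 by rewrite addr_gt0.
have a10 : 0 < a1 by rewrite !lt_min ltr01 !divr_gt0// mulr_gt0.
exists r, (K1 + K2 + K3), a1; split; first by split=> //; rewrite addr_gt0// addr_gt0.
move=> a om /andP[a0]; rewrite !le_min => /and3P[a1' ar1 ar].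
have sn i t : `|a * sin (om * wb i * t)| <= a.
  by rewrite normrM (gtr0_norm a0) ler_piMr ?sin_max// ltW.
have dS t : `|dither a om t| <= a * S by apply: combination_le => //; exact: ltW.
have dr1 t : `|dither a om t| <= r1.
  by apply: le_trans (dS t) _; rewrite -ler_pdivlMr.
pose e t := chart_coord c0 (lie_exp (dither a om t : tangent (1%g : G))).
have eS t : `|e t - v0| <= C1 * (a * S).
  have [_ h _] := He _ (dr1 t); apply: le_trans h _.
  by rewrite ler_wpM2l// ltW.
have er t : `|e t - v0| <= r.
  by apply: le_trans (eS t) _; rewrite mulrCA -ler_pdivlMr// mulr_gt0.
have mC x t : box us r x -> `|measured a om x t| <= C.
  by move=> Bx; apply: bndP => //; exact: er.
have vS x t : box us r x -> `|es_vector a om x t| <= a * C * S.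
  move=> Bx; rewrite /es_vector normrN; apply: combination_le.
    by rewrite mulr_ge0// ltW.
  by move=> i; rewrite normrM; apply: ler_pM => //; exact: mC.
split.
- move=> g t gcs; apply: es_field_vector => //.
  by have [] := He _ (dr1 t).
- move=> x t Bx; have cx := Bc _ Bx; split.
  + have [h _] := HL x (es_vector a om x t) Bx; apply: le_trans h _.
    apply: le_trans (ler_wpM2l (ltW L0) (vS x t Bx)) _.
    have -> : L * (a * C * S) = K1 * a by rewrite /K1; ring.
    by rewrite ler_wpM2r ?(ltW a0)// -addrA lerDl addr_ge0// ltW.
  + have EN : es_chart_field a om x t =
        - lfield cs (combination (fun i => a * sin (om * wb i * t) * measured a om x t)) x.
      exact: linearN.
    rewrite EN; apply: etrans (linearN ('d (potential J cs) x) _) _.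
    by congr (- _); exact: slope_combination.
  (* Two errors of order a^2 meet here: the Taylor remainder in [h], and the replacement of [h] by
     the dither through the second-order estimate of the exponential. *)
  + pose h := e t - v0.
    have T1 := Tay x h Bx (er t).
    have mE : translated_potential J cs x (v0 + h) = measured a om x t.
      by rewrite /h addrC subrK.
    have [_ _ h2] := He _ (dr1 t).
    have ld : 'd (potential J cs) x (lfield cs h x) =
        'd (potential J cs) x (lfield cs (dither a om t) x) +
        'd (potential J cs) x (lfield cs (h - dither a om t) x).
      have q1 : lfield cs (h - dither a om t) x = lfield cs h x - lfield cs (dither a om t) x.
        exact: linearB.
      have q2 : 'd (potential J cs) x (lfield cs h x - lfield cs (dither a om t) x) =
        'd (potential J cs) x (lfield cs h x) - 'd (potential J cs) x (lfield cs (dither a om t) x).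
        exact: linearB.
      by rewrite q1 q2 addrC subrK.
    have T2 : `|'d (potential J cs) x (lfield cs (h - dither a om t) x)| <=
        M * (L * (C1 * S ^+ 2)) * a ^+ 2.
      have [_ q1] := HM _ Bx; apply: le_trans (q1 _) _.
      rewrite -mulrA; apply: ler_wpM2l; first exact: ltW.
      have [q2 _] := HL x (h - dither a om t) Bx; apply: le_trans q2 _.
      rewrite -mulrA; apply: ler_wpM2l; first exact: ltW.
      apply: le_trans h2 _; rewrite -mulrA; apply: ler_wpM2l; first exact: ltW.
      rewrite -exprMn mulrC lerXn2r ?nnegrE ?mulr_ge0 ?(ltW a0) ?(ltW S0)//.
    have T3 : C * `|h| ^+ 2 <= C * (C1 * S) ^+ 2 * a ^+ 2.
      rewrite -mulrA -exprMn; apply: ler_wpM2l; first exact: ltW.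
      rewrite lerXn2r ?nnegrE ?mulr_ge0 ?(ltW C10) ?(ltW S0) ?(ltW a0)//.
      by apply: le_trans (eS t) _; rewrite mulrA mulrAC.
    have sc := slope_combination (fun i => a * sin (om * wb i * t)) cx.
    rewrite -/(dither a om t) in sc.
    rewrite mE ld sc in T1.
    have {}T1 := le_trans T1 T3.
    have -> : (K1 + K2 + K3) * a ^+ 2 = (C * (C1 * S) ^+ 2 * a ^+ 2 +
        M * (L * (C1 * S ^+ 2)) * a ^+ 2) + (K1 + K3) * a ^+ 2 by rewrite /K2; ring.
    apply: (@le_trans _ _ (C * (C1 * S) ^+ 2 * a ^+ 2 + M * (L * (C1 * S ^+ 2)) * a ^+ 2)).
      apply: le_trans (lerD T1 T2); apply: le_trans (ler_normD _ _).
      by rewrite opprD !addrA subrK.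
    by rewrite lerDl mulr_ge0 ?sqr_ge0// addr_ge0// ltW.
- move=> x x' t Bx Bx'.
  have -> : es_chart_field a om x t - es_chart_field a om x' t =
      (lfield cs (es_vector a om x t) x - lfield cs (es_vector a om x t) x') +
      lfield cs (es_vector a om x t - es_vector a om x' t) x'.
    have -> : lfield cs (es_vector a om x t - es_vector a om x' t) x' =
      lfield cs (es_vector a om x t) x' - lfield cs (es_vector a om x' t) x'.
      exact: linearB.
    by rewrite subrKA.
  rewrite (le_trans (ler_normD _ _))//.
  have [_ /(_ _ Bx') h1] := HL x (es_vector a om x t) Bx.
  have [h2 _] := HL x' (es_vector a om x t - es_vector a om x' t) Bx'.
  have h3 : `|es_vector a om x t - es_vector a om x' t| <= a * (C * `|x - x'|) * S.
    rewrite /es_vector -opprD normrN combinationB; apply: combination_le.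
      by rewrite !mulr_ge0// ltW.
    move=> i; rewrite -mulrBr normrM; apply: ler_pM => //.
    apply: le_trans (lipP _ _ _ _ Bx Bx' (er t) (er t)) _.
    by rewrite subrr normr0 addr0.
  have xx0 : 0 <= `|x - x'| by [].
  have b1 : L * `|x - x'| * `|es_vector a om x t| <= L * (C * S) * `|x - x'|.
    rewrite mulrAC; apply: ler_wpM2r => //; apply: ler_wpM2l; first exact: ltW.
    apply: le_trans (vS x t Bx) _; rewrite -mulrA ler_piMl//.
    by rewrite mulr_ge0// ltW.
  have b2 : L * `|es_vector a om x t - es_vector a om x' t| <= L * (C * S) * `|x - x'|.
    rewrite -mulrA; apply: ler_wpM2l; first exact: ltW.
    apply: le_trans h3 _; rewrite -!mulrA; apply: le_trans (ler_piMl _ a1') _.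
      by rewrite !mulr_ge0// ltW.
    by rewrite [S * _]mulrC.
  have := lerD (le_trans h1 b1) (le_trans h2 b2); rewrite -mulrDl -/K3 => h4.
  apply: le_trans h4 _; apply: ler_wpM2r => //.
  by rewrite lerDr addr_ge0// ltW.
- move=> x Bx.
  have scont i : continuous (fun t : R => a * sin (om * wb i * t)).
    move=> t; apply: cvgMl_tmp.
    apply: (@continuous_comp R R R (fun t => om * wb i * t) sin); last exact: continuous_sin.
    exact: mulrl_continuous.
  have dcont : continuous (dither a om) by exact: combination_continuous.
  have mcont : continuous (measured a om x).
    move=> t; apply: eps_continuous => eps eps0.
    have k0 : 0 < C * C1 by rewrite mulr_gt0.
    have ek : 0 < eps / (C * C1) by rewrite divr_gt0.
    apply: filterS (continuous_dist_le (dcont t) ek) => s hs.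
    apply: le_trans (lipP _ _ _ _ Bx Bx (er t) (er s)) _.
    rewrite subrr normr0 add0r.
    apply: le_trans (ler_wpM2l (ltW C0) (Helip _ _ (dr1 t) (dr1 s))) _.
    by rewrite mulrA mulrC -ler_pdivlMr.
  have vcont : continuous (es_vector a om x).
    move=> t; apply: cvgN.
    apply: (@combination_continuous (fun i t => a * sin (om * wb i * t) * measured a om x t)).
    by move=> i s; apply: cvgM; [exact: scont|exact: mcont].
  move=> t; apply: eps_continuous => eps eps0.
  have ek : 0 < eps / L by rewrite divr_gt0.
  apply: filterS (continuous_dist_le (vcont t) ek) => s hs.
  have -> : es_chart_field a om x t - es_chart_field a om x s =
      lfield cs (es_vector a om x t - es_vector a om x s) x.
    exact: esym (linearB _ _ _).
  have [h _] := HL x (es_vector a om x t - es_vector a om x s) Bx.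
  by apply: le_trans h _; rewrite mulrC -ler_pdivlMr.
Qed.

End ExtremumSeekingField.

(** * Trapping below a regular level *)

Section RegularBand.
Variable R : realType.

(** Otherwise the interval from 0 to [m], of positive measure, would consist of critical values. *)
Lemma regular_value_exists n (A : set 'rV[R]_n) (f : 'rV[R]_n -> R) (m : R) :
  open A -> smooth_on A f -> 0 < m ->
  exists2 c, 0 < c < m & forall x, critical A f x -> f x != c.
Proof.
move=> oA Cf m0; apply: contrapT => H.
have sub : `]0, m[%classic `<=` f @` critical A f.
  move=> c /=; rewrite in_itv /= => c0m; apply: contrapT => nc; apply: H.
  by exists c => // x Cx; apply/eqP => fx; apply: nc; exists x.
have N : (@lebesgue_measure R).-negligible (`]0, m[%classic : set R).
  by apply: negligibleS (sard oA Cf).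
have mI : measurable (`]0, m[%classic : set R) := measurable_itv _.
have := @measure_negligible _ _ R (@lebesgue_measure R) _ mI N.
move=> Z; have := etrans (esym (lebesgue_measure_itv (R:=R) `]0, m[)) Z.
rewrite /= lte_fin m0 => /eqP; rewrite eqe subr0.
by rewrite gt_eqF.
Qed.

Lemma compact_pos_lower_bound n (K : set 'rV[R]_n) (f : 'rV[R]_n -> R) :
  compact K -> (forall x, K x -> {for x, continuous f}) -> (forall x, K x -> 0 < f x) ->
  exists2 m, 0 < m & forall x, K x -> m <= f x.
Proof.
(* The empty set has to be allowed: for [n = 0] the sphere to which this is applied is empty. *)
move=> cK cf f0; have [[x Kx]|K0] := pselect (K !=set0); last first.
  by exists 1 => // x Kx; exfalso; apply: K0; exists x.
have cw : {within K, continuous f}.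
  by apply: continuous_in_subspaceT => y /set_mem; exact: cf.
have [y Ky ymin] := compact_EVT_min (ex_intro _ x Kx) cK cw.
exists (f y); first by apply: f0; rewrite inE in Ky.
by move=> z Kz; apply: ymin; rewrite inE.
Qed.

(** The barrier is put on the corrected [w]. Where [w = c], [f] is within [k / 2] of [c], so [q] is
    at least [k] and the drift [l * k] beats the error [e]. Passing between [f] and [w] costs
    [k / 2] at the start and at the end. *)
Lemma drift_barrier (w w' f q : R -> R) (b c e k l : R) : 0 <= l -> e < l * k ->
  (forall t, 0 <= t <= b -> velocity [set s | 0 <= s] w t (w' t)) ->
  (forall t, 0 <= t <= b -> `|w' t + l * q t| <= e) ->
  (forall t, 0 <= t <= b -> `|w t - f t| <= k / 2) ->
  (forall t, 0 <= t <= b -> `|f t - c| <= k -> k <= q t) ->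
  f 0 < c - k / 2 -> forall t, 0 <= t <= b -> f t < c + k / 2.
Proof.
move=> l0 elk wv w'q wf fq f0 t tb.
have b0 : 0 <= (0 : R) <= b by rewrite lexx; case/andP: tb => t0; exact: le_trans.
suff : w t < c by have := wf t tb; rewrite ler_norml; lra.
apply: (scalar_barrier (w' := w') (b := b)) => //.
  by have := wf 0 b0; rewrite ler_norml; lra.
move=> s sb wsc; have := wf s sb; rewrite wsc => fsc.
have k0 : 0 <= k by have := le_trans (normr_ge0 _) fsc; lra.
have fs : `|f s - c| <= k by rewrite distrC; apply: le_trans fsc _; lra.
have : l * k <= l * q s by rewrite ler_wpM2l//; exact: fq.
by have := w'q s sb; rewrite ler_norml; lra.
Qed.

Lemma small_parameters (K k a1 om1 : R) : 0 < K -> 0 < k -> 0 < a1 -> 0 < om1 ->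
  exists a om, [/\ 0 < a < a1, om1 < om, K * a / om <= k / 2 &
    K * (a ^+ 3 + a ^+ 2 / om) < a ^+ 2 / 2 * k].
Proof.
(* The factor 8 gives 2Ka <= k/4, strictly below the required k/2. In [om], the term 1/a makes
   a^2/om at most a^3, and 2Ka/k makes the correction at most k/2. *)
move=> K0 k0 a10 om10; pose a := Num.min (a1 / 2) (k / (8 * K)).
have a0 : 0 < a by rewrite lt_min !divr_gt0// mulr_gt0.
have ak : 8 * K * a <= k by rewrite mulrC -ler_pdivlMr ?mulr_gt0// /a ge_min lexx orbT.
pose om := om1 + a^-1 + 2 * K * a / k.
have ai0 : 0 < a^-1 by rewrite invr_gt0.
have Ka0 : 0 < 2 * K * a / k by rewrite divr_gt0// !mulr_gt0.
have om0 : 0 < om by rewrite !addr_gt0.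
exists a, om; split.
- rewrite a0; apply: (@le_lt_trans _ _ (a1 / 2)); first by rewrite /a ge_min lexx.
  by rewrite gtr_pMr// invf_lt1// ltr1n.
- by rewrite /om; lra.
- have omk : 2 * K * a / k <= om by rewrite /om; lra.
  by rewrite ler_pdivrMr//; rewrite ler_pdivrMr// in omk; lra.
- have h : a ^+ 2 / om <= a ^+ 3.
    rewrite ler_pdivrMr// (exprSr a 2) -mulrA ler_peMr ?sqr_ge0//.
    by rewrite mulrC -ler_pdivrMr// div1r /om; lra.
  have a2 : 0 < a ^+ 2 by rewrite exprn_gt0.
  have h2 : K * (a ^+ 3 + a ^+ 2 / om) <= K * (a ^+ 3 + a ^+ 3).
    by rewrite ler_wpM2l ?(ltW K0)// lerD2l.
  apply: le_lt_trans h2 _.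
  have -> : K * (a ^+ 3 + a ^+ 3) = a ^+ 2 * (2 * K * a) by ring.
  have -> : a ^+ 2 / 2 * k = a ^+ 2 * (k / 2) by field.
  rewrite ltr_pM2l//; have : 0 < K * a by rewrite mulr_gt0.
  by lra.
Qed.

End RegularBand.

(** * Trapping of all solutions near the minimum *)

Theorem theorem4p2 (R : realType) (n : nat) (G : lieGroupType R n)
  (compactG : compact [set: G]) (connectedG : connected [set: G])
  (X : n.-tuple (tangent (1%g : G))) (basisX : basis_of fullv X)
  (J : G -> R) (J_ge0 : forall g, 0 <= J g) (J_smooth : smooth_fun J)
  (gs : G) (J_posdef : locally_posdef J gs) (gs_min : unique_local_min J gs)
  (wb : 'I_n -> rat) (wb_gt0 : forall i, 0 < wb i)
  (wb_neq : forall i j, i != j -> wb i != wb j)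
  (wb_neq2 : forall i j, i != j -> 2 * wb i != wb j)
  (wb_neqD : forall i j k, i != j -> i != k -> j != k -> wb i != wb j + wb k)
  (U : set G) (nbhsU : nbhs gs U)
  (a_max : R) (a_max_gt0 : 0 < a_max)
  (omega_min : R) (omega_min_gt0 : 0 < omega_min) :
  exists (a : 'I_n -> R) (omega : R) (Uh : set G),
    [/\ forall i, 0 < a i < a_max, omega_min < omega, nbhs gs Uh &
      forall g0, Uh g0 ->
        let sol := es_solution X J a (fun i => omega * ratr (wb i)) g0 in
        (exists p, sol p) /\
        (forall p, sol p ->
           exists2 T0, 0 <= T0 & forall t, T0 <= t -> U (p t))].
Proof.
pose cs := chart_at gs; pose us := chart_coord cs gs.
have acs : atlas cs := atlas_chart_at gs.
have gcs : chart_dom cs gs := chart_at_dom gs.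
have cus : chart_img cs us by exact: chart_imgP.
have ocs : open (chart_img cs) := @chart_img_open R n G cs.
pose wr (i : 'I_n) : R := ratr (wb i).
have wr0 i : 0 < wr i by rewrite /wr ltr0q.
have wr_inj : injective wr.
  move=> i k /fmorph_inj E; apply: contrapT => /eqP ik.
  by have := wb_neq _ _ ik; rewrite E eqxx.
pose j := potential J cs; pose d i := slope_along J cs (tnth X i).
have Cj := potential_smooth J_smooth acs; have Cd i := slope_along_smooth J_smooth acs (tnth X i).
have [r1 [K [a1 [[r10 K0 a10 Bc1] Hes]]]] := es_chart_estimates X J_smooth acs wr cus.
have [J0 Jpos] := J_posdef.
have usK : chart_inv cs us = gs by exact: chart_coordK.
have invc : chart_inv cs x @[x --> us] --> gs by rewrite -usK; exact: (chart_inv_cts cus).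
have [r [r0 rr1 rU rpos]] : exists r, [/\ 0 < r, r <= r1,
    forall x, box us r x -> U (chart_inv cs x) &
    forall x, box us r x -> x != us -> 0 < j x].
  have N1 : \forall x \near us, U (chart_inv cs x) := invc _ nbhsU.
  have N2 : \forall x \near us, chart_inv cs x != gs -> 0 < J (chart_inv cs x) := invc _ Jpos.
  have [e /= e0 He] := (nbhs_ballP _ _).1 (filterI (filterI N1 N2) (chart_img_nbhs cus)).
  exists (Num.min r1 (e / 2)).
  have Hb x : box us (Num.min r1 (e / 2)) x -> ball us e x.
    move=> xr; rewrite -ball_normE /= distrC; apply: le_lt_trans xr _.
    rewrite gt_min; apply/orP; right.
    by rewrite gtr_pMr// invf_lt1// ltr1n.
  split.
  - by rewrite lt_min r10 divr_gt0.
  - by rewrite ge_min lexx.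
  - by move=> x /Hb /He [[]].
  - move=> x /Hb /He [[_ h] cx] xu; apply: h; apply/eqP => xg.
    by move/eqP: xu; apply; rewrite -(chart_invK cx) xg.
have Bsub : box us r `<=` box us r1 by move=> x xr; exact: le_trans rr1.
have Bc : box us r `<=` chart_img cs by move=> x /Bsub /Bc1.
have jc x : chart_img cs x -> {for x, continuous j}.
  by move=> cx; exact: Ck_continuous (Cj 0%N) cx.
have dc i x : chart_img cs x -> {for x, continuous (d i)}.
  by move=> cx; exact: Ck_continuous (Cd i 0%N) cx.
have jus : j us = 0 by rewrite /j /potential usK.
have [m m0 Hm] : exists2 m, 0 < m & forall x, `|x - us| = r -> m <= j x.
  have sphereB x : `|x - us| = r -> box us r x by move=> xr; rewrite /box /= xr.
  have cS : compact [set x : 'rV[R]_n | `|x - us| = r].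
    apply: (@subclosed_compact _ _ (box us r)) => //; last exact: closed_box_compact.
    apply: (@preimage_closed _ _ (fun x : 'rV[R]_n => `|x - us|) [set r]) => [x _|].
      exact: (cvg_norm (cvgB cvg_id (cvg_cst us))).
    exact: closed_eq.
  apply: (compact_pos_lower_bound cS) => x xr.
    by apply: jc; apply: Bc; exact: sphereB.
  apply: rpos; first exact: sphereB.
  by apply/eqP => xu; move: r0; rewrite -xr xu subrr normr0 ltxx.
have [c /andP[c0 cm] Hc] := regular_value_exists ocs Cj m0.
(* The sum can vanish only at a point of level [c] where all derivatives [d i] vanish; by the basis
   property that is a critical point, which the regular value [c] excludes. *)
have [k0 k00 Hk0] : exists2 k0, 0 < k0 &
    forall x, box us r x -> k0 <= `|j x - c| + \sum_i d i x ^+ 2.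
  apply: compact_pos_lower_bound.
  - exact: closed_box_compact.
  - move=> x Bx; have cx := Bc _ Bx.
    suff C0 : Ck 0 (chart_img cs) (fun x => `|j x - c| + \sum_i d i x ^+ 2).
      exact: Ck_continuous C0 cx.
    apply: CkD => //; last first.
      apply: Ck_sum => // i.
      have -> : (fun x => d i x ^+ 2) = (fun x => d i x * d i x) by apply/funext => z; rewrite expr2.
      exact: CkM ocs (Cd i 0%N) (Cd i 0%N).
    by split=> // y cy; exact: (cvg_norm (cvgB (jc _ cy) (cvg_cst c))).
  - move=> x Bx; have cx := Bc _ Bx.
    have sq0 i : 0 <= d i x ^+ 2 by exact: sqr_ge0.
    have s0 : 0 <= \sum_i d i x ^+ 2 by apply: sumr_ge0.
    rewrite lt0r addr_ge0// andbT; apply/negP => /eqP E.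
    have /eqP jxc : `|j x - c| == 0 by rewrite eq_le normr_ge0 andbT; lra.
    have /eqP sx0 : \sum_i d i x ^+ 2 == 0 by rewrite eq_le s0 andbT; move: (normr_ge0 (j x - c)); lra.
    have dx0 i : d i x = 0.
      apply/eqP; rewrite -sqrf_eq0; apply/eqP.
      by apply: (psumr_eq0P _ sx0).
    move/eqP: jxc; rewrite normr_eq0 subr_eq0; apply/negP; apply: Hc.
    split=> // i; apply: etrans (deriveE _ (potential_differentiable J_smooth acs cx)) _.
    exact: (critical_of_basis J_smooth acs basisX cx dx0).
(* [k0 / 2] turns the bound on the sum into one on the squares alone in the band of half-width [ka];
   [c] keeps the minimum below the band, and [m - c] keeps the boundary of the box above it. *)
pose ka := Num.min (k0 / 2) (Num.min c (m - c)).
have ka0 : 0 < ka by rewrite !lt_min divr_gt0//= c0 subr_gt0.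
have kah : ka / 2 < ka by rewrite gtr_pMr// invf_lt1// ltr1n.
have kac : ka <= c by rewrite /ka !ge_min lexx orbT.
have kam : c + ka <= m by rewrite -lerBrDl /ka !ge_min lexx !orbT.
have Hka x : box us r x -> `|j x - c| <= ka -> ka <= \sum_i d i x ^+ 2.
  move=> Bx jx; have := Hk0 _ Bx; have : ka <= k0 / 2 by rewrite /ka ge_min lexx.
  by move=> h1 h2; lra.
have [Kd Kd0 Hdrift] := averaging_drift ocs Bc (Cj 1%N) (fun i => Cd i 1%N) wr0 wr_inj K0.
have a2_gt0 : 0 < Num.min (Num.min 1 a1) a_max by rewrite !lt_min ltr01 a10.
have [a [om [/andP[a0]]]] := small_parameters Kd0 ka0 a2_gt0 omega_min_gt0.
rewrite !lt_min => /andP[/andP[alt1 alta1] amax] omin small1 small2.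
have aa1 : 0 < a <= a1 by rewrite a0 ltW.
have al1 : 0 < a <= 1 by rewrite a0 ltW.
have om0 : 0 < om := lt_trans omega_min_gt0 omin.
have [Wj Wdrift] := Hdrift a om al1 om0.
have [Hfield Hbound Hlip Hcont] := Hes a om aa1.
pose fld := es_chart_field X J cs wr a om.
have trap (u : R -> 'rV[R]_n) b : (forall t, 0 <= t <= b -> box us r (u t) /\
      velocity [set s | 0 <= s] u t (fld (u t) t)) -> j (u 0) < c - ka / 2 ->
    forall t, 0 <= t <= b -> j (u t) < c + ka / 2.
  move=> Hu u0 t tb; pose w s := corrected j d wr a om (u s) s.
  have /choice [w' Hw'] s : exists w', 0 <= s <= b -> velocity [set s | 0 <= s] w s w' /\
      `|w' + a ^+ 2 / 2 * \sum_i d i (u s) ^+ 2| <= Kd * (a ^+ 3 + a ^+ 2 / om).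
    (* Outside the time interval the value 0 is junk. *)
    have [sb|nsb] := pselect (0 <= s <= b); last by exists 0.
    have [Bs vs] := Hu s sb; have [f1 f2 f3] := Hbound _ s (Bsub _ Bs).
    have [w' Hw'] := Wdrift _ u _ _ s Bs vs f1 f2 f3; by exists w'.
  have l0 : 0 <= a ^+ 2 / 2 by rewrite divr_ge0// sqr_ge0.
  apply: (drift_barrier (w := w) (w' := w') (f := j \o u) (b := b) l0 small2) => // s sb.
  - exact: (Hw' s sb).1.
  - exact: (Hw' s sb).2.
  - by apply: le_trans small1; apply: Wj; exact: (Hu s sb).1.
  - exact: Hka (Hu s sb).1.
(* On the boundary of the box [j] is at least [m], above the level; so a bound on [j] turns [<= r]
   into [< r]. *)
have inner x : box us r x -> j x <= c + ka / 2 -> `|x - us| < r.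
  move=> Bx jx; rewrite lt_neqAle; apply/andP; split=> //.
  apply/negP => /eqP xr; have := le_trans (Hm _ xr) jx.
  by rewrite leNgt => /negP; apply; apply: lt_le_trans kam; rewrite ltrD2l.
pose Uh : set G := [set g | chart_dom cs g /\ (`|chart_coord cs g - us| < r /\
  j (chart_coord cs g) < c - ka / 2)].
exists (fun=> a), om, Uh; split=> //.
- by move=> i; rewrite a0.
- have cc := chart_coord_cts gcs.
  have N1 : \forall g \near gs, `|chart_coord cs g - us| < r.
    have rb : nbhs us (ball us r) by exact: nbhsx_ballx.
    have N : \forall g \near gs, ball us r (chart_coord cs g) := cc _ rb.
    by apply: filterS N => g; rewrite /= -ball_normE /= distrC.
  have N2 : \forall g \near gs, j (chart_coord cs g) < c - ka / 2.
    have h : \forall x \near us, j x < c - ka / 2.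
      have us0 : j us < c - ka / 2 by rewrite jus subr_gt0 (lt_le_trans kah).
      exact: (cvgr_lt _ (jc _ cus) _ us0).
    exact: cc _ h.
  by apply: filterS3 (chart_dom_nbhs gcs) N1 N2 => g g1 g2 g3.
move=> g0 [g0cs [g0r g0j]] sol; split.
  have cb x : box us r (clamp us r x) by apply: clamp_box; exact: ltW.
  (* The clamped field is globally bounded and Lipschitz; its solution solves the original equation
     while it stays in the box. *)
  pose F t x := fld (clamp us r x) t.
  have Flip t x y : `|F t x - F t y| <= K * `|x - y|.
    apply: le_trans (Hlip _ _ t (Bsub _ (cb x)) (Bsub _ (cb y))) _.
    by rewrite ler_wpM2l ?(ltW K0)//; exact: clamp_lipschitz.
  have Ka : 0 < K * a by rewrite mulr_gt0.
  have Fb t x : `|F t x| <= K * a by have [] := Hbound _ t (Bsub _ (cb x)).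
  have Fc x : continuous (F ^~ x) by exact: Hcont _ (Bsub _ (cb x)).
  have [y [y0 ylip yv]] := picard K0 Ka Flip Fb Fc (chart_coord cs g0).
  have yvel t : 0 <= t -> box us r (y t) -> velocity [set s | 0 <= s] y t (fld (y t) t).
    by move=> t0 Bt; have := yv t t0; rewrite /F clamp_id.
  have yin b t : 0 <= t <= b -> `|y t - us| < r.
    apply: (real_induction (P := fun t => `|y t - us| < r)).
    - by rewrite y0.
    - move=> s s0 ys; have /velocity_cvg yc := yv s s0.
      have rb : nbhs (y s) (ball us r).
        by apply: open_nbhs_nbhs; split; [exact: ball_open|rewrite -ball_normE /= distrC].
      have N1 : \forall x \near s, 0 <= x -> ball us r (y x) := yc _ rb.
      by apply: filterS N1 => x h x0; have := h x0; rewrite -ball_normE /= distrC.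
    - move=> T /andP[T0 Tb] HT; have T0' := ltW T0.
      have yc := velocity_cvg (yv T T0').
      have BT : box us r (y T).
        apply: (closed_left_limit (p := y) (compact_closed (@norm_hausdorff _ _)
          (@closed_box_compact _ _ us r)) T0 yc).
        by move=> s sT; apply: ltW; exact: HT.
      (* At the limit time closedness gives membership in the box only; the level bound, passing to
         the limit as a non-strict inequality, restores strictness. *)
      apply: inner => //.
      have jyc : j (y s) @[s --> within [set s | 0 <= s] (nbhs T)] --> j (y T).
        exact: (cvg_comp _ _ yc (jc _ (Bc _ BT))).
      apply: (closed_left_limit (p := j \o y) (@closed_le R (c + ka / 2)) T0 jyc).
      move=> s /andP[s0 sT]; apply: ltW; apply: (trap y s); last by rewrite s0 lexx.
        move=> t' /andP[t0' ts]; have h : `|y t' - us| < r.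
          by apply: HT; rewrite t0' (le_lt_trans ts).
        by split; [exact: ltW|apply: yvel => //; exact: ltW].
      by rewrite y0.
  exists (fun t => chart_inv cs (y t)); split; first by rewrite y0 chart_coordK.
  move=> t t0.
  have Bt : box us r (y t) by apply: ltW; apply: (yin t); rewrite t0 lexx.
  have cyt := Bc _ Bt.
  have E : es_field X J (fun=> a) (fun i => om * ratr (wb i)) (chart_inv cs (y t)) t =
      left_diff (chart_inv cs (y t)) (es_vector X J cs wr a om (y t) t : tangent (1%g : G)).
    by have := Hfield _ t (chart_inv_dom cyt); rewrite chart_invK.
  have V := chart_curve_velocity acs cyt (yvel t t0 Bt).
  exact: (eq_ind_r (fun v => has_velocity [set s | 0 <= s] (p := fun s => chart_inv cs (y s)) (t := t) v) V E).
(* Since the box lies over [U], the solution is in [U] from time 0 on. The continuation is repeated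
   for an arbitrary solution in the group, which could a priori also leave the chart. *)
move=> p [p0 pv]; exists 0 => // t0 t00.
pose u := chart_coord cs \o p.
have pvel t : 0 <= t -> chart_dom cs (p t) ->
    p s @[s --> within [set s | 0 <= s] (nbhs t)] --> p t /\
    velocity [set s | 0 <= s] u t (fld (u t) t).
  move=> tn pt; have V := eq_ind _ (fun v => has_velocity [set s | 0 <= s] (p := p) (t := t) v)
    (pv t tn) _ (Hfield (p t) t pt).
  have [pc uv] := (has_velocityP [set s | 0 <= s] (es_vector X J cs wr a om (u t) t) acs pt).1 V.
  split; first exact: pc.
  exact: (eq_ind_r (velocity [set s | 0 <= s] u t) uv (lfield_coord _ pt)).
pose P t := chart_dom cs (p t) /\ `|u t - us| < r.
have PP : forall b t, 0 <= t <= b -> P t.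
  move=> b; apply: real_induction.
  - by split; rewrite /u /= p0.
  - move=> s s0 [ps us_]; have [pc uv] := pvel s s0 ps.
    have N1 : \forall x \near s, 0 <= x -> chart_dom cs (p x) := pc _ (chart_dom_nbhs ps).
    have rb : nbhs (u s) (ball us r).
      by apply: open_nbhs_nbhs; split; [exact: ball_open|rewrite -ball_normE /= distrC].
    have N2 : \forall x \near s, 0 <= x -> ball us r (u x) := velocity_cvg uv rb.
    apply: filterS2 N1 N2 => x h1 h2 x0; split; first exact: h1.
    by have := h2 x0; rewrite -ball_normE /= distrC.
  - move=> T /andP[T0 Tb] HT; have T0' := ltW T0.
    have [pc _] := pv T T0'.
    have [|x Bx xE] := closed_left_limit (chart_box_closed Bc) T0 pc.
      move=> s sT; have [h1 h2] := HT s sT; exists (u s); first exact: ltW.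
      by rewrite /u /= chart_coordK.
    have cx := Bc _ Bx.
    have pT : chart_dom cs (p T) by rewrite -xE; exact: chart_inv_dom.
    have uT : u T = x by rewrite /u /= -xE chart_invK.
    split=> //; have [_ /velocity_cvg uc] := pvel T T0' pT.
    rewrite uT; apply: inner => //; rewrite -uT.
    have cuT : chart_img cs (u T) by rewrite uT.
    have juc : j (u s) @[s --> within [set s | 0 <= s] (nbhs T)] --> j (u T).
      exact: (cvg_comp _ _ uc (jc _ cuT)).
    apply: (closed_left_limit (p := j \o u) (@closed_le R (c + ka / 2)) T0 juc).
    move=> s /andP[s0 sT]; apply: ltW; apply: (trap u s); last by rewrite s0 lexx.
      move=> t' /andP[t0' ts].
      have [h1 h2] : P t' by apply: HT; rewrite t0' (le_lt_trans ts).
      by split; [exact: ltW|exact: (pvel t' t0' h1).2].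
    by rewrite /u /= p0.
have [h1 h2] : P t0 by apply: (PP t0); rewrite t00 lexx.
by rewrite -(chart_coordK h1); apply: rU; exact: ltW.
Qed.
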